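(* Let $f:[0,1]\to(0,1)$ and let $\alpha>0$ with $\alpha\notin\mathbb{N}$. (1) If $f\in C^\alpha[0,1]$, then $f$ can be simulated at the rate $(\Delta_n(x))^\alpha$ on $[0,1]$. Precisely, there exist polynomials $$g_n(x)=\sum_{k=0}^n\binom nk a(n,k)x^k(1-x)^{n-k},\qquad h_n(x)=\sum_{k=0}^n\binom nk b(n,k)x^k(1-x)^{n-k}\qquad(n\ge1)$$ such that: (i) $0\le a(n,k)\le b(n,k)\le 1$ for all $n\ge 1$, $0\le k\le n$; (ii') $\binom nk a(n,k)$ and $\binom nk b(n,k)$ are integer multiples of $2^{-n}$; (iii) $g_n(p)\le f(p)\le h_n(p)$ for all $p\in[0,1]$; (iv) for all $m<n$, $g_m\preceq_n g_n$ and $h_m\succeq_n h_n$; and $h_n(x)-g_n(x)=O((\Delta_n(x))^\alpha)$ uniformly in $x\in[0,1]$. (2) Conversely, if $f$ can be simulated at the rate $(\Delta_n(x))^\alpha$ on $[0,1]$, then $f\in C^\alpha[0,1]$.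
   Context: $\Delta_n(x)=\max\{\sqrt{x(1-x)/n},\,1/n\}$ for $x\in[0,1]$ and integers $n\ge1$. For non-integer $\alpha>0$ let $r=\lfloor\alpha\rfloor$; $f\in C^\alpha[0,1]$ means that $f$ is $r$ times differentiable on $[0,1]$ and $\omega(f^{(r)};h)=\sup_{x,y\in[0,1],|x-y|<h}|f^{(r)}(x)-f^{(r)}(y)|=O(h^{\alpha-r})$. For polynomials $q,r$ of degree at most $n$, $q\preceq_n r$ (equivalently $r\succeq_n q$) means that $r-q=\sum_{k=0}^n c_k\binom nk x^k(1-x)^{n-k}$ with all $c_k\ge0$. Simulation: one is given independent tosses of a coin with unknown heads probability $p$ and, independently, independent tosses of a fair coin; the $i$-th input is the pair consisting of the $i$-th toss of each. The law of the input sequence is denoted $\mathbb{P}_p$. A simulation algorithm for $f$ on $[0,1]$ consists of a stopping time $N\in\mathbb{N}\cup\{\infty\}$ for the input sequence (for each $k$, the event $\{N=k\}$ is determined by the first $k$ inputs), with $\mathbb{P}_p(N<\infty)=1$, and an output in $\{0,1\}$ (heads $=1$) determined by the first $N$ inputs, such that $\mathbb{P}_p(\text{output}=1)=f(p)$ for every $p\in[0,1]$; $N$ and the output rule do not depend on $p$. The function $f$ can be simulated at the rate $\psi_n(p)$ on $[0,1]$ if there is such an algorithm and a constant $C$ with $\mathbb{P}_p(N>n)\le C\psi_n(p)$ for all $n\ge1$ and $p\in[0,1]$. *)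

(* Defs.v *)
From HB Require Import structures.
From mathcomp Require Import all_boot all_order all_algebra.
From mathcomp Require Import all_classical all_reals all_analysis measurable_realfun.
From mathcomp Require Import lra.

Set Implicit Arguments.
Unset Strict Implicit.
Unset Printing Implicit Defensive.

Import Order.TTheory GRing.Theory Num.Theory.
Import numFieldNormedType.Exports.

Local Open Scope classical_set_scope.
Local Open Scope ring_scope.

Definition Delta (R : realType) (n : nat) (x : R) : R :=
  Num.max (Num.sqrt (x * (1 - x) / n%:R)) n%:R^-1.

(* The limit is taken within [0, 1], hence one-sided at the endpoints; values
   of g outside [0, 1] are irrelevant. *)
Definition deriv_on01 (R : realType) (g g' : R -> R) : Prop :=
  forall x : R, x \in `[0, 1] ->
    (g y - g x) / (y - x) @[y --> within `[0, 1] x^'] --> g' x.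

(* The supremum is extended-real valued: it is +oo when unbounded. *)
Definition modulus01 (R : realType) (g : R -> R) (h : R) : \bar R :=
  ereal_sup [set e | exists x y : R,
    [/\ x \in `[0, 1], y \in `[0, 1], `|x - y| < h & e = `|g x - g y|%:E]].

(* D k is the k-th derivative of f on [0, 1]. *)
Definition C_alpha01 (R : realType) (alpha : R) (f : R -> R) : Prop :=
  let r := Num.truncn alpha in
  exists D : nat -> R -> R,
    [/\ {in `[0, 1], D 0%N =1 f},
        (forall k, (k < r)%N -> deriv_on01 (D k) (D k.+1)) &
        exists C : R, \forall h \near 0^'+,
          (modulus01 (D r) h <= (C * h `^ (alpha - r%:R))%:E)%E].

Definition bernstein (R : realType) (n : nat) (c : nat -> R) : {poly R} :=
  \sum_(k < n.+1) ('C(n, k)%:R * c k) *: ('X^k * (1 - 'X) ^+ (n - k)).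

Definition bernstein_le (R : realType) (n : nat) (q r : {poly R}) : Prop :=
  exists c : nat -> R, (forall k, (k <= n)%N -> 0 <= c k) /\
    r - q = bernstein n c.

(* One input: the toss of the p-coin, then the toss of the fair coin
   (true = heads). *)
Definition input : Type := (bool * bool)%type.

Definition cylinder (w : seq input) : set (nat -> input) :=
  [set s | mkseq s (size w) = w].

(* Input sequences, with the product sigma-algebra. *)
Notation inputs := (g_sigma_algebraType (range cylinder)).

(* The law of the inputs is realised as the image of the uniform distribution
   on [0, 1] under the following map: [toss q u] is a toss of a q-coin read off
   the uniform variable u, and [rest q u] is again uniform and independent of
   it. Lemma input_law_cylinder below states that this is the product law; the
   cylinders form, up to the empty set, a pi-system generating the
   sigma-algebra, so the law is characterised by that lemma. *)
Definition toss (R : realType) (q u : R) : bool := u < q.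

Definition rest (R : realType) (q u : R) : R :=
  if u < q then u / q else (u - q) / (1 - q).

Definition read_input (R : realType) (p u : R) : input :=
  (toss p u, toss 2^-1 (rest p u)).

Definition rest_input (R : realType) (p u : R) : R := rest 2^-1 (rest p u).

Definition read_inputs (R : realType) (p : R) : measurableTypeR R -> inputs :=
  fun u i => read_input p (iter i (rest_input p) u).

Lemma measurable_rest (R : realType) (q : R) : measurable_fun setT (rest q).
Proof.
apply: measurable_fun_ifT.
- by apply: measurable_fun_ltr => //; exact: measurable_cst.
- exact: measurable_funM.
- by apply: measurable_funM => //; exact: measurable_funB.
Qed.

Lemma measurable_rest_input (R : realType) (p : R) i :
  measurable_fun setT (fun u => iter i (rest_input p) u).
Proof.
elim: i => [|i IH] /=; first exact: measurable_id.
apply: (measurableT_comp (measurable_rest _)).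
exact: (measurableT_comp (measurable_rest _)).
Qed.

Lemma read_inputs_cons (R : realType) (p u : R) (x : input) (w : seq input) :
  cylinder (x :: w) (read_inputs p u) <->
  read_input p u = x /\ cylinder w (read_inputs p (rest_input p u)).
Proof.
rewrite /cylinder /mkseq /= (iotaDl 1 0) -map_comp.
have -> : [seq (read_inputs p u \o addn 1) i | i <- iota 0 (size w)] =
          [seq read_inputs p (rest_input p u) i | i <- iota 0 (size w)].
  by apply: eq_map => i; rewrite /read_inputs/= -iterSr.
by split => [[h1 h2]|[h1 h2]]; [split|congr (_ :: _)].
Qed.

Lemma measurable_read_inputs (R : realType) (p : R) :
  measurable_fun setT (read_inputs p).
Proof.
apply: (@measurability _ _ _ inputs _ _ (range cylinder) erefl).
move=> _ [_ [w _ <-] <-]; rewrite setTI.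
have mtoss q i (g : R -> R) : measurable_fun setT g ->
    measurable_fun setT (fun u => toss q (g (iter i (rest_input p) u))).
  move=> mg; apply: measurable_fun_ltr; last exact: measurable_cst.
  exact: (measurableT_comp mg (measurable_rest_input p i)).
have [->|w0] := eqVneq w [::].
  rewrite [X in measurable X](_ : _ = setT)//.
  by apply/seteqP; split.
have -> : read_inputs p @^-1` cylinder w =
  \bigcap_(i in [set i | (i < size w)%N])
    [set u | read_inputs p u i = nth (false, false) w i].
  apply/seteqP; split=> u /=.
    by rewrite /cylinder/= => <- i /=; rewrite size_mkseq => il; rewrite nth_mkseq.
  move=> H; apply: (@eq_from_nth _ (false, false)); first by rewrite size_mkseq.
  by move=> i; rewrite size_mkseq => il; rewrite nth_mkseq// H.
apply: bigcap_measurable.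
  by exists 0%N; rewrite /= lt0n size_eq0.
move=> i _.
case: (nth _ _ _) => b c.
have -> : [set u | read_inputs p u i = (b, c)] =
  ((fun u => toss p (iter i (rest_input p) u)) @^-1` [set b]) `&`
  ((fun u => toss 2^-1 (rest p (iter i (rest_input p) u))) @^-1` [set c]).
  by apply/seteqP; split=> u /=; rewrite /read_inputs /read_input; [case|case=> -> ->].
apply: measurableI; rewrite -[X in measurable X]setTI.
  exact: (mtoss p i id).
by apply: (mtoss 2^-1 i (rest p)) => //; exact: measurable_rest.
Qed.

HB.instance Definition _ (R : realType) (p : R) :=
  isMeasurableFun.Build _ _ (measurableTypeR R) inputs (read_inputs p)
    (measurable_read_inputs p).

(* For p outside [0, 1] this is a junk probability. *)
Definition input_law (R : realType) (p : R) : probability inputs R :=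
  distribution (uniform_prob (@ltr01 R)) (read_inputs p).

Lemma rest01 (R : realType) (q u : R) :
  0 <= q <= 1 -> 0 <= u < 1 -> 0 <= rest q u < 1.
Proof.
move=> /andP[q0 q1] /andP[u0 u1]; rewrite /rest; case: ltP => uq.
  have q_gt0 : 0 < q by apply: le_lt_trans uq.
  by rewrite divr_ge0//= ltr_pdivrMr// mul1r.
have q_lt1 : 0 < 1 - q by rewrite subr_gt0; apply: le_lt_trans u1.
by rewrite divr_ge0 ?subr_ge0//= ltr_pdivrMr// mul1r ltrD2r.
Qed.

Lemma toss_rest_itv (R : realType) (q a l : R) (b : bool) :
    0 <= q <= 1 -> 0 <= a -> 0 <= l -> a + l <= 1 ->
  exists a', [/\ 0 <= a', 0 <= bernoulli_pmf q b * l, a' + bernoulli_pmf q b * l <= 1 &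
    forall u, 0 <= u < 1 ->
      (toss q u = b /\ a <= rest q u < a + l) <->
      a' <= u < a' + bernoulli_pmf q b * l].
Proof.
move=> /andP[q0 q1] a0 l0 al1; rewrite /toss /rest; case: b => /=.
  exists (a * q); split; [exact: mulr_ge0|exact: mulr_ge0|nra|].
  move=> u /andP[u0 u1]; case: ltP => uq.
    have q_gt0 : 0 < q by apply: le_lt_trans uq.
    rewrite ler_pdivlMr// ltr_pdivrMr// [q * l]mulrC -mulrDl.
    by split => [[]|].
  split => [[]//|/andP[h1 h2]]; exfalso; nra.
exists (q + (1 - q) * a); have q1' : 0 <= 1 - q by rewrite subr_ge0.
split; [by rewrite addr_ge0// mulr_ge0|exact: mulr_ge0|nra|].
move=> u /andP[u0 u1]; case: ltP => uq.
  split => [[]//|/andP[h1 h2]]; exfalso; nra.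
have q_lt1 : 0 < 1 - q by rewrite subr_gt0; apply: le_lt_trans u1.
rewrite ler_pdivlMr// ltr_pdivrMr// lerBrDl ltrBlDl -addrA -mulrDr.
rewrite [a * _]mulrC [(a + l) * _]mulrC.
by split => [[]|].
Qed.

Lemma cylinder_itv (R : realType) (p : R) (w : seq input) : 0 <= p <= 1 ->
  let l := \prod_(x <- w) (bernoulli_pmf p x.1 * bernoulli_pmf 2^-1 x.2) in
  exists a, [/\ 0 <= a, 0 <= l, a + l <= 1 &
    forall u, 0 <= u < 1 -> cylinder w (read_inputs p u) <-> a <= u < a + l].
Proof.
move=> p01 /=; have h01 : 0 <= (2^-1 : R) <= 1 by lra.
elim: w => [|[b c] w [a [a0 l0 al1 IH]]].
  by exists 0; rewrite big_nil add0r; split => // u u01.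
rewrite big_cons /=; set l := \prod_(_ <- _) _ in l0 al1 IH *.
have [a1 [a10 l10 al11 H1]] := toss_rest_itv c h01 a0 l0 al1.
have [a2 [a20 l20 al21 H2]] := toss_rest_itv b p01 a10 l10 al11.
exists a2; rewrite -mulrA; split => // u u01.
rewrite read_inputs_cons -(H2 u u01) -(H1 _ (rest01 p01 u01)).
rewrite -IH; last by apply: rest01 => //; exact: rest01.
rewrite /read_input; split => [[[-> ->] ?]//|[-> [-> ?]]//].
Qed.

Lemma measurable_cylinder (w : seq input) : measurable (cylinder w : set inputs).
Proof. by apply: sub_sigma_algebra; exists w. Qed.

Lemma input_law_cylinder (R : realType) (p : R) (w : seq input) :
  0 <= p <= 1 ->
  input_law p (cylinder w) =
    (\prod_(x <- w) (bernoulli_pmf p x.1 * bernoulli_pmf 2^-1 x.2))%:E.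
Proof.
move=> p01; have [a [a0 l0 al1 H]] := cylinder_itv w p01.
set l := \prod_(_ <- _) _ in l0 al1 H *.
rewrite [LHS](_ : _ = (\int[lebesgue_measure]_(x in read_inputs p @^-1` cylinder w)
  (uniform_pdf 0 1 x)%:E)%E)//.
rewrite integral_uniform_pdf.
have mP : measurable (read_inputs p @^-1` cylinder w).
  by rewrite -[X in measurable X]setTI; apply: measurable_read_inputs => //;
     exact: measurable_cylinder.
rewrite (eq_integral (fun=> 1%E)); last first.
  move=> x; rewrite inE/= in_itv/= /uniform_pdf => -[_ ->].
  by rewrite subr0 invr1.
rewrite integral_cst//; last exact: measurableI.
rewrite mul1e.
have -> : read_inputs p @^-1` cylinder w `&` `[0, 1] =
    `[a, a + l[ `|` (read_inputs p @^-1` cylinder w `&` [set 1]).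
  apply/seteqP; split => u /=; rewrite !in_itv/=.
    move=> [cu /andP[u0]]; rewrite le_eqVlt => /orP[/eqP u1|u1].
      by right; split.
    by left; apply/(H u) => //; rewrite u0.
  case=> [/andP[u0 u1]|[cu u1]]; last by split => //; rewrite u1 ler01 lexx.
  have u01 : 0 <= u < 1 by lra.
  by split; [apply/(H u) => //; rewrite u0|lra].
have m1 : measurable (read_inputs p @^-1` cylinder w `&` [set 1]).
  exact: measurableI.
rewrite measureU0//; last first.
  by apply: (subset_measure0 m1 _ _ (lebesgue_measure_set1 (1 : R))).
rewrite -[LHS]/(lebesgue_measure `[a, a + l[) lebesgue_measure_itv/= lte_fin.
by case: ltP => al; rewrite -?EFinB; congr (_%:E); lra.
Qed.

(* The stopping time takes values in option nat, with None for infinity. *)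
Definition stopping_time (N : inputs -> option nat) : Prop :=
  forall (k : nat) (s t : inputs),
    mkseq s k = mkseq t k -> N s = Some k -> N t = Some k.

Definition stops (N : inputs -> option nat) : set inputs :=
  [set s | exists k, N s = Some k].

Definition runs_past (N : inputs -> option nat) (n : nat) : set inputs :=
  [set s | if N s is Some k then (n < k)%N else True].

(* The output rule [out] is applied to the list of the first N inputs. *)
Definition outputs_heads (N : inputs -> option nat) (out : seq input -> bool) :
    set inputs :=
  [set s | exists2 k, N s = Some k & out (mkseq s k)].

Definition simulation (R : realType) (f : R -> R)
    (N : inputs -> option nat) (out : seq input -> bool) : Prop :=
  stopping_time N /\
  forall p : R, p \in `[0, 1] ->
    input_law p (stops N) = 1%E /\
    input_law p (outputs_heads N out) = (f p)%:E.

Definition can_simulate (R : realType) (f : R -> R) (psi : nat -> R -> R) :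
    Prop :=
  exists (N : inputs -> option nat) (out : seq input -> bool),
    simulation f N out /\
    exists C : R, forall (n : nat) (p : R), (1 <= n)%N -> p \in `[0, 1] ->
      (input_law p (runs_past N n) <= (C * psi n p)%:E)%E.

(* Main.v *)
Require Import Defs.
From HB Require Import structures.
From mathcomp Require Import all_boot all_order all_algebra.
From mathcomp Require Import all_classical all_reals all_analysis.
From mathcomp Require Import complex.
From mathcomp Require Import ring lra zify.

Set Implicit Arguments.
Unset Strict Implicit.
Unset Printing Implicit Defensive.

Import Order.TTheory GRing.Theory Num.Theory.
Import numFieldNormedType.Exports.

Local Open Scope classical_set_scope.
Local Open Scope ring_scope.

(** A simulation produces polynomials with nonnegative Bernstein coefficients: whether
the algorithm has stopped by time n with output heads depends on the first n
inputs, and a word of n inputs with h heads has probability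
2^-n p^h (1 - p)^(n - h). The theorem is therefore about the approximation of f
by monotone sequences of polynomials, for the order given by the signs of the
Bernstein coefficients.

From smoothness to simulation. Let A n k be the k-th Bernstein coefficient, in
degree n, of the Taylor polynomial of f at k / n ([taylor_coef]). Evaluation at
a point x, and likewise taking the k-th Bernstein coefficient in a higher degree
n with x = k / n, averages the coefficients of degree m by weights that are
concentrated at distance Delta m x from x ([averages], [avg_powR]). Such an
average reproduces polynomials exactly, and the Taylor polynomials at x and at
i / m differ by Taylor remainders; so the average of A m differs from f x,
respectively from A n k, by O(Delta m x ^ alpha) ([avg_taylor_coef]).
Subtracting K Delta^alpha from A turns this into a sequence that increases along
the degrees n0 M^j: the average of Delta^alpha in degree m is at least
c Delta m x ^ alpha ([avg_Delta_coef_ge]), while Delta (M m) x ^ alpha is smaller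
by the factor M^(alpha / 2), so that for large M and K the gain exceeds the
error and also pays for rounding the coefficients to dyadic numbers
([lower_data_exist]). Applied to f and to 1 - f this gives the envelopes
([envelopes_exist]). Monotone envelopes prescribe how many words with h heads
are to be accepted and rejected by time n, and sets of words with these
cardinalities can be chosen compatibly for all n
([decided_count], [simulate_envelopes]).

From simulation to smoothness. Looking at the algorithm at the times 2^j writes
f as a series of polynomials G of degree n = 2^(j+1) with nonnegative Bernstein
coefficients and G = O(Delta n ^ alpha). By the triangle inequality
|G z| <= S^n G (|z| / S) with S = |z| + |1 - z| for every complex z. In the disc
of radius Delta n x / 2 about x one has S <= 1 + 1 / n, so Cauchy's estimate
bounds the k-th derivative of G at x by O(Delta n x ^ (alpha - k))
([bernstein_derivn_le]). Hence the series can be differentiated floor(alpha)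
times, and the modulus of continuity of the last derivative is obtained by using
the mean value theorem in the terms with Delta n x larger than the increment h,
and the size of the terms in the others ([two_regime_sum],
[C_alpha01_of_series]). *)

(** * Bernstein coefficients as linear functionals *)

(** The dual basis of the Bernstein basis of degree n: the k-th coefficient of X^j is
k (k - 1) ... (k - j + 1) / (n (n - 1) ... (n - j + 1)). Cutting the sum at n
makes this linear on all polynomials. *)
Definition bcoef (R : realType) (n k : nat) (q : {poly R}) : R :=
  \sum_(j < n.+1) q`_j * ((k ^_ j)%:R / (n ^_ j)%:R).

Lemma bcoef_is_linear (R : realType) (n k : nat) :
  linear_for *%R (@bcoef R n k).
Proof.
move=> a p q; rewrite /bcoef mulr_sumr -big_split/=.
by apply: eq_bigr => j _; rewrite coefD coefZ; ring.
Qed.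

HB.instance Definition _ (R : realType) (n k : nat) :=
  GRing.isLinear.Build R {poly R} R *%R (@bcoef R n k) (@bcoef_is_linear R n k).

Lemma bcoefXn (R : realType) (n k j : nat) : (j <= n)%N ->
  bcoef n k ('X^j : {poly R}) = (k ^_ j)%:R / (n ^_ j)%:R.
Proof.
move=> jn; rewrite /bcoef (bigD1 (Ordinal (jn : (j < n.+1)%N)))//= coefXn eqxx mul1r.
rewrite big1 ?addr0// => i /negPf ij; rewrite coefXn.
by rewrite -[X in X == _]/(val i) (_ : (val i == j) = false) ?mul0r// -ij.
Qed.

Lemma bcoef1 (R : realType) (n k : nat) : bcoef n k (1 : {poly R}) = 1.
Proof. by rewrite -(expr0 'X) bcoefXn// !ffactn0 divr1. Qed.

Lemma bcoefXn_bin (R : realType) (n k j : nat) : (k <= n)%N -> (j <= n)%N ->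
  'C(n, k)%:R * bcoef n k ('X^j : {poly R}) =
    (if (j <= k)%N then 'C(n - j, k - j) else 0%N)%:R.
Proof.
move=> kn jn; rewrite bcoefXn//.
have n0 : (n ^_ j)%:R != 0 :> R by rewrite pnatr_eq0 -lt0n ffact_gt0.
apply: (mulIf n0); rewrite mulrA divfK// -!natrM; congr (_%:R).
case: leqP => jk; last by rewrite ffact_small ?muln0.
elim: j n k {n0} kn jn jk => [|j IH] n k kn jn jk.
  by rewrite !subn0 !ffactn0.
case: n kn jn => [|n]// kn jn; case: k kn jk => [|k]// kn jk.
rewrite !subSS !ffactSS mulnA [(_ * k.+1)%N]mulnC -mul_bin_diag -mulnA IH//.
by rewrite mulnCA.
Qed.

(** Elevation of the degree from m to n. These hypergeometric weights are
nonnegative, which is why coefficients in degree n are averages of those in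
degree m. *)
Lemma bcoef_basis (R : realType) (n k m i : nat) :
    (k <= n)%N -> (m <= n)%N -> (i <= m)%N ->
  'C(n, k)%:R * bcoef n k ('X^i * (1 - 'X) ^+ (m - i) : {poly R}) =
    (if (i <= k)%N then 'C(n - m, k - i) else 0%N)%:R.
Proof.
move=> kn mn im; move E : (m - i)%N => d.
have {E} Em : m = (i + d)%N by lia.
elim: d i m Em im mn => [|d IH] i m Em im mn.
  by rewrite expr0 mulr1 bcoefXn_bin//; [rewrite Em addn0 | lia].
have -> : 'X^i * (1 - 'X) ^+ d.+1 =
    'X^i * (1 - 'X) ^+ d - 'X^(i.+1) * (1 - 'X) ^+ d :> {poly R}.
  by rewrite !exprS; ring.
rewrite linearB/= mulrBr (IH i m.-1) ?(IH i.+1 m); [|lia..].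
case: (ltngtP i k) => ik.
- have -> : (n - m.-1 = (n - m).+1)%N by lia.
  have -> : (k - i = (k - i.+1).+1)%N by lia.
  by rewrite binS natrD addrK.
- by rewrite subrr.
- by rewrite ik subnn !bin0 subr0.
Qed.

Lemma bcoef_basis_ge0 (R : realType) (n k m i : nat) :
    (k <= n)%N -> (m <= n)%N -> (i <= m)%N ->
  0 <= bcoef n k ('X^i * (1 - 'X) ^+ (m - i) : {poly R}).
Proof.
move=> kn mn im; have C0 : 0 < 'C(n, k)%:R :> R by rewrite ltr0n bin_gt0.
by rewrite -(pmulr_rge0 _ C0) bcoef_basis// ler0n.
Qed.

Lemma bcoef_bernstein (R : realType) (n k : nat) (c : nat -> R) : (k <= n)%N ->
  bcoef n k (bernstein n c) = c k.
Proof.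
move=> kn; rewrite /bernstein linear_sum/= (bigD1 (Ordinal (kn : (k < n.+1)%N)))//=.
have C0 : 'C(n, k)%:R != 0 :> R by rewrite pnatr_eq0 -lt0n bin_gt0.
rewrite big1 ?addr0 => [|i ik].
  apply: (mulfI C0); rewrite linearZ/= mulrCA bcoef_basis// leqnn !subnn bin0.
  by rewrite mulr1 mulrC.
rewrite linearZ/=; apply: (mulfI C0).
rewrite mulrCA bcoef_basis//; last by rewrite -ltnS.
rewrite subnn mulr0; case: leqP => ik'; last by rewrite mulr0.
rewrite bin0n (_ : (k - i == 0)%N = false) ?mulr0//.
apply/negbTE; apply: contra ik => ki; apply/eqP/val_inj => /=.
by move: ki ik'; rewrite subn_eq0 => ki ik'; apply/eqP; rewrite eqn_leq ki ik'.
Qed.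

Lemma bernstein_linear (R : realType) (n : nat) (a : R) (c d : nat -> R) :
  bernstein n (fun k => a * c k + d k) = a *: bernstein n c + bernstein n d.
Proof.
rewrite /bernstein scaler_sumr -big_split/=; apply: eq_bigr => k _.
by rewrite scalerA -scalerDl; congr (_ *: _); ring.
Qed.

Lemma bernsteinB (R : realType) (n : nat) (c d : nat -> R) :
  bernstein n (fun k => c k - d k) = bernstein n c - bernstein n d.
Proof.
rewrite addrC -scaleN1r -bernstein_linear; congr bernstein.
by apply/funext => k; rewrite mulN1r addrC.
Qed.

Lemma eq_bernstein (R : realType) (n : nat) (c d : nat -> R) :
  (forall k, (k <= n)%N -> c k = d k) -> bernstein n c = bernstein n d.
Proof.
move=> cd; apply: eq_bigr => k _; rewrite cd//.
by rewrite -ltnS.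
Qed.

Lemma bernstein_geom (R : realType) (n : nat) (u v : R) :
  bernstein n (fun k => u ^+ k * v ^+ (n - k)) =
    (u *: 'X + v *: (1 - 'X)) ^+ n.
Proof.
rewrite addrC exprDn; apply: eq_bigr => k _.
rewrite !exprZn; set a := 'X^k; set b := (1 - 'X) ^+ _.
by rewrite -!mul_polyC !polyCM polyC_natr; ring.
Qed.

Lemma size_bernstein (R : realType) (n : nat) (c : nat -> R) :
  (size (bernstein n c) <= n.+1)%N.
Proof.
apply: (leq_trans (size_sum _ _ _)); apply/bigmax_leqP => k _.
apply: (leq_trans (size_scale_leq _ _)).
apply: (leq_trans (size_polyMleq _ _)).
have s1 : (size (1 - 'X : {poly R})%R <= 2)%N.
  by rewrite -opprB size_polyN size_XsubC.
have s2 : (size ((1 - 'X) ^+ (n - k) : {poly R})%R <= (n - k).+1)%N.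
  apply: (leq_trans (size_poly_exp_leq _ _)).
  rewrite ltnS -[leqRHS]mul1n leq_mul2r; apply/orP; right.
  by move: s1; case: size => [|[|[]]].
rewrite size_polyXn; have := ltn_ord k; lia.
Qed.

(** For the monomial X^j, expand X^j (X + (1 - X))^(n - j). *)
Lemma bernstein_bcoef (R : realType) (n : nat) (q : {poly R}) :
  (size q <= n.+1)%N -> bernstein n (fun k => bcoef n k q) = q.
Proof.
move=> sq.
have mono j : (j <= n)%N ->
    bernstein n (fun k => bcoef n k ('X^j : {poly R})) = 'X^j.
  move=> jn.
  have sumX : 'X + (1 - 'X) = 1 :> {poly R} by rewrite addrC subrK.
  transitivity ('X^j * bernstein (n - j) (fun k => 1 ^+ k * 1 ^+ (n - j - k)) : {poly R});
    last by rewrite bernstein_geom !scale1r sumX expr1n mulr1.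
  rewrite /bernstein mulr_sumr.
  rewrite -(big_mkord xpredT (fun k => ('C(n, k)%:R * bcoef n k ('X^j : {poly R})) *:
     ('X^k * (1 - 'X) ^+ (n - k) : {poly R}))).
  rewrite (big_cat_nat (n := j))//=; last lia.
  rewrite big_nat_cond big1 ?add0r => [|k /andP[/andP[_ kj] _]]; last first.
    by rewrite bcoefXn_bin//; [rewrite leqNgt kj scale0r | lia].
  rewrite -{1}[j]add0n big_addn subSn// big_mkord; apply: eq_bigr => k _.
  have kn := ltn_ord k.
  rewrite !expr1n !mulr1 -scalerAr mulrA -exprD bcoefXn_bin//; last lia.
  rewrite leq_addl addnK [(j + k)%N]addnC; congr (_ *: (_ * _ ^+ _)); lia.
rewrite -[in RHS](coefK q) poly_def.
transitivity (\sum_(j < n.+1) q`_j *: 'X^j : {poly R}); last first.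
  rewrite (big_ord_widen _ (fun j => q`_j *: 'X^j) sq) [in RHS]big_mkcond/=.
  apply: eq_bigr => j _; case: ltnP => // sj.
  by rewrite nth_default// scale0r.
transitivity (\sum_(j < n.+1) q`_j *:
    bernstein n (fun k => bcoef n k ('X^j : {poly R}))); last first.
  by apply: eq_bigr => j _; rewrite mono// -ltnS.
rewrite /bernstein (eq_bigr _ (fun j _ => scaler_sumr _ _ _ _)) exchange_big/=.
apply: eq_bigr => k _; rewrite (eq_bigr _ (fun j _ => scalerA _ _ _)) -scaler_suml.
congr (_ *: _); rewrite {1}/bcoef mulr_sumr; apply: eq_bigr => j _.
have jn : (j <= n)%N by rewrite -ltnS.
by rewrite bcoefXn//; ring.
Qed.

Lemma bernstein_leP (R : realType) (n : nat) (q r : {poly R}) :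
    (size q <= n.+1)%N -> (size r <= n.+1)%N ->
  (forall k, (k <= n)%N -> bcoef n k q <= bcoef n k r) -> bernstein_le n q r.
Proof.
move=> sq sr qr; exists (fun k => bcoef n k (r - q)); split.
  by move=> k kn; rewrite linearB/= subr_ge0 qr.
rewrite bernstein_bcoef//; apply: (leq_trans (size_polyD _ _)).
by rewrite size_polyN geq_max sr sq.
Qed.

Lemma bernstein_le_bcoef (R : realType) (n k : nat) (q r : {poly R}) :
  (k <= n)%N -> bernstein_le n q r -> bcoef n k q <= bcoef n k r.
Proof.
move=> kn [c [c0 rq]]; rewrite -subr_ge0 -linearB/= rq bcoef_bernstein//.
exact: c0.
Qed.

Lemma basis_ge0 (R : realType) (i j : nat) (x : R) : x \in `[0, 1] ->
  0 <= ('X^i * (1 - 'X) ^+ j : {poly R}).[x].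
Proof.
rewrite in_itv/= => /andP[x0 x1].
by rewrite !hornerE mulr_ge0 ?exprn_ge0// subr_ge0.
Qed.

Lemma horner_bernstein (R : realType) (n : nat) (c : nat -> R) (x : R) :
  (bernstein n c).[x] =
    \sum_(k < n.+1) 'C(n, k)%:R * c k * (x ^+ k * (1 - x) ^+ (n - k)).
Proof.
by rewrite /bernstein horner_sum; apply: eq_bigr => k _; rewrite !hornerE.
Qed.

(** * The scale of approximation *)

Lemma Delta_gt0 (R : realType) (n : nat) (x : R) : (1 <= n)%N -> 0 < Delta n x.
Proof. by move=> n0; rewrite lt_max invr_gt0 ltr0n n0 orbT. Qed.

Lemma Delta_ge_inv (R : realType) (n : nat) (x : R) : n%:R^-1 <= Delta n x.
Proof. by rewrite le_max lexx orbT. Qed.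

Lemma Delta_sqr (R : realType) (n : nat) (x : R) : x \in `[0, 1] ->
  Delta n x ^+ 2 = Num.max (x * (1 - x) / n%:R) (n%:R^-1 ^+ 2).
Proof.
rewrite in_itv/= => /andP[x0 x1].
have n0 : 0 <= n%:R^-1 :> R by rewrite invr_ge0.
have v0 : 0 <= x * (1 - x) / n%:R by rewrite !mulr_ge0// subr_ge0.
have s0 := sqrtr_ge0 (x * (1 - x) / n%:R).
rewrite /Delta -[in RHS](sqr_sqrtr v0).
by rewrite !maxEle ler_pXn2r ?nnegrE//; case: ifP.
Qed.

Lemma Delta_sqr_le (R : realType) (n : nat) (x : R) : (1 <= n)%N ->
  x \in `[0, 1] -> Delta n x ^+ 2 <= n%:R^-1.
Proof.
move=> n0 x01; rewrite Delta_sqr//; move: x01; rewrite in_itv/= => /andP[x0 x1].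
have n1 : 0 < (n%:R^-1 : R) <= 1 by rewrite invr_gt0 ltr0n n0 invf_le1 ?ler1n ?ltr0n.
by rewrite ge_max; apply/andP; split; nra.
Qed.

Lemma Delta_le1 (R : realType) (n : nat) (x : R) : (1 <= n)%N ->
  x \in `[0, 1] -> Delta n x <= 1.
Proof.
move=> n0 x01; have d0 := Delta_gt0 x n0.
rewrite -(ler_pXn2r (n := 2))// ?nnegrE ?(ltW d0)// expr1n.
by rewrite (le_trans (Delta_sqr_le _ _))// invf_le1 ?ler1n ?ltr0n.
Qed.

(** The function x (1 - x) is 1-Lipschitz on the unit interval and 1 / n <= Delta n z. *)
Lemma Delta_sqr_shift (R : realType) (n : nat) (x z : R) : (1 <= n)%N ->
  x \in `[0, 1] -> z \in `[0, 1] ->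
  Delta n x ^+ 2 <= Delta n z ^+ 2 + `|x - z| * Delta n z.
Proof.
move=> n0 x01 z01; rewrite (Delta_sqr _ x01).
have := Delta_sqr n z01; have := Delta_gt0 z n0.
move: (Delta n z) => e e0 e2.
have h1 : z * (1 - z) / n%:R <= e ^+ 2 by rewrite e2 le_max lexx.
have h2 : n%:R^-1 ^+ 2 <= e ^+ 2 by rewrite e2 le_max lexx orbT.
have a0 := normr_ge0 (x - z).
have ae : 0 <= `|x - z| * e by rewrite mulr_ge0// ltW.
rewrite ge_max; apply/andP; split; last by lra.
have n1 : 0 < n%:R^-1 :> R by rewrite invr_gt0 ltr0n.
move: x01 z01; rewrite !in_itv/= => /andP[x0 x1] /andP[z0 z1].
have h3 : x * (1 - x) <= z * (1 - z) + `|x - z|.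
  by case: (leP 0 (x - z)) => h; [rewrite ger0_norm// | rewrite ltr0_norm//]; nra.
have : x * (1 - x) * n%:R^-1 <= (z * (1 - z) + `|x - z|) * n%:R^-1.
  by rewrite ler_wpM2r// ltW.
by nra.
Qed.

Lemma Delta_shift (R : realType) (n : nat) (x z : R) : (1 <= n)%N ->
  x \in `[0, 1] -> z \in `[0, 1] -> Delta n x <= Delta n z + `|x - z|.
Proof.
move=> n0 x01 z01; have := Delta_sqr_shift n0 x01 z01.
have := Delta_gt0 x n0; have := Delta_gt0 z n0; have := normr_ge0 (x - z).
set a := `|_|; set d := Delta n x; set e := Delta n z => a0 e0 d0 h.
by rewrite leNgt; apply/negP => h'; nra.
Qed.

(** Delta varies by a bounded factor over distances of its own size. Here the factor
multiplies the value at the other point z, as lower bounds for averages of Delta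
require. *)
Lemma Delta_shift_rel (R : realType) (n : nat) (x z : R) : (1 <= n)%N ->
  x \in `[0, 1] -> z \in `[0, 1] ->
  Delta n x <= Delta n z * (1 + `|z - x| / Delta n x).
Proof.
move=> n0 x01 z01; have := Delta_sqr_shift n0 x01 z01; rewrite distrC.
have := Delta_gt0 x n0; have := Delta_gt0 z n0; have := normr_ge0 (z - x).
set a := `|_|; set d := Delta n x; set e := Delta n z => a0 e0 d0 h.
have t0 : 0 <= a / d by rewrite divr_ge0// ltW.
have ad : a = (a / d) * d by rewrite divfK// gt_eqF.
move: h t0; rewrite {1}ad; move: (a / d) => t h t0.
by rewrite leNgt; apply/negP => h'; nra.
Qed.

Lemma Delta_mul (R : realType) (l n : nat) (x : R) : (1 <= l)%N -> (1 <= n)%N ->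
  x \in `[0, 1] -> Delta (l * n) x <= Delta n x / Num.sqrt l%:R.
Proof.
move=> l0 n0 x01.
have s0 : 0 < Num.sqrt l%:R :> R by rewrite sqrtr_gt0 ltr0n.
have ln : (1 <= l * n)%N by rewrite muln_gt0 l0.
have d0 := ltW (Delta_gt0 x ln).
rewrite -(ler_pXn2r (n := 2)) ?nnegrE ?divr_ge0 ?(ltW s0) ?(ltW (Delta_gt0 x n0))//.
rewrite exprMn exprVn sqr_sqrtr// !Delta_sqr//.
have n1 : 0 < n%:R^-1 :> R by rewrite invr_gt0 ltr0n.
have l1 : 0 < (l%:R^-1 : R) <= 1 by rewrite invr_gt0 ltr0n l0 invf_le1 ?ler1n ?ltr0n.
rewrite natrM invfM maxr_pMl; last by lra.
move: l1 n1; move: l%:R^-1 n%:R^-1 => u v u1 v0.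
rewrite ge_max !le_max; apply/andP; split; apply/orP; [left|right]; first by lra.
rewrite exprMn [leRHS]mulrC ler_wpM2r ?sqr_ge0//; nra.
Qed.

Lemma Delta_le_mul (R : realType) (l m n : nat) (x : R) :
    (1 <= l)%N -> (1 <= m)%N -> (m <= n)%N -> (n <= l * m)%N ->
  x \in `[0, 1] -> Delta m x <= l%:R * Delta n x.
Proof.
move=> l0 m0 mn nlm x01; have n0 : (1 <= n)%N by lia.
have lR : 1 <= l%:R :> R by rewrite ler1n.
have d0 := ltW (Delta_gt0 x m0); have e0 := ltW (Delta_gt0 x n0).
rewrite -(ler_pXn2r (n := 2)) ?nnegrE ?mulr_ge0//.
rewrite exprMn !Delta_sqr//.
have m1 : 0 < m%:R^-1 :> R by rewrite invr_gt0 ltr0n.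
have n1 : 0 < n%:R^-1 :> R by rewrite invr_gt0 ltr0n.
have mn1 : m%:R^-1 <= l%:R * n%:R^-1 :> R.
  rewrite ler_pdivlMr ?ltr0n// mulrC ler_pdivrMr ?ltr0n//.
  by rewrite -natrM ler_nat.
rewrite maxr_pMr ?sqr_ge0//.
move: x01 m1 n1 mn1; rewrite in_itv/= => /andP[x0 x1].
move: m%:R^-1 n%:R^-1 => u v u0 v0 uv.
have ll : l%:R <= l%:R ^+ 2 :> R by nra.
rewrite ge_max !le_max; apply/andP; split; apply/orP; [left|right].
  have x2 : 0 <= x * (1 - x) by nra.
  apply: (le_trans (ler_wpM2l x2 uv)).
  rewrite mulrCA; apply: ler_wpM2r => //; apply: mulr_ge0 => //; exact: ltW.
by rewrite -exprMn lerXn2r ?nnegrE ?mulr_ge0 ?(ltW u0) ?(ltW v0).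
Qed.

Lemma powR_mulXn (R : realType) (x a : R) (k : nat) : 0 <= x -> 0 <= a ->
  k%:R <= a -> x `^ a = x `^ (a - k%:R) * x ^+ k.
Proof.
move=> x0 a0 ka; have [->|xn0] := eqVneq x 0.
  case: k ka => [|k] ka; first by rewrite subr0 expr0 mulr1.
  rewrite expr0n/= mulr0 powR0// gt_eqF//; apply: lt_le_trans ka.
  by rewrite ltr0n.
rewrite -powR_mulrn// -powRD ?subrK//.
by rewrite xn0 implybT.
Qed.

Lemma one_powR (R : realType) (a : R) : 1 `^ a = 1.
Proof. by rewrite powR1. Qed.

(** * Averages of Bernstein coefficients *)

(** The common features of evaluation at x and of the k-th Bernstein coefficient in
degree n >= m with x = k / n. The bounds on the powers of X and of 1 - X say that
the weights are at most as dispersed as binomial weights. *)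
Definition averages (R : realType) (m : nat) (x : R) (L : {scalar {poly R}}) :=
  [/\ L 1 = 1,
      forall i, (i <= m)%N -> 0 <= L ('X^i * (1 - 'X) ^+ (m - i)),
      forall j, (j <= m)%N -> L 'X^j <= x ^+ j &
      forall j, (j <= m)%N -> L ((1 - 'X) ^+ j) <= (1 - x) ^+ j].

Lemma averages_horner (R : realType) (m : nat) (x : R) : x \in `[0, 1] ->
  averages m x (horner_eval x).
Proof.
move=> x01; split=> [|i _|j _|j _] /=; rewrite /horner_eval.
- by rewrite hornerE.
- exact: basis_ge0.
- by rewrite !hornerE.
- by rewrite !hornerE.
Qed.

Lemma frac_in01 (R : realType) (n k : nat) : (1 <= n)%N -> (k <= n)%N ->
  k%:R / n%:R \in `[0 : R, 1].
Proof.
move=> n0 kn; rewrite in_itv/= divr_ge0//= ler_pdivrMr ?ltr0n// mul1r.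
by rewrite ler_nat.
Qed.

(** Each factor (k - l) / (n - l) is at most k / n: sampling without replacement is
less dispersed than sampling with replacement. *)
Lemma bcoefXn_le (R : realType) (n k j : nat) : (1 <= n)%N -> (k <= n)%N ->
  (j <= n)%N -> bcoef n k ('X^j : {poly R}) <= (k%:R / n%:R) ^+ j.
Proof.
move=> n0 kn; elim: j => [|j IH] jn; first by rewrite !expr0 bcoef1.
have := IH (ltnW jn); rewrite !bcoefXn//; last exact: ltnW.
rewrite !ffactnSr !natrM exprSr => {}IH.
rewrite invfM mulrACA.
have nj : 0 < (n - j)%:R :> R by rewrite ltr0n subn_gt0.
apply: ler_pM => //; rewrite ?divr_ge0//.
rewrite ler_pdivrMr// mulrAC ler_pdivlMr ?ltr0n//.
rewrite -!natrM ler_nat; nia.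
Qed.

Lemma bcoef_rev (R : realType) (n k j : nat) : (k <= n)%N -> (j <= n)%N ->
  bcoef n k ((1 - 'X) ^+ j : {poly R}) = bcoef n (n - k) ('X^j : {poly R}).
Proof.
move=> kn jn; have C0 : 'C(n, k)%:R != 0 :> R by rewrite pnatr_eq0 -lt0n bin_gt0.
apply: (mulfI C0); rewrite -{2}(bin_sub kn) bcoefXn_bin//; last exact: leq_subr.
have := bcoef_basis R kn jn (leq0n j); rewrite expr0 mul1r !subn0/= => ->.
congr (_%:R); case: leqP => h; last by rewrite bin_small//; lia.
by rewrite -bin_sub; [congr binomial; lia | lia].
Qed.

Lemma averages_bcoef (R : realType) (n k m : nat) : (1 <= n)%N -> (k <= n)%N ->
  (m <= n)%N -> averages m (k%:R / n%:R : R) (@bcoef R n k).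
Proof.
move=> n0 kn mn; split=> [|i im|j jm|j jm] /=; first exact: bcoef1.
- exact: bcoef_basis_ge0.
- by apply: bcoefXn_le => //; exact: leq_trans mn.
- have jn := leq_trans jm mn; rewrite bcoef_rev//.
  apply: (le_trans (bcoefXn_le _ n0 _ jn)); first exact: leq_subr.
  by rewrite natrB// mulrBl divff// pnatr_eq0 -lt0n.
Qed.

Lemma avgE (R : realType) (m : nat) (L : {scalar {poly R}}) (c : nat -> R) :
  L (bernstein m c) =
    \sum_(i < m.+1) ('C(m, i)%:R * c i) * L ('X^i * (1 - 'X) ^+ (m - i)).
Proof. by rewrite linear_sum/=; apply: eq_bigr => i _; rewrite linearZ. Qed.

Lemma avg_le (R : realType) (m : nat) (x : R) (L : {scalar {poly R}})
    (c d : nat -> R) : averages m x L ->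
  (forall i, (i <= m)%N -> c i <= d i) ->
  L (bernstein m c) <= L (bernstein m d).
Proof.
move=> [_ L0 _ _] cd; rewrite !avgE; apply: ler_sum => i _.
have im : (i <= m)%N by rewrite -ltnS.
by apply: ler_wpM2r; [exact: L0 | apply: ler_wpM2l => //; exact: cd].
Qed.

Lemma bernstein_const (R : realType) (n : nat) (a : R) :
  bernstein n (fun=> a) = a%:P.
Proof.
transitivity (bernstein n (fun k => a * (1 ^+ k * 1 ^+ (n - k)) + 0)).
  by apply: eq_bernstein => k _; rewrite !expr1n !mulr1 addr0.
rewrite bernstein_linear bernstein_geom !scale1r addrC.
rewrite [X in X ^+ _]addrC subrK expr1n alg_polyC.
by rewrite /bernstein big1 ?add0r// => k _; rewrite mulr0 scale0r.
Qed.

Lemma avg_const (R : realType) (m : nat) (x : R) (L : {scalar {poly R}}) (a : R) :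
  averages m x L -> L (bernstein m (fun=> a)) = a.
Proof. by move=> [L1 _ _ _]; rewrite bernstein_const -alg_polyC linearZ/= L1 mulr1. Qed.

Lemma bernsteinZ (R : realType) (n : nat) (a : R) (c : nat -> R) :
  bernstein n (fun k => a * c k) = a *: bernstein n c.
Proof.
rewrite /bernstein scaler_sumr; apply: eq_bigr => k _.
by rewrite scalerA; congr (_ *: _); ring.
Qed.

Lemma bernsteinD (R : realType) (n : nat) (c d : nat -> R) :
  bernstein n (fun k => c k + d k) = bernstein n c + bernstein n d.
Proof.
rewrite -[bernstein n c]scale1r -bernstein_linear; congr bernstein.
by apply/funext => k; rewrite mul1r.
Qed.

(** In powers of X the polynomial has nonnegative coefficients because 1 <= v, so L
is dominated by evaluation at x. Decreasing sequences are treated in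
[avg_geom_rev] by the symmetry X <-> 1 - X. *)
Lemma avg_geom (R : realType) (m : nat) (x v : R) (L : {scalar {poly R}}) :
    averages m x L -> 1 <= v ->
  L (bernstein m (fun i => v ^+ i)) <= (1 + (v - 1) * x) ^+ m.
Proof.
move=> [L1 L0 LX LY] v1.
rewrite [bernstein _ _](_ : _ = (1 + (v - 1) *: 'X) ^+ m); last first.
  transitivity (bernstein m (fun k => v ^+ k * 1 ^+ (m - k))).
    by apply: eq_bernstein => k _; rewrite expr1n mulr1.
  rewrite bernstein_geom; congr (_ ^+ _).
  by rewrite -!mul_polyC rmorphB/=; ring.
rewrite [in leRHS]exprDn exprDn linear_sum/=; apply: ler_sum => i _.
have im : (i <= m)%N by rewrite -ltnS.
rewrite !expr1n !mul1r exprZn scalerMnl linearZ/= exprMn -mulrnAl.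
apply: ler_wpM2l; last exact: LX.
by rewrite mulrn_wge0// exprn_ge0// subr_ge0.
Qed.

(** * Concentration of averages *)

Lemma avg_geom_rev (R : realType) (m : nat) (x v : R) (L : {scalar {poly R}}) :
    averages m x L -> 1 <= v ->
  L (bernstein m (fun i => v ^+ (m - i))) <= (1 + (v - 1) * (1 - x)) ^+ m.
Proof.
move=> [L1 L0 LX LY] v1.
rewrite [bernstein _ _](_ : _ = (1 + (v - 1) *: (1 - 'X)) ^+ m); last first.
  transitivity (bernstein m (fun k => 1 ^+ k * v ^+ (m - k))).
    by apply: eq_bernstein => k _; rewrite expr1n mul1r.
  rewrite bernstein_geom; congr (_ ^+ _).
  by rewrite -!mul_polyC rmorphB/=; ring.
rewrite [in leRHS]exprDn exprDn linear_sum/=; apply: ler_sum => i _.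
have im : (i <= m)%N by rewrite -ltnS.
rewrite !expr1n !mul1r exprZn scalerMnl linearZ/= exprMn -mulrnAl.
apply: ler_wpM2l; last exact: LY.
by rewrite mulrn_wge0// exprn_ge0// subr_ge0.
Qed.

Lemma expR_le_quad (R : realType) (a : R) : a <= 1 / 2 ->
  expR a <= 1 + a + 2 * a ^+ 2.
Proof.
move=> a2; have := expR_ge1Dx (- a); rewrite expRN => h.
have e0 := expR_gt0 a.
have : (1 - a) * expR a <= 1 by rewrite -ler_pdivlMr// mul1r.
move: (expR a) e0 => e e0 h'; rewrite leNgt; apply/negP => h2.
have : (1 - a) * (1 + a + 2 * a ^+ 2) < (1 - a) * e by rewrite ltr_pM2l//; lra.
nra.
Qed.

(** The moment generating function of a centred Bernoulli variable, bounded by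
applying [expR_le_quad] at its two values. *)
Lemma mgf_le (R : realType) (x s : R) : x \in `[0, 1] -> `|s| <= 1 / 2 ->
  expR (- (s * x)) * (1 + (expR s - 1) * x) <= expR (2 * s ^+ 2 * (x * (1 - x))).
Proof.
rewrite in_itv/= ler_norml => /andP[x0 x1] /andP[s0 s1].
apply: le_trans (expR_ge1Dx _).
have -> : expR (- (s * x)) * (1 + (expR s - 1) * x) =
    (1 - x) * expR (- (s * x)) + x * expR (s * (1 - x)).
  by rewrite (_ : s * (1 - x) = - (s * x) + s) ?expRD; ring.
have h1 : expR (- (s * x)) <= 1 + (- (s * x)) + 2 * (- (s * x)) ^+ 2.
  by apply: expR_le_quad; nra.
have h2 : expR (s * (1 - x)) <= 1 + s * (1 - x) + 2 * (s * (1 - x)) ^+ 2.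
  by apply: expR_le_quad; nra.
have x1' : 0 <= 1 - x by lra.
have := ler_wpM2l x1' h1; have := ler_wpM2l x0 h2; nra.
Qed.

Lemma avg_exp (R : realType) (m : nat) (x s : R) (L : {scalar {poly R}}) :
    x \in `[0, 1] -> averages m x L -> `|s| <= 1 / 2 ->
  L (bernstein m (fun i => expR (s * (i%:R - m%:R * x)))) <=
    expR (2 * s ^+ 2 * (x * (1 - x)) * m%:R).
Proof.
move=> x01 avL sh; rewrite expRM_natr.
apply: (@le_trans _ _ ((expR (- (s * x)) * (1 + (expR s - 1) * x)) ^+ m)); last first.
  rewrite lerXn2r ?nnegrE ?mgf_le ?expR_ge0// mulr_ge0 ?expR_ge0//.
  move: x01; rewrite in_itv/= => /andP[x0 x1]; have := expR_gt0 s; nra.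
rewrite exprMn -expRM_natr; case: (leP 0 s) => s0.
  rewrite (_ : (fun i => _) = (fun i => expR (- (s * x) * m%:R) * expR s ^+ i)).
    rewrite bernsteinZ linearZ/= ler_wpM2l ?expR_ge0//.
    by apply: avg_geom => //; rewrite -expR0 ler_expR.
  apply/funext => i; rewrite -expRM_natr -expRD; congr expR.
  by ring.
have -> : expR (- (s * x) * m%:R) * (1 + (expR s - 1) * x) ^+ m =
    expR (s * (1 - x) * m%:R) * (1 + (expR (- s) - 1) * (1 - x)) ^+ m.
  rewrite !expRM_natr -!exprMn; congr (_ ^+ m).
  rewrite (_ : s * (1 - x) = - (s * x) + s); last by ring.
  by rewrite expRD (expRN s); field; rewrite gt_eqF// expR_gt0.
rewrite (@eq_bernstein _ _ _ (fun i => expR (s * (1 - x) * m%:R) * expR (- s) ^+ (m - i))).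
  rewrite bernsteinZ linearZ/= ler_wpM2l ?expR_ge0//.
  by apply: avg_geom_rev => //; rewrite -expR0 ler_expR; lra.
move=> i im; rewrite -expRM_natr -expRD; congr expR.
by rewrite natrB//; ring.
Qed.

(** Exponential concentration of the weights at distance Delta m x from x; all
moments follow from it. *)
Lemma avg_exp_abs (R : realType) (m : nat) (x : R) (L : {scalar {poly R}}) :
    (1 <= m)%N -> x \in `[0, 1] -> averages m x L ->
  L (bernstein m (fun i => expR (`|i%:R / m%:R - x| / Delta m x / 2))) <=
    2 * expR 1.
Proof.
move=> m0 x01 avL; have d0 := Delta_gt0 x m0; have dm := Delta_ge_inv m x.
have mR : 0 < m%:R :> R by rewrite ltr0n.
(* The rate s is at most 1/2, and 2 s^2 x (1 - x) m <= 1 since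
x (1 - x) / m <= d^2. *)
set d := Delta m x in d0 dm *; pose s := (m%:R * d)^-1 / 2.
have md : 1 <= m%:R * d by rewrite -ler_pdivrMl// mulr1.
have s0 : 0 < s by rewrite divr_gt0// invr_gt0 mulr_gt0.
have s1 : s <= 1 / 2 by rewrite /s ler_pM2r ?invr_gt0// invf_le1// mulr_gt0.
have sx : 2 * s ^+ 2 * (x * (1 - x)) * m%:R <= 1.
  have : x * (1 - x) / m%:R <= d ^+ 2 by rewrite Delta_sqr// le_max lexx.
  rewrite ler_pdivrMr// => h.
  have -> : 2 * s ^+ 2 * (x * (1 - x)) * m%:R = (x * (1 - x)) / (2 * (d ^+ 2 * m%:R)).
    by rewrite /s; field; rewrite !gt_eqF.
  have q0 : 0 < d ^+ 2 * m%:R by rewrite mulr_gt0// exprn_gt0.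
  by rewrite ler_pdivrMr ?mulr_gt0//; lra.
pose E s i : R := expR (s * (i%:R - m%:R * x)).
have bnd t : `|t| = s -> L (bernstein m (E t)) <= expR 1.
  move=> ts; apply: (le_trans (avg_exp x01 avL _)); first by rewrite ts.
  by rewrite -(real_normK (num_real t)) ts ler_expR.
apply: (@le_trans _ _ (L (bernstein m (fun i => E s i + E (- s) i)))).
  apply: (avg_le avL) => i im; rewrite /E.
  have -> : `|i%:R / m%:R - x| / d / 2 = `|s * (i%:R - m%:R * x)|.
    rewrite normrM (gtr0_norm s0).
    have -> : i%:R / m%:R - x = m%:R^-1 * (i%:R - m%:R * x).
      by field; rewrite gt_eqF.
    rewrite normrM gtr0_norm ?invr_gt0//.
    by rewrite /s; field; rewrite !gt_eqF.
  rewrite mulNr; move: (s * _) => a; case: (ger0P a) => a0.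
    by rewrite ler_wpDr ?expR_ge0.
  by rewrite ler_wpDl ?expR_ge0.
rewrite bernsteinD linearD/= mulr2n mulrDl mul1r.
by apply: lerD; apply: bnd; rewrite ?normrN gtr0_norm.
Qed.

Lemma powR_le_exp (R : realType) (b : R) : 0 <= b ->
  exists2 K : R, 0 <= K & forall t, 0 <= t -> (1 + t) `^ b <= K * expR (t / 2).
Proof.
move=> b0; pose q := (Num.truncn b).+1.
exists ((2 * q%:R) ^+ q); first by rewrite exprn_ge0// mulr_ge0.
move=> t t0; have bq : b <= q%:R by apply/ltW; exact: truncnS_gt.
have t1 : 1 <= 1 + t by rewrite lerDl.
apply: (le_trans (ler_powR t1 bq)); rewrite powR_mulrn; last by lra.
have qR : 1 <= q%:R :> R by rewrite ler1n.
have -> : expR (t / 2) = expR (t / (2 * q%:R)) ^+ q.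
  rewrite -expRM_natr; congr expR; field.
  by rewrite gt_eqF//; lra.
rewrite -exprMn; set u := t / _; have e0 := expR_ge0 u.
have h : 1 + t <= 2 * q%:R * expR u.
  apply: (@le_trans _ _ (2 * q%:R * (1 + u))).
    rewrite mulrDr mulr1 [_ * u]mulrC divfK; first by lra.
    by rewrite gt_eqF//; lra.
  by rewrite ler_wpM2l ?expR_ge1Dx//; lra.
by rewrite lerXn2r// nnegrE; [lra | apply: le_trans h; lra].
Qed.

Lemma avg_powR (R : realType) (b : R) : 0 <= b ->
  exists2 M : R, 0 < M & forall (m : nat) (x : R) (L : {scalar {poly R}}),
    (1 <= m)%N -> x \in `[0, 1] -> averages m x L ->
    L (bernstein m (fun i => (1 + `|i%:R / m%:R - x| / Delta m x) `^ b)) <= M.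
Proof.
move=> b0; have [K K0 HK] := powR_le_exp b0.
have e0 := expR_gt0 (1 : R).
exists (K * (2 * expR 1) + 1); first by rewrite ltr_wpDl// mulr_ge0// mulr_ge0// ltW.
move=> m x L m0 x01 avL.
apply: (@le_trans _ _ (K * (2 * expR 1))); last by lra.
apply: le_trans (ler_wpM2l K0 (avg_exp_abs m0 x01 avL)).
have -> : forall c, K * L (bernstein m c) = L (bernstein m (fun i => K * c i)).
  by move=> c; rewrite bernsteinZ linearZ.
apply: (avg_le avL) => i im; apply: HK.
by rewrite divr_ge0// ltW// Delta_gt0.
Qed.

(** * Bernstein coefficients of powers centred at a node *)

Lemma bcoefZ (R : realType) (n k : nat) (a : R) (p : {poly R}) :
  bcoef n k (a *: p) = a * bcoef n k p.
Proof. exact: linearZ. Qed.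

Lemma bcoefD (R : realType) (n k : nat) (p q : {poly R}) :
  bcoef n k (p + q) = bcoef n k p + bcoef n k q.
Proof. exact: linearD. Qed.

Lemma bcoefB (R : realType) (n k : nat) (p q : {poly R}) :
  bcoef n k (p - q) = bcoef n k p - bcoef n k q.
Proof. exact: linearB. Qed.

(** Dual form of the differential equation x (1 - x) b' = (k - n x) b of the
Bernstein basis, checked on monomials. *)
Lemma bcoef_centered (R : realType) (n k : nat) (q : {poly R}) :
    (1 <= n)%N -> (k <= n)%N -> (size q <= n)%N ->
  n%:R * bcoef n k (('X - (k%:R / n%:R)%:P) * q) =
    - bcoef n k ('X * (1 - 'X) * q^`()).
Proof.
move=> n0 kn sq; have nR : n%:R != 0 :> R by rewrite pnatr_eq0 -lt0n.
have mono j : (j < n)%N ->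
    n%:R * bcoef n k (('X - (k%:R / n%:R)%:P) * 'X^j) =
    - bcoef n k ('X * (1 - 'X) * ('X^j)^`() : {poly R}).
  move=> jn.
  have -> : ('X - (k%:R / n%:R)%:P) * 'X^j =
      'X^(j.+1) - (k%:R / n%:R) *: 'X^j :> {poly R}.
    by rewrite exprS -mul_polyC; ring.
  have -> : 'X * (1 - 'X) * ('X^j)^`() = j%:R *: ('X^j - 'X^(j.+1)) :> {poly R}.
    rewrite derivXn -!mul_polyC polyC_natr; case: j {jn} => [|j]/=; first by ring.
    by rewrite !exprS; ring.
  rewrite bcoefB !bcoefZ bcoefB !bcoefXn//; last exact: ltnW.
  rewrite !ffactnSr !natrM.
  have f0 : (n ^_ j)%:R != 0 :> R by rewrite pnatr_eq0 -lt0n ffact_gt0 ltnW.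
  have nj : (n - j)%:R != 0 :> R by rewrite pnatr_eq0 -lt0n subn_gt0.
  case: (leqP j k) => jk; last by rewrite (ffact_small jk); ring.
  move: nj; rewrite !natrB//; last exact: ltnW.
  by move=> nj; field; rewrite f0 nR nj.
have -> : q = \sum_(j < n) q`_j *: 'X^j.
  rewrite -[LHS](coefK q) poly_def (big_ord_widen _ (fun j => q`_j *: 'X^j) sq).
  rewrite big_mkcond/=; apply: eq_bigr => j _; case: ltnP => // sj.
  by rewrite nth_default// scale0r.
have -> : (\sum_(j < n) q`_j *: 'X^j)^`() = \sum_(j < n) q`_j *: ('X^j)^`().
  by rewrite raddf_sum; apply: eq_bigr => j _ /=; rewrite derivZ.
have bsum (F : 'I_n -> {poly R}) : bcoef n k (\sum_j F j) = \sum_j bcoef n k (F j).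
  exact: linear_sum.
rewrite [('X - _) * _]mulr_sumr ['X * _ * _]mulr_sumr !bsum mulr_sumr -sumrN; apply: eq_bigr => j _.
by rewrite -!scalerAr !bcoefZ mulrCA mono// mulrN.
Qed.

(** With y = k / n, [bcoef_centered] relates the coefficients of three consecutive
powers of X - y; the factors y (1 - y) / n and 1 / n in this recursion are at
most Delta^2 and Delta. *)
Lemma bcoef_centered_pow_le (R : realType) (j : nat) :
  exists2 C : R, 0 <= C & forall n k, (1 <= n)%N -> (2 * j <= n)%N -> (k <= n)%N ->
    `|bcoef n k (('X - (k%:R / n%:R)%:P) ^+ j)| <=
      C * Delta n (k%:R / n%:R) ^+ j.
Proof.
pose P j := exists2 C : R, 0 <= C & forall n k, (1 <= n)%N -> (2 * j <= n)%N ->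
  (k <= n)%N -> `|bcoef n k (('X - (k%:R / n%:R)%:P) ^+ j)| <=
      C * Delta n (k%:R / n%:R) ^+ j.
suff : P j /\ P j.+1 by case.
elim: j => [|j [[A A0 HA] [B B0 HB]]].
  split; first by exists 1 => // n k n0 _ kn; rewrite !expr0 bcoef1 normr1 mulr1.
  exists 0 => // n k n0 _ kn; rewrite mul0r expr1 bcoefB -alg_polyC bcoefZ.
  rewrite bcoef1 -['X]expr1 bcoefXn// !ffactn1 mulr1 subrr normr0//.
split; first by exists B.
exists (2 * j.+1%:R * (A + B)); first by rewrite !mulr_ge0// addr_ge0.
move=> n k n0 jn kn; set y : R := k%:R / n%:R.
have y01 : y \in `[0, 1] by apply: frac_in01.
have := HA n k n0 _ kn; have := HB n k n0 _ kn.
move=> /(_ ltac:(lia)) hB /(_ ltac:(lia)) hA; rewrite -/y in hA hB *.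
set a := bcoef n k _ in hA; set b := bcoef n k _ in hB; set c := bcoef n k _.
have e : n%:R * c = - (j.+1%:R * (y * (1 - y) * a + (1 - 2 * y) * b - c)).
  rewrite /c exprS bcoef_centered//; last by rewrite size_exp_XsubC; lia.
  rewrite deriv_exp derivB derivX derivC subr0 mul1r/=.
  have -> : 'X * (1 - 'X) * (('X - y%:P) ^+ j *+ j.+1) =
     j.+1%:R *: ((y * (1 - y)) *: ('X - y%:P) ^+ j + (1 - 2 * y) *: ('X - y%:P) ^+ j.+1
       - ('X - y%:P) ^+ j.+2).
    by rewrite -!mul_polyC !exprS !(polyCM, polyCB, polyC1, polyC_natr); ring.
  by rewrite bcoefZ bcoefB bcoefD !bcoefZ.
have d0 := Delta_gt0 y n0; have dn := Delta_ge_inv n y.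
have d2 : y * (1 - y) / n%:R <= Delta n y ^+ 2.
  by rewrite Delta_sqr// le_max lexx.
set d := Delta n y in d0 dn d2 hA hB *.
have nR : 0 < n%:R :> R by rewrite ltr0n.
have jnR : 2 * j.+1%:R <= n%:R :> R by rewrite -natrM ler_nat; lia.
have j0 : 0 < j.+1%:R :> R by rewrite ltr0n.
have {}e : c = - (j.+1%:R / (n%:R - j.+1%:R)) * (y * (1 - y) * a + (1 - 2 * y) * b).
  have nj : n%:R - j.+1%:R != 0 :> R by rewrite gt_eqF//; lra.
  apply: (mulIf nj); set S := y * (1 - y) * a + (1 - 2 * y) * b in e *.
  have -> : - (j.+1%:R / (n%:R - j.+1%:R)) * S * (n%:R - j.+1%:R) = - (j.+1%:R * S).
    by rewrite mulrAC mulNr divfK// mulNr.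
  by lra.
have J0 : 0 <= j.+1%:R / (n%:R - j.+1%:R) :> R by apply: divr_ge0; lra.
rewrite e normrM normrN (ger0_norm J0).
have h1 : j.+1%:R / (n%:R - j.+1%:R) <= 2 * j.+1%:R / n%:R :> R.
  have nj : 0 < n%:R - j.+1%:R :> R by lra.
  by rewrite ler_pdivrMr// mulrAC ler_pdivlMr//; nra.
have h2 : `|y * (1 - y) * a + (1 - 2 * y) * b| <= y * (1 - y) * (A * d ^+ j) + B * d ^+ j.+1.
  move: y01; rewrite in_itv/= => /andP[y0 y1].
  apply: (le_trans (ler_normD _ _)); apply: lerD; rewrite normrM.
    by rewrite ger0_norm; [apply: ler_wpM2l; nra | nra].
  rewrite -[leRHS]mul1r; apply: ler_pM => //.
  by rewrite ler_norml; lra.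
have y0 : 0 <= y * (1 - y) by move: y01; rewrite in_itv/= => /andP[y0 y1]; nra.
apply: (@le_trans _ _ (2 * j.+1%:R / n%:R * (y * (1 - y) * (A * d ^+ j) + B * d ^+ j.+1))).
  exact: ler_pM.
have -> : 2 * j.+1%:R / n%:R * (y * (1 - y) * (A * d ^+ j) + B * d ^+ j.+1) =
  2 * j.+1%:R * (y * (1 - y) / n%:R * (A * d ^+ j) + n%:R^-1 * (B * d ^+ j.+1)).
  by field; rewrite gt_eqF.
rewrite -[leRHS]mulrA ler_wpM2l ?mulr_ge0// mulrDl; apply: lerD.
  have := ler_wpM2r (mulr_ge0 A0 (exprn_ge0 j (ltW d0))) d2.
  by move/le_trans; apply; rewrite le_eqVlt; apply/orP; left; apply/eqP; rewrite !exprS; ring.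
have := ler_wpM2r (mulr_ge0 B0 (exprn_ge0 j.+1 (ltW d0))) dn.
by move/le_trans; apply; rewrite le_eqVlt; apply/orP; left; apply/eqP; rewrite !exprS; ring.
Qed.

(** * Derivatives on the unit interval *)

(** The form without quotients is stable under sums and makes no exception of y = x. *)
Lemma deriv_on01P (R : realType) (g g' : R -> R) :
  deriv_on01 g g' <-> forall x : R, x \in `[0, 1] -> forall e, 0 < e ->
    exists2 d, 0 < d & forall y : R, y \in `[0, 1] -> `|y - x| < d ->
      `|g y - g x - g' x * (y - x)| <= e * `|y - x|.
Proof.
split=> H x x01.
  move=> e e0; have /cvgrPdist_le/(_ _ e0) := H x x01.
  move=> /nbhs_ballP[d /= d0 Hd]; exists d => // y y01 yx.
  have [->|nxy] := eqVneq y x; first by rewrite !subrr mulr0 subr0 normr0 mulr0.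
  have := Hd y; rewrite /ball/= distrC => /(_ yx nxy y01).
  have yx0 : y - x != 0 by rewrite subr_eq0.
  rewrite -ler_pdivrMr ?normr_gt0// -normf_div distrC.
  by congr (`| _ | <= _); field.
apply/cvgrPdist_le => e e0; have [d d0 Hd] := H x x01 e e0.
apply/nbhs_ballP; exists d => //= y; rewrite /ball/= distrC => yx nxy y01.
have yx0 : y - x != 0 by rewrite subr_eq0.
have := Hd y y01 yx; rewrite -ler_pdivrMr ?normr_gt0// -normf_div.
rewrite [in X in _ -> X]distrC; congr (`| _ | <= _).
by field.
Qed.

Lemma deriv_on01_continuous (R : realType) (g g' : R -> R) :
  deriv_on01 g g' -> {within `[0 : R, 1], continuous g}.
Proof.
move=> /deriv_on01P H; apply/subspace_continuousP => x x01.
apply/cvgrPdist_le => e e0.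
have [d d0 Hd] := H x x01 1 ltr01.
have c0 : 0 < 1 + `|g' x| by rewrite ltr_wpDr.
pose d' := Num.min d (e / (1 + `|g' x|)).
apply/nbhs_ballP; exists d' => /=; first by rewrite lt_min d0 divr_gt0.
move=> y; rewrite /ball/= lt_min => /andP[yd ye] y01.
rewrite distrC in yd; have := Hd y y01 yd; rewrite mul1r => h.
rewrite distrC -[g y - g x](subrK (g' x * (y - x))).
apply: (le_trans (ler_normD _ _)); rewrite normrM.
move: ye; rewrite distrC ltr_pdivlMr// => ye.
have := normr_ge0 (g' x); have := normr_ge0 (y - x); nra.
Qed.

Lemma deriv_on01_is_derive (R : realType) (g g' : R -> R) (x : R) :
  deriv_on01 g g' -> x \in `]0, 1[ -> is_derive x 1 g (g' x).
Proof.
move=> /deriv_on01P H; rewrite in_itv/= => /andP[x0 x1].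
have x01 : x \in `[0, 1] by rewrite in_itv/= !ltW.
suff h : (fun h : R => h^-1 *: ((g \o shift x) (h *: (1 : R)) - g x)) @ 0^' --> g' x.
  by apply: DeriveDef; [apply/cvg_ex; exists (g' x) | exact: cvg_lim].
apply/cvgrPdist_le => e e0; have [d d0 Hd] := H x x01 e e0.
pose d' := Num.min d (Num.min x (1 - x)).
apply/nbhs_ballP; exists d' => /=; first by rewrite !lt_min d0 x0 subr_gt0.
move=> h; rewrite /ball/= sub0r normrN !lt_min => /and3P[hd hx h1] h0.
have h01 : h + x \in `[0, 1].
  by move: hx h1; rewrite in_itv/= !ltr_norml => /andP[? ?] /andP[? ?]; lra.
have := Hd _ h01; rewrite addrK => /(_ hd).
rewrite -ler_pdivrMr ?normr_gt0// -normf_div [in X in _ -> X]distrC.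
by congr (`| _ | <= _); rewrite /= /GRing.scale/= mulr1; field.
Qed.

Lemma deriv_on01_mvt (R : realType) (g g' : R -> R) (B x y : R) :
    deriv_on01 g g' -> x \in `[0, 1] -> y \in `[0, 1] ->
    (forall z, z \in `[0, 1] -> `|z - x| <= `|y - x| -> `|g' z| <= B) ->
  `|g y - g x| <= B * `|y - x|.
Proof.
move=> H; suff wlog a b : a \in `[0, 1] -> b \in `[0, 1] -> a < b ->
    (forall z, z \in `[a, b] -> `|g' z| <= B) -> `|g b - g a| <= B * `|b - a|.
  move=> x01 y01 gB; move: (x01) (y01); rewrite !in_itv/= => /andP[x0 x1] /andP[y0 y1].
  case: (ltgtP x y) => xy.
  - apply: wlog => // z; rewrite in_itv/= => /andP[xz zy]; apply: gB.
      by rewrite in_itv/=; lra.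
    by rewrite !ger0_norm ?subr_ge0//; lra.
  - rewrite distrC [`|y - x|]distrC; apply: wlog => // z; rewrite in_itv/= => /andP[xz zy].
    apply: gB; first by rewrite in_itv/=; lra.
    by rewrite !ler0_norm ?subr_le0//; lra.
  - by rewrite xy !subrr normr0 mulr0.
rewrite !in_itv/= => /andP[a0 a1] /andP[b0 b1] ab gB.
have dg z : z \in `]a, b[ -> is_derive z 1 g (g' z).
  rewrite in_itv/= => /andP[az zb]; apply: deriv_on01_is_derive => //.
  by rewrite in_itv/=; lra.
have cg : {within `[a, b], continuous g}.
  apply: continuous_subspaceW (deriv_on01_continuous H) => z/=.
  by rewrite !in_itv/= => /andP[? ?]; lra.
have [c cab ->] := MVT ab dg cg.
rewrite normrM ler_wpM2r// gB//; move: cab; rewrite !in_itv/= => /andP[? ?].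
by rewrite !ltW.
Qed.

Lemma deriv_on01_horner (R : realType) (p : {poly R}) :
  deriv_on01 (horner p) (horner p^`()).
Proof.
apply/deriv_on01P => x _ e e0.
have [_ <-] := is_derive_poly p x.
have : derivable (horner p) x 1 by exact: derivable_horner.
rewrite /derivable /derive => /cvgrPdist_le/(_ _ e0) /nbhs_ballP[d/= d0 Hd].
exists d => // y _ yx.
have [->|nxy] := eqVneq y x; first by rewrite !subrr mulr0 subr0 normr0 mulr0.
have yx0 : y - x != 0 by rewrite subr_eq0.
have := Hd (y - x); rewrite /ball/= sub0r normrN => /(_ yx yx0).
rewrite -ler_pdivrMr ?normr_gt0// -normf_div distrC.
rewrite /GRing.scale/= mulr1 subrK; congr (`| _ | <= _).
by field.
Qed.

(** * Taylor polynomials of functions of class C^alpha *)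

(** The assumption concerns small distances only; other points are joined by a chain
of M equal steps, where M depends only on the range of validity. *)
Lemma modulus_holder (R : realType) (g : R -> R) (d : R) : 0 < d ->
    (exists C : R, \forall h \near 0^'+, (modulus01 g h <= (C * h `^ d)%:E)%E) ->
  exists2 C : R, 0 <= C &
    forall x y : R, x \in `[0, 1] -> y \in `[0, 1] ->
      `|g x - g y| <= C * `|x - y| `^ d.
Proof.
move=> d0 [C]; rewrite nearE => /nbhs_ballP[e /= e0 He].
have loc (x y : R) : x \in `[0, 1] -> y \in `[0, 1] -> `|x - y| < e / 2 ->
    `|g x - g y| <= `|C| * 2 `^ d * `|x - y| `^ d.
  move=> x01 y01 xye; have [->|nxy] := eqVneq x y.
    by rewrite !subrr normr0 mulr_ge0// ?powR_ge0// mulr_ge0// powR_ge0.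
  have xy0 : 0 < `|x - y| by rewrite normr_gt0 subr_eq0.
  have h0 : 0 < 2 * `|x - y| by rewrite mulr_gt0.
  (* The modulus is defined by a strict inequality, whence the factor 2. *)
  have := He (2 * `|x - y|); rewrite /ball/= sub0r normrN gtr0_norm//.
  move=> /(_ ltac:(lra) h0) hm.
  have : ((`|g x - g y|)%R%:E <= modulus01 g (2 * `|x - y|)%R)%E.
    by apply: ereal_sup_ubound; exists x, y; split => //; lra.
  move=> /le_trans/(_ hm); rewrite lee_fin => /le_trans; apply.
  by rewrite powRM// mulrA ler_wpM2r ?powR_ge0// ler_wpM2r ?powR_ge0// ler_norm.
pose M := (Num.truncn (e / 2)^-1).+1.
have M0 : 0 < M%:R :> R by rewrite ltr0n.
have Me : M%:R^-1 < e / 2.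
  by rewrite invf_plt ?posrE// ?divr_gt0//; exact: truncnS_gt.
exists (M%:R * (`|C| * 2 `^ d)); first by rewrite !mulr_ge0// powR_ge0.
move=> x y x01 y01.
pose z i : R := y + i%:R / M%:R * (x - y).
have z01 i : (i <= M)%N -> z i \in `[0, 1].
  move=> iM; have : i%:R / M%:R \in `[0 : R, 1] by apply: frac_in01.
  move: x01 y01; rewrite !in_itv/= /z => /andP[? ?] /andP[? ?] /andP[? ?]; nra.
have -> : g x - g y = \sum_(0 <= i < M) (g (z i.+1) - g (z i)).
  rewrite telescope_sumr// /z mul0r mul0r addr0 divff ?gt_eqF// mul1r.
  by rewrite addrCA subrr addr0.
apply: (le_trans (ler_norm_sum _ _ _)).
have xy1 : `|x - y| <= 1.
  by move: x01 y01; rewrite !in_itv/= ler_norml => /andP[? ?] /andP[? ?]; lra.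
apply: (@le_trans _ _ (\sum_(0 <= i < M) (`|C| * 2 `^ d * `|x - y| `^ d))); last first.
  by rewrite sumr_const_nat subn0 -[leLHS]mulr_natl mulrA.
rewrite !big_nat; apply: ler_sum => i /andP[_ iM].
have zz : `|z i.+1 - z i| = M%:R^-1 * `|x - y|.
  rewrite /z -[X in X * `|_|](@gtr0_norm _ M%:R^-1) ?invr_gt0// -normrM.
  congr `| _ |; rewrite -natr1; field.
  by rewrite gt_eqF.
have M1 : 0 < (M%:R^-1 : R) <= 1 by rewrite invr_gt0 M0 invf_le1// ler1n.
have n0 := normr_ge0 (x - y).
apply: (le_trans (loc _ _ (z01 _ iM) (z01 _ (ltnW iM)) _)); first by rewrite zz; nra.
rewrite ler_wpM2l ?mulr_ge0 ?powR_ge0// zz.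
by apply: ge0_ler_powR; rewrite ?nnegrE ?(ltW d0)//; nra.
Qed.

Definition taylor (R : realType) (D : nat -> R -> R) (r : nat) (x : R) : {poly R} :=
  \sum_(j < r.+1) (D j x / j`!%:R) *: ('X - x%:P) ^+ j.

Lemma size_taylor (R : realType) (D : nat -> R -> R) (r : nat) (x : R) :
  (size (taylor D r x) <= r.+1)%N.
Proof.
apply: (leq_trans (size_sum _ _ _)); apply/bigmax_leqP => j _.
apply: (leq_trans (size_scale_leq _ _)).
by rewrite size_exp_XsubC.
Qed.

Lemma derivn_XsubC_exp (R : realType) (c : R) (n j : nat) :
  (('X - c%:P) ^+ n)^`(j) = ('X - c%:P) ^+ (n - j) *+ n ^_ j.
Proof.
elim: j => [|j IH]; first by rewrite subn0 ffactn0 derivn0 mulr1n.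
rewrite derivnS IH derivMn deriv_exp derivXsubC mul1r -mulrnA ffactnSr mulnC subnS.
by [].
Qed.

Lemma derivn_taylor (R : realType) (D : nat -> R -> R) (r j : nat) (x : R) :
  (j <= r)%N -> (taylor D r x)^`(j).[x] = D j x.
Proof.
move=> jr; rewrite /taylor (raddf_sum (derivn j)) horner_sum.
rewrite (bigD1 (Ordinal (jr : (j < r.+1)%N)))//= big1 ?addr0 => [|i ij].
  rewrite derivnZ derivn_XsubC_exp subnn expr0 ffactnn !hornerE.
  by rewrite hornerMn hornerC; field; rewrite pnatr_eq0 -lt0n fact_gt0.
rewrite derivnZ derivn_XsubC_exp hornerZ hornerMn horner_exp hornerXsubC subrr expr0n.
rewrite subn_eq0; case: leqP => h; last by rewrite mul0rn mulr0.
rewrite ffact_small ?mulr0//.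
have : (val i != j) by apply: contra ij => /eqP ij; apply/eqP/val_inj.
by move=> ij'; rewrite ltn_neqAle ij' h.
Qed.

Lemma derivn_taylor_top (R : realType) (D : nat -> R -> R) (r : nat) (x y : R) :
  (taylor D r x)^`(r).[y] = D r x.
Proof.
rewrite -[RHS](derivn_taylor D x (leqnn r)).
have : (size (taylor D r x)^`(r) <= 1)%N.
  have H p k : (size (p^`(k) : {poly R}) <= size p - k)%N.
    elim: k => [|k IH]; first by rewrite subn0.
    rewrite derivnS subnS; have [->|p0] := eqVneq p^`(k) 0.
      by rewrite deriv0 size_poly0.
    by rewrite -ltnS; apply: (leq_trans (lt_size_deriv p0)); lia.
  by apply: (leq_trans (H _ _)); have := size_taylor D r x; lia.
by move=> /size1_polyC ->; rewrite !hornerC.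
Qed.

Lemma deriv_on01B_horner (R : realType) (g g' : R -> R) (p : {poly R}) :
  deriv_on01 g g' ->
  deriv_on01 (fun x => g x - p.[x]) (fun x => g' x - p^`().[x]).
Proof.
move=> /deriv_on01P H; have /deriv_on01P P := @deriv_on01_horner R p.
apply/deriv_on01P => x x01 e e0; have e2 : 0 < e / 2 by rewrite divr_gt0.
have [d1 d10 H1] := H x x01 _ e2; have [d2 d20 H2] := P x x01 _ e2.
exists (Num.min d1 d2); first by rewrite lt_min d10.
move=> y y01; rewrite lt_min => /andP[/(H1 _ y01) h1 /(H2 _ y01) h2].
have -> : g y - p.[y] - (g x - p.[x]) - (g' x - p^`().[x]) * (y - x) =
    (g y - g x - g' x * (y - x)) - (p.[y] - p.[x] - p^`().[x] * (y - x)) by ring.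
by apply: (le_trans (ler_normB _ _)); apply: (le_trans (lerD h1 h2)); lra.
Qed.

(** Downward induction on j: the remainder of order j vanishes at x and its derivative
is the remainder of order j + 1, so the mean value theorem gains a factor
|y - x| at each step and keeps the constant. *)
Lemma taylor_remainder (R : realType) (D : nat -> R -> R) (r : nat) (alpha C : R) :
    r%:R <= alpha ->
    (forall k, (k < r)%N -> deriv_on01 (D k) (D k.+1)) ->
    (forall x y : R, x \in `[0, 1] -> y \in `[0, 1] ->
      `|D r x - D r y| <= C * `|x - y| `^ (alpha - r%:R)) -> 0 <= C ->
  forall j x y, (j <= r)%N -> x \in `[0, 1] -> y \in `[0, 1] ->
    `|D j y - (taylor D r x)^`(j).[y]| <= C * `|y - x| `^ (alpha - j%:R).
Proof.
move=> ra HD HC C0 j x y jr x01; move E : (r - j)%N => i.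
elim: i j y jr E => [|i IH] j y jr E y01.
  have -> : j = r by lia.
  by rewrite derivn_taylor_top; apply: HC.
have jr' : (j < r)%N by lia.
pose B := C * `|y - x| `^ (alpha - j.+1%:R).
have := deriv_on01_mvt (B := B) (deriv_on01B_horner (p := (taylor D r x)^`(j)) (HD j jr')) x01 y01.
rewrite -derivnS derivn_taylor// subrr subr0.
have a0 : 0 <= alpha - j.+1%:R.
  by rewrite subr_ge0; apply: le_trans ra; rewrite ler_nat.
move=> /(_ _)/le_trans; apply.
  move=> z z01 zy; apply: (le_trans (IH j.+1 z jr' _ z01)); first by lia.
  by rewrite ler_wpM2l// ge0_ler_powR ?nnegrE.
rewrite /B (@powR_mulXn _ `|y - x| (alpha - j%:R) 1) ?normr_ge0//.
- by rewrite -mulrA expr1 -natr1 opprD addrA.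
- by move: a0; rewrite -natr1; lra.
- by move: a0; rewrite -natr1; lra.
Qed.

(** * Bernstein coefficients of Taylor polynomials *)

Lemma poly_taylor (R : realType) (p : {poly R}) (r : nat) (y : R) :
  (size p <= r.+1)%N ->
  p = \sum_(j < r.+1) p^`N(j).[y] *: ('X - y%:P) ^+ j.
Proof.
move=> sp; rewrite -[LHS]comp_polyXr /comp_poly.
transitivity ((map_poly polyC p).[y%:P + ('X - y%:P)]).
  by rewrite addrC subrK.
rewrite (@nderiv_taylor_wide _ r.+1); last 2 first.
- exact: mulrC.
- by rewrite size_map_polyC.
apply: eq_bigr => j _; rewrite nderivn_map horner_map/= mul_polyC.
by [].
Qed.

Lemma bounded_upto (R : realType) (P : nat -> R -> Prop) (r : nat) :
    (forall j B B', P j B -> B <= B' -> P j B') ->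
    (forall j, (j <= r)%N -> exists B, P j B) ->
  exists2 B, 0 <= B & forall j, (j <= r)%N -> P j B.
Proof.
move=> mono; elim: r => [|r IH] H.
  have [B PB] := H 0%N (leqnn _); exists `|B| => // j; rewrite leqn0 => /eqP ->.
  by apply: mono PB _; exact: ler_norm.
have [j jr|B B0 HB] := IH; first by apply: H; exact: leqW.
have [B' PB'] := H r.+1 (leqnn _); exists (B + `|B'|); first by rewrite addr_ge0.
move=> j; rewrite leq_eqVlt => /orP[/eqP ->|].
  by apply: mono PB' _; rewrite ler_wpDl// ler_norm.
by rewrite ltnS => /HB PB; apply: mono PB _; rewrite lerDl.
Qed.

Lemma bcoef_centered_pow_unif (R : realType) (r : nat) :
  exists2 C : R, 0 <= C & forall j n k, (j <= r)%N ->
    (1 <= n)%N -> (2 * r <= n)%N -> (k <= n)%N ->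
    `|bcoef n k (('X - (k%:R / n%:R)%:P) ^+ j)| <=
      C * Delta n (k%:R / n%:R) ^+ j.
Proof.
pose P j (C : R) := forall n k, (1 <= n)%N -> (2 * r <= n)%N -> (k <= n)%N ->
    `|bcoef n k (('X - (k%:R / n%:R)%:P) ^+ j)| <=
      C * Delta n (k%:R / n%:R) ^+ j.
have [j B B' H BB' n k n0 rn kn|j jr|C C0 HC] := @bounded_upto R P r.
- apply: (le_trans (H n k n0 rn kn)); apply: ler_wpM2r => //.
  by rewrite exprn_ge0// ltW// Delta_gt0.
- have [C _ HC] := bcoef_centered_pow_le R j; exists C => n k n0 rn kn.
  by apply: HC => //; lia.
- by exists C => // j n k jr; exact: HC.
Qed.

(** These coefficients reproduce polynomials of degree at most r and involve f and its
derivatives at k / n only; for r <= 1 and n >= 1 they are the values of f. *)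
Definition taylor_coef (R : realType) (D : nat -> R -> R) (r n k : nat) : R :=
  bcoef n k (taylor D r (k%:R / n%:R)).

(** Expand the difference of the two Taylor polynomials at the node i / m: its j-th
derivative there is a Taylor remainder of order j, and the Bernstein coefficient
of (X - i / m)^j is O(Delta^j). *)
Lemma taylor_coef_change (R : realType) (D : nat -> R -> R) (r : nat) (alpha C : R) :
    r%:R <= alpha -> 0 <= C ->
    (forall j x y, (j <= r)%N -> x \in `[0, 1] -> y \in `[0, 1] ->
      `|D j y - (taylor D r x)^`(j).[y]| <= C * `|y - x| `^ (alpha - j%:R)) ->
  exists2 K : R, 0 <= K & forall m i x, (1 <= m)%N -> (2 * r <= m)%N -> (i <= m)%N ->
    x \in `[0, 1] ->
    `|taylor_coef D r m i - bcoef m i (taylor D r x)| <=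
      K * (Delta m x + `|i%:R / m%:R - x|) `^ alpha.
Proof.
move=> ra C0 HC; have [B B0 HB] := bcoef_centered_pow_unif R r.
exists (C * B *+ r.+1); first by rewrite mulrn_wge0// mulr_ge0.
move=> m i x m0 rm im x01; set y : R := i%:R / m%:R.
have y01 : y \in `[0, 1] by apply: frac_in01.
rewrite /taylor_coef -/y -bcoefB; set q := taylor D r y - taylor D r x.
have sq : (size q <= r.+1)%N.
  by rewrite (leq_trans (size_polyD _ _))// size_polyN geq_max !size_taylor.
rewrite (poly_taylor y sq).
have -> (F : 'I_r.+1 -> {poly R}) : bcoef m i (\sum_j F j) = \sum_j bcoef m i (F j).
  exact: linear_sum.
apply: (le_trans (ler_norm_sum _ _ _)).
set E := Delta m x + `|y - x|.
have d0 := Delta_gt0 x m0; have n0 := normr_ge0 (y - x).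
have E0 : 0 <= E by rewrite addr_ge0// ltW.
apply: (@le_trans _ _ (\sum_(j < r.+1) C * B * E `^ alpha)); last first.
  by rewrite sumr_const card_ord mulrnAl.
apply: ler_sum => j _; have jr : (j <= r)%N by rewrite -ltnS.
have ja : j%:R <= alpha by apply: le_trans ra; rewrite ler_nat.
have a0 : 0 <= alpha by apply: le_trans ja.
rewrite bcoefZ normrM (powR_mulXn E0 a0 ja).
rewrite [leRHS](_ : _ = (C * E `^ (alpha - j%:R)) * (B * E ^+ j)); last by ring.
apply: ler_pM => //.
  apply: (@le_trans _ _ (`|q^`(j).[y]|)).
    rewrite nderivn_def hornerMn -mulr_natr normrM ler_peMr// normr_nat.
    by rewrite ler1n fact_gt0.
  rewrite derivnB hornerD hornerN derivn_taylor//.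
  apply: (le_trans (HC j x y jr x01 y01)); rewrite ler_wpM2l//.
  by apply: ge0_ler_powR; rewrite ?nnegrE ?subr_ge0// lerDr ltW.
apply: (le_trans (HB j m i jr m0 rm im)); rewrite ler_wpM2l//.
apply: lerXn2r; rewrite ?nnegrE// ?(ltW (Delta_gt0 _ _))//.
by rewrite /E -/y; apply: Delta_shift.
Qed.

Lemma avgZ (R : realType) (m : nat) (L : {scalar {poly R}}) (a : R) (c : nat -> R) :
  L (bernstein m (fun i => a * c i)) = a * L (bernstein m c).
Proof. by rewrite bernsteinZ linearZ. Qed.

Definition Delta_coef (R : realType) (alpha : R) (n k : nat) : R :=
  Delta n (k%:R / n%:R) `^ alpha.

Lemma avg_norm_le (R : realType) (m : nat) (x : R) (L : {scalar {poly R}})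
    (c d : nat -> R) : averages m x L ->
  (forall i, (i <= m)%N -> `|c i| <= d i) ->
  `|L (bernstein m c)| <= L (bernstein m d).
Proof.
move=> avL cd; rewrite ler_norml; apply/andP; split.
  rewrite -mulN1r -avgZ; apply: (avg_le avL) => i /cd.
  by rewrite ler_norml mulN1r => /andP[].
by apply: (avg_le avL) => i /cd; rewrite ler_norml => /andP[].
Qed.

Lemma avg_shifted_powR (R : realType) (alpha : R) : 0 <= alpha ->
  exists2 M : R, 0 < M & forall (m : nat) (x : R) (L : {scalar {poly R}}),
    (1 <= m)%N -> x \in `[0, 1] -> averages m x L ->
    L (bernstein m (fun i => (Delta m x + `|i%:R / m%:R - x|) `^ alpha)) <=
      M * Delta m x `^ alpha.
Proof.
move=> a0; have [M M0 HM] := avg_powR a0; exists M => // m x L m0 x01 avL.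
have d0 := Delta_gt0 x m0.
rewrite (_ : (fun i => _) = fun i => Delta m x `^ alpha *
    (1 + `|i%:R / m%:R - x| / Delta m x) `^ alpha); last first.
  apply/funext => i; rewrite -powRM ?(ltW d0) ?addr_ge0 ?divr_ge0 ?(ltW d0)//.
  by rewrite mulrDr mulr1 mulrCA divff ?mulr1// gt_eqF.
rewrite avgZ mulrC ler_wpM2r ?powR_ge0//.
exact: HM.
Qed.

Lemma avg_Delta_coef_le (R : realType) (alpha : R) : 0 <= alpha ->
  exists2 M : R, 0 < M & forall (m : nat) (x : R) (L : {scalar {poly R}}),
    (1 <= m)%N -> x \in `[0, 1] -> averages m x L ->
    L (bernstein m (Delta_coef alpha m)) <= M * Delta m x `^ alpha.
Proof.
move=> a0; have [M M0 HM] := avg_shifted_powR a0; exists M => // m x L m0 x01 avL.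
apply: le_trans (HM m x L m0 x01 avL); apply: (avg_le avL) => i im.
have i01 := frac_in01 R m0 im; have d0 := Delta_gt0 x m0.
apply: ge0_ler_powR; rewrite ?nnegrE ?addr_ge0 ?(ltW d0) ?(ltW (Delta_gt0 _ _))//.
exact: Delta_shift.
Qed.

(** At least half of the weight lies within T Delta m x of x, where Delta is
comparable with Delta m x. This lower bound is what makes the envelopes
monotone. *)
Lemma avg_Delta_coef_ge (R : realType) (alpha : R) : 0 <= alpha ->
  exists2 c : R, 0 < c & forall (m : nat) (x : R) (L : {scalar {poly R}}),
    (1 <= m)%N -> x \in `[0, 1] -> averages m x L ->
    c * Delta m x `^ alpha <= L (bernstein m (Delta_coef alpha m)).
Proof.
move=> a0; have [M M0 HM] := avg_powR (@ler01 R).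
pose T := 2 * M; have T0 : 0 < T by rewrite mulr_gt0.
have e0 : 0 < (1 + T) `^ (- alpha) by rewrite powR_gt0// addr_gt0.
exists ((1 + T) `^ (- alpha) / 2); first by rewrite divr_gt0.
move=> m x L m0 x01 avL; have d0 := Delta_gt0 x m0.
have da0 := powR_ge0 (Delta m x) alpha.
pose t i : R := `|i%:R / m%:R - x| / Delta m x.
have t0 i : 0 <= t i by rewrite divr_ge0// ltW.
pose P := Delta m x `^ alpha * (1 + T) `^ (- alpha).
have P0 : 0 <= P by rewrite mulr_ge0// ltW.
(* P (1 - (1 + t) / T) is below P for t <= T and negative for t > T; its average
is at least P / 2 since T = 2 M. *)
apply: (@le_trans _ _ (L (bernstein m (fun i => - (P / T) * (1 + t i) `^ 1 + P)))).
  rewrite (_ : (fun _ => _) = (fun i => - (P / T) * (1 + t i) `^ 1 + (fun=> P) i))//.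
  rewrite bernstein_linear linearD linearZ/= (avg_const _ avL).
  have := HM m x L m0 x01 avL; rewrite -/t => h.
  have PT : 0 <= P / T by rewrite divr_ge0// ltW.
  have -> : (1 + T) `^ (- alpha) / 2 * Delta m x `^ alpha = - (P / T) * M + P.
    by rewrite /P /T; field; rewrite gt_eqF.
  by rewrite lerD2r !mulNr lerN2; apply: ler_wpM2l => //; exact: h.
apply: (avg_le avL) => i im; have i01 := frac_in01 R m0 im.
rewrite powRr1; last by rewrite addr_ge0.
have [tT|tT] := leP (t i) T; last first.
  apply: le_trans (powR_ge0 _ _).
  have -> : - (P / T) * (1 + t i) + P = - (P / T * (1 + t i - T)).
    by field; rewrite gt_eqF.
  by rewrite oppr_le0 mulr_ge0 ?divr_ge0 ?(ltW T0)//; lra.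
apply: (@le_trans _ _ P).
  have : 0 <= P / T by rewrite divr_ge0// ltW.
  by have := t0 i; nra.
rewrite /P powRN ler_pdivrMr ?powR_gt0 ?addr_gt0//.
have e1 := Delta_gt0 (i%:R / m%:R : R) m0.
rewrite /Delta_coef -powRM ?(ltW e1) ?addr_ge0 ?(ltW T0)//.
apply: ge0_ler_powR; rewrite ?nnegrE ?(ltW d0) ?mulr_ge0 ?addr_ge0 ?(ltW e1) ?(ltW T0)//.
apply: (le_trans (Delta_shift_rel m0 x01 i01)).
by rewrite ler_wpM2l ?(ltW e1)// lerD2l.
Qed.

(** The Taylor polynomial at x has degree at most m, so L maps it to the average of
its own Bernstein coefficients, and the error is an average of the differences
estimated in [taylor_coef_change]. *)
Lemma avg_taylor_coef (R : realType) (D : nat -> R -> R) (r : nat) (alpha C : R) :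
    r%:R <= alpha -> 0 <= C ->
    (forall j x y, (j <= r)%N -> x \in `[0, 1] -> y \in `[0, 1] ->
      `|D j y - (taylor D r x)^`(j).[y]| <= C * `|y - x| `^ (alpha - j%:R)) ->
  exists2 K : R, 0 < K & forall m x (L : {scalar {poly R}}),
    (1 <= m)%N -> (2 * r <= m)%N -> x \in `[0, 1] -> averages m x L ->
    `|L (bernstein m (taylor_coef D r m)) - L (taylor D r x)| <=
      K * Delta m x `^ alpha.
Proof.
move=> ra C0 HC; have [K K0 HK] := taylor_coef_change ra C0 HC.
have a0 : 0 <= alpha by apply: le_trans ra.
have [M M0 HM] := avg_shifted_powR a0.
exists (K * M + 1); first by rewrite ltr_wpDl// mulr_ge0// ltW.
move=> m x L m0 rm x01 avL.
have sT : (size (taylor D r x) <= m.+1)%N.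
  by apply: (leq_trans (size_taylor _ _ _)); lia.
rewrite -{1}(bernstein_bcoef sT) -linearB/= -bernsteinB.
apply: (@le_trans _ _ (K * M * Delta m x `^ alpha)); last first.
  by rewrite ler_wpM2r ?powR_ge0// lerDl.
apply: (@le_trans _ _ (L (bernstein m
    (fun i => K * (Delta m x + `|i%:R / m%:R - x|) `^ alpha)))).
  by apply: (avg_norm_le avL) => i im; apply: HK.
by rewrite avgZ -mulrA ler_wpM2l// HM.
Qed.

Lemma horner_bounded01 (R : realType) (p : {poly R}) :
  exists2 B : R, 0 <= B & forall x : R, x \in `[0, 1] -> `|p.[x]| <= B.
Proof.
exists (\sum_(j < size p) `|p`_j|); first by rewrite sumr_ge0.
move=> x; rewrite in_itv/= => /andP[x0 x1]; rewrite horner_coef.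
apply: (le_trans (ler_norm_sum _ _ _)); apply: ler_sum => j _.
by rewrite normrM ler_piMr// ger0_norm ?exprn_ge0// exprn_ile1.
Qed.

Lemma taylor_coef_close (R : realType) (D : nat -> R -> R) (r : nat) (alpha C : R) :
    r%:R <= alpha -> 0 <= C ->
    (forall j x y, (j <= r)%N -> x \in `[0, 1] -> y \in `[0, 1] ->
      `|D j y - (taylor D r x)^`(j).[y]| <= C * `|y - x| `^ (alpha - j%:R)) ->
  exists2 K : R, 0 < K & forall n k, (1 <= n)%N -> (2 * r <= n)%N -> (k <= n)%N ->
    `|taylor_coef D r n k - D 0%N (k%:R / n%:R)| <= K * Delta n (k%:R / n%:R).
Proof.
move=> ra C0 HC; have [B B0 HB] := bcoef_centered_pow_unif R r.
have [j A A' H AA' x x01|j jr|A A0 HA] := @bounded_upto R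
    (fun j A => forall x : R, x \in `[0, 1] -> `|D j x| <= A) r.
- by apply: (le_trans (H x x01)).
- have [A A0 HA] := horner_bounded01 (taylor D r 0)^`(j).
  exists (C + A) => x x01; rewrite -[D j x](subrK (taylor D r 0)^`(j).[x]).
  apply: (le_trans (ler_normD _ _)); apply: lerD; last exact: HA.
  have z01 : 0 \in `[0 : R, 1] by rewrite in_itv/= lexx ler01.
  apply: (le_trans (HC j 0 x jr z01 x01)); rewrite -[leRHS]mulr1 ler_wpM2l//.
  have ja : j%:R <= alpha by apply: le_trans ra; rewrite ler_nat.
  move: x01; rewrite in_itv/= subr0 => /andP[x0 x1].
  rewrite ger0_norm// -[leRHS](one_powR (alpha - j%:R)).
  by apply: ge0_ler_powR; rewrite ?nnegrE// subr_ge0.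
exists (A * B *+ r + 1); first by rewrite ltr_wpDl// mulrn_wge0// mulr_ge0.
move=> n k n0 rn kn; set y : R := k%:R / n%:R.
have y01 : y \in `[0, 1] by apply: frac_in01.
have d0 := Delta_gt0 y n0; have d1 := Delta_le1 n0 y01.
apply: (@le_trans _ _ (A * B *+ r * Delta n y)); last by rewrite ler_wpM2r ?(ltW d0)// lerDl.
rewrite /taylor_coef -/y /taylor.
have -> (F : 'I_r.+1 -> {poly R}) : bcoef n k (\sum_j F j) = \sum_j bcoef n k (F j).
  exact: linear_sum.
rewrite big_ord_recl/= expr0 bcoefZ bcoef1 fact0 divr1 mulr1 addrC addKr.
apply: (le_trans (ler_norm_sum _ _ _)).
apply: (@le_trans _ _ (\sum_(j < r) A * B * Delta n y)); last first.
  by rewrite sumr_const card_ord mulrnAl.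
apply: ler_sum => j _; rewrite /bump leq0n add1n bcoefZ normrM -mulrA.
have jr : (j.+1 <= r)%N by case: j.
apply: ler_pM => //.
  rewrite normrM normfV normr_nat -[leRHS]mulr1; apply: ler_pM => //.
  - exact: HA.
  - by rewrite invf_le1 ?ler1n ?ltr0n fact_gt0.
apply: (le_trans (HB _ _ _ jr n0 rn kn)); rewrite ler_wpM2l//.
by rewrite exprS ler_piMr ?(ltW d0)// exprn_ile1 ?(ltW d0).
Qed.

(** * Monotone dyadic envelopes *)

Lemma bcoef_le_elevate (R : realType) (m n : nat) (p q : {poly R}) :
    (1 <= n)%N -> (m <= n)%N -> (size p <= m.+1)%N -> (size q <= m.+1)%N ->
    (forall i, (i <= m)%N -> bcoef m i p <= bcoef m i q) ->
  forall k, (k <= n)%N -> bcoef n k p <= bcoef n k q.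
Proof.
move=> n0 mn sp sq pq k kn.
rewrite -(bernstein_bcoef sp) -(bernstein_bcoef sq).
exact: (avg_le (averages_bcoef R n0 kn mn)).
Qed.

Definition dyadic (R : realType) (n k : nat) (v : R) : Prop :=
  exists z : int, 'C(n, k)%:R * v = z%:~R * 2 ^- n.

Definition dyadic_floor (R : realType) (n k : nat) (v : R) : R :=
  (Num.floor (v * (2 ^+ n * 'C(n, k)%:R)))%:~R / (2 ^+ n * 'C(n, k)%:R).

Lemma dyadic_floorP (R : realType) (n k : nat) (v : R) : (k <= n)%N ->
  dyadic n k (dyadic_floor n k v) /\
  v - 2 ^- n <= dyadic_floor n k v <= v.
Proof.
move=> kn; have C1 : 1 <= 'C(n, k)%:R :> R by rewrite ler1n bin_gt0.
have p0 : 0 < 2 ^+ n :> R by rewrite exprn_gt0.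
have q0 : 0 < 2 ^+ n * 'C(n, k)%:R :> R by rewrite mulr_gt0//; lra.
split.
  exists (Num.floor (v * (2 ^+ n * 'C(n, k)%:R))); rewrite /dyadic_floor.
  by field; rewrite !gt_eqF//; lra.
rewrite /dyadic_floor ler_pdivrMr// floor_le andbT ler_pdivlMr//.
apply/ltW; apply: le_lt_trans (_ : v * (2 ^+ n * 'C(n, k)%:R) - 1 < _).
  by rewrite mulrBl lerD2l lerN2 mulrA mulVf ?gt_eqF// mul1r.
by rewrite ltrBlDr; have := floorD1_gt (v * (2 ^+ n * 'C(n, k)%:R)); rewrite intrD.
Qed.

Lemma dyadic_elevate (R : realType) (m n k : nat) (c : nat -> R) :
    (m <= n)%N -> (k <= n)%N -> (forall i, (i <= m)%N -> dyadic m i (c i)) ->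
  dyadic n k (bcoef n k (bernstein m c)).
Proof.
move=> mn kn dc.
have [z Hz] : exists z : nat -> int, forall i, (i <= m)%N ->
    'C(m, i)%:R * c i = (z i)%:~R * 2 ^- m.
  have : forall i : nat, exists z : int, (i <= m)%N -> 'C(m, i)%:R * c i = z%:~R * 2 ^- m.
    move=> i; case: (leqP i m) => im; last by exists 0.
    by have [z Hz] := dc i im; exists z.
  by move=> /choice[z Hz]; exists z.
exists (\sum_(i < m.+1) z i * (if (i <= k)%N then 'C(n - m, k - i) else 0%N)%:Z * 2 ^+ (n - m)).
rewrite (avgE _ (@bcoef R n k)) rmorph_sum/= mulr_sumr mulr_suml; apply: eq_bigr => i _.
have im : (i <= m)%N by rewrite -ltnS.
rewrite mulrCA bcoef_basis// Hz// !rmorphM/= rmorphXn/=.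
have -> : 2 ^- n = 2 ^- m * 2 ^- (n - m) :> R.
  by rewrite -invfM -exprD subnKC.
rewrite -pmulrn; field.
by rewrite !expf_neq0.
Qed.

Lemma dyadic1B (R : realType) (n k : nat) (v : R) : dyadic n k v -> dyadic n k (1 - v).
Proof.
move=> [z Hz]; exists (2 ^+ n * 'C(n, k)%:Z - z).
rewrite mulrBr Hz mulr1 rmorphB/= rmorphM/= rmorphXn/= mulrBl; congr (_ - _).
by rewrite -pmulrn mulrAC divff ?mul1r// expf_neq0.
Qed.

(** The largest n0 M^j that is at most n, when n0 <= n. *)
Definition scale (n0 M n : nat) : nat := (n0 * M ^ trunc_log M (n %/ n0))%N.

Lemma scale_bounds (n0 M n : nat) : (1 <= n0)%N -> (1 < M)%N -> (n0 <= n)%N ->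
  [/\ (n0 <= scale n0 M n)%N, (scale n0 M n <= n)%N & (n <= M * scale n0 M n)%N].
Proof.
move=> n00 M1 n0n; rewrite /scale.
have q0 : (0 < n %/ n0)%N by rewrite divn_gt0.
have /andP[h1 h2] := trunc_log_bounds M1 q0.
have e0 : (0 < M ^ trunc_log M (n %/ n0))%N by rewrite expn_gt0 (ltnW M1).
split; first by rewrite leq_pmulr.
  by rewrite mulnC -leq_divRL.
rewrite mulnCA -expnS; apply/ltnW; rewrite mulnC -ltn_divLR//.
Qed.

(** With E = Delta^alpha in mind. In [ld_step] the coefficient K + 1 instead of K
leaves the margin E, which by [ld_dyadic] covers the error of rounding down to a
dyadic number. *)
Record lower_data (R : realType) (A E : nat -> nat -> R) (K : R) (n0 M : nat) : Prop :=
  LowerData {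
    ld_dyadic : forall n k, (n0 <= n)%N -> (k <= n)%N -> 2 ^- n <= E n k;
    ld_pos : forall n k, (n0 <= n)%N -> (k <= n)%N -> (K + 1) * E n k <= A n k;
    ld_step : forall m k, (n0 <= m)%N -> (k <= M * m)%N ->
      bcoef (M * m) k (bernstein m (fun i => A m i - K * E m i)) <=
        A (M * m)%N k - (K + 1) * E (M * m)%N k }.

Definition lower_poly (R : realType) (A E : nat -> nat -> R) (K : R) (m : nat) :
    {poly R} :=
  bernstein m (fun i => dyadic_floor m i (A m i - K * E m i)).

(** The envelope changes at the degrees n0 M^j only; in between its degree is
elevated, which preserves dyadic coefficients. *)
Definition lower_coef (R : realType) (A E : nat -> nat -> R) (K : R) (n0 M n k : nat) : R :=
  if (n < n0)%N then 0 else bcoef n k (lower_poly A E K (scale n0 M n)).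

Lemma lower_poly_scales (R : realType) (A E : nat -> nat -> R) (K : R) (n0 M : nat) :
    (1 <= n0)%N -> (1 < M)%N -> lower_data A E K n0 M ->
  forall i j n k, (i <= j)%N -> (n0 * M ^ j <= n)%N -> (k <= n)%N ->
    bcoef n k (lower_poly A E K (n0 * M ^ i)) <=
    bcoef n k (lower_poly A E K (n0 * M ^ j)).
Proof.
move=> n00 M1 [Hd _ Hs] i j n k ij jn kn; move: jn.
have Mp l : (0 < M ^ l)%N by rewrite expn_gt0 (ltnW M1).
elim: j ij => [|j IH]; first by rewrite leqn0 => /eqP ->.
rewrite leq_eqVlt => /orP[/eqP ->//|]; rewrite ltnS => ij jn.
have jj : (n0 * M ^ j <= n0 * M ^ j.+1)%N by rewrite leq_pmul2l// leq_exp2l.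
apply: (le_trans (IH ij (leq_trans jj jn))).
set m := (n0 * M ^ j)%N; have mE : (n0 * M ^ j.+1 = M * m)%N.
  by rewrite /m expnS mulnCA.
rewrite mE in jn jj *; have m0 : (n0 <= m)%N by rewrite leq_pmulr.
have Mm0 : (n0 <= M * m)%N by lia.
apply: (bcoef_le_elevate _ jn) => //; [lia|..].
- by apply: (leq_trans (size_bernstein _ _)); rewrite ltnS.
- exact: size_bernstein.
move=> l lm; rewrite [in leRHS]/lower_poly bcoef_bernstein//.
have [_ /andP[h _]] := dyadic_floorP (A (M * m)%N l - K * E (M * m)%N l) lm.
apply: le_trans h.
have l0 : (1 <= M * m)%N by lia.
apply: (@le_trans _ _ (bcoef (M * m) l (bernstein m (fun i => A m i - K * E m i)))).
  apply: (avg_le (averages_bcoef R l0 lm jj)) => t tm.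
  by have [_ /andP[]] := dyadic_floorP (A m t - K * E m t) tm.
apply: (le_trans (Hs m l m0 lm)); have := Hd _ _ Mm0 lm; lra.
Qed.

Lemma lower_coef_spec (R : realType) (A E : nat -> nat -> R) (K : R) (n0 M : nat) :
    (1 <= n0)%N -> (1 < M)%N -> lower_data A E K n0 M ->
  let a := lower_coef A E K n0 M in
  [/\ forall n k, (1 <= n)%N -> (k <= n)%N -> 0 <= a n k,
      forall n k, (1 <= n)%N -> (k <= n)%N -> dyadic n k (a n k),
      forall n, (n0 <= n)%N -> bernstein n (a n) = lower_poly A E K (scale n0 M n) &
      forall m n, (1 <= m)%N -> (m <= n)%N ->
        bernstein_le n (bernstein m (a m)) (bernstein n (a n))].
Proof.
move=> n00 M1 ld a.
have sz n : (n0 <= n)%N -> (size (lower_poly A E K (scale n0 M n)) <= n.+1)%N.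
  move=> n0n; have [h1 h2 h3] := scale_bounds n00 M1 n0n.
  by apply: (leq_trans (size_bernstein _ _)).
have ge0 n k : (1 <= n)%N -> (k <= n)%N -> 0 <= a n k.
  move=> n1 kn; rewrite /a /lower_coef; case: ltnP => // n0n.
  have [h1 h2 h3] := scale_bounds n00 M1 n0n.
  have av := averages_bcoef R n1 kn h2.
  rewrite -(avg_const 0 av); apply: (avg_le av) => i im.
  have [_ /andP[h _]] := dyadic_floorP (A (scale n0 M n) i - K * E (scale n0 M n) i) im.
  apply: le_trans h; have := ld_dyadic ld h1 im; have := ld_pos ld h1 im; lra.
have rep n : (n0 <= n)%N -> bernstein n (a n) = lower_poly A E K (scale n0 M n).
  move=> n0n; rewrite -[RHS](bernstein_bcoef (sz n n0n)); apply: eq_bernstein => k kn.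
  by rewrite /a /lower_coef ltnNge n0n.
split => //.
- move=> n k n1 kn; rewrite /a /lower_coef; case: ltnP => [_|n0n].
    by exists 0; rewrite mulr0 mul0r.
  have [h1 h2 h3] := scale_bounds n00 M1 n0n.
  by apply: dyadic_elevate => // i im; have [] := dyadic_floorP (A (scale n0 M n) i - K * E (scale n0 M n) i) im.
- move=> m n m1 mn; have n1 := leq_trans m1 mn.
  apply: bernstein_leP; [|exact: size_bernstein|].
    by apply: (leq_trans (size_bernstein _ _)); rewrite ltnS.
  move=> k kn; rewrite bcoef_bernstein//.
  have [mn0|n0m] := ltnP m n0.
    rewrite (_ : bernstein m (a m) = 0) ?linear0 ?ge0//.
    rewrite (@eq_bernstein _ _ _ (fun=> 0)) ?bernstein_const// => i _.
    by rewrite /a /lower_coef mn0.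
  have n0n := leq_trans n0m mn.
  rewrite rep// {1}/a /lower_coef ltnNge n0n /=.
  have [h1 h2 h3] := scale_bounds n00 M1 n0n.
  apply: (lower_poly_scales n00 M1 ld) => //.
  by apply: leq_trunc_log; apply: leq_div2r.
Qed.

(** * Choice of the scales *)

(** The estimate of n^(alpha + 1) leaves a factor n that absorbs the constant. *)
Lemma powR_le_exp2 (R : realType) (alpha : R) : 0 <= alpha ->
  exists N : nat, forall n, (N <= n)%N -> (1 <= n)%N -> n%:R `^ alpha <= 2 ^+ n :> R.
Proof.
move=> a0; have [K K0 HK] := @powR_le_exp R (alpha + 1) (addr_ge0 a0 ler01).
exists (Num.truncn K).+1 => n nN n1; have nR : 0 < n%:R :> R by rewrite ltr0n.
have Kn : K <= n%:R by apply: (le_trans (ltW (truncnS_gt K))); rewrite ler_nat.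
(* The bound exp (1/2) <= 2 turns the exponential of [powR_le_exp] into a power
of 2. *)
have h : n%:R `^ (alpha + 1) <= K * 2 ^+ n.
  apply: (@le_trans _ _ ((1 + n%:R) `^ (alpha + 1))).
    by apply: ge0_ler_powR; rewrite ?nnegrE ?addr_ge0// lerDr.
  apply: (le_trans (HK n%:R _)) => //; apply: ler_wpM2l => //.
  rewrite mulrC expRM_natr; apply: lerXn2r; rewrite ?nnegrE ?expR_ge0//.
  by have := @expR_le_quad R 2^-1 ltac:(lra); lra.
move: h; rewrite (@powR_mulXn _ n%:R (alpha + 1) 1) ?addr_ge0 ?lerDr// addrK expr1 => h.
rewrite -(ler_pM2r nR) (le_trans h)// mulrC ler_wpM2l ?exprn_ge0//.
Qed.

Lemma holder_continuous (R : realType) (g : R -> R) (C d : R) : 0 < d -> 0 <= C ->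
    (forall x y : R, x \in `[0, 1] -> y \in `[0, 1] ->
      `|g x - g y| <= C * `|x - y| `^ d) ->
  {within `[0 : R, 1], continuous g}.
Proof.
move=> d0 C0 H; apply/subspace_continuousP => x x01.
apply/cvgrPdist_le => e e0; have C1 : 0 < C + 1 by rewrite ltr_wpDl.
apply/nbhs_ballP; exists ((e / (C + 1)) `^ d^-1) => /=.
  by rewrite powR_gt0// divr_gt0.
move=> y; rewrite /ball/= => yx y01; apply: (le_trans (H x y x01 y01)).
apply: (@le_trans _ _ ((C + 1) * `|x - y| `^ d)).
  by rewrite ler_wpM2r ?powR_ge0// lerDl.
rewrite mulrC -ler_pdivlMr//.
have -> : e / (C + 1) = ((e / (C + 1)) `^ d^-1) `^ d.
  by rewrite -powRrM mulVf ?gt_eqF// powRr1// divr_ge0// ltW.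
by apply: ge0_ler_powR; rewrite ?nnegrE ?powR_ge0// ltW.
Qed.

Lemma truncn_lt_nonint (R : realType) (alpha : R) : 0 < alpha ->
  (forall m : nat, alpha <> m%:R) ->
  (Num.truncn alpha)%:R < alpha < (Num.truncn alpha).+1%:R.
Proof.
move=> a0 an; rewrite truncnS_gt andbT lt_neqAle truncn_le ?(ltW a0)// andbT.
by apply/eqP => h; apply: (an (Num.truncn alpha)).
Qed.

Lemma continuous_range01 (R : realType) (f g : R -> R) :
    (forall x : R, x \in `[0, 1] -> 0 < f x < 1) -> {in `[0, 1], g =1 f} ->
    {within `[0 : R, 1], continuous g} ->
  exists2 e, 0 < e & forall x : R, x \in `[0, 1] -> e <= f x <= 1 - e.
Proof.
move=> hf gf cg.
have [u u01 Hu] := EVT_min (@ler01 R) cg; have [v v01 Hv] := EVT_max (@ler01 R) cg.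
have [/andP[fu0 fu1] /andP[fv0 fv1]] := (hf u u01, hf v v01).
exists (Num.min (f u) (1 - f v)); first by rewrite lt_min fu0 subr_gt0.
move=> x x01; rewrite ge_min -(gf x x01) -(gf u u01) Hu//=.
rewrite lerBrDl -lerBrDr ge_min; apply/orP; right.
by rewrite -(gf v v01) lerD2l lerN2 Hv.
Qed.

Lemma leq_addP (a b n : nat) : (a + b <= n)%N -> (a <= n)%N /\ (b <= n)%N.
Proof. lia. Qed.

Lemma Delta_small (R : realType) (e : R) : 0 < e ->
  exists2 N : nat, (1 <= N)%N & forall n (x : R), (N <= n)%N -> x \in `[0, 1] ->
    Delta n x <= e.
Proof.
move=> e0; exists (Num.truncn (e ^- 2)).+1 => // n x Nn x01.
have n1 : (1 <= n)%N by lia.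
have nR : 0 < n%:R :> R by rewrite ltr0n.
rewrite -(ler_pXn2r (n := 2)) ?nnegrE ?(ltW e0) ?(ltW (Delta_gt0 _ _))//.
apply: (le_trans (Delta_sqr_le n1 x01)).
rewrite -[leRHS]invrK lef_pV2 ?posrE ?invr_gt0 ?exprn_gt0//.
by apply: (le_trans (ltW (truncnS_gt _))); rewrite ler_nat.
Qed.

Lemma Delta_powR_small (R : realType) (alpha C e : R) : 0 < alpha -> 0 < e ->
  exists2 N, (1 <= N)%N & forall n (x : R), (N <= n)%N -> x \in `[0, 1] ->
    C * Delta n x `^ alpha <= e.
Proof.
move=> a0 e0; have C1 : 0 < `|C| + 1 by rewrite ltr_wpDl.
have h0 : 0 < (e / (`|C| + 1)) `^ alpha^-1 by rewrite powR_gt0// divr_gt0.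
have [N N0 HN] := Delta_small h0; exists N => // n x Nn x01.
have d0 := Delta_gt0 x (leq_trans N0 Nn).
apply: (@le_trans _ _ ((`|C| + 1) * Delta n x `^ alpha)).
  by rewrite ler_wpM2r ?powR_ge0// (le_trans (ler_norm C))// lerDl.
rewrite mulrC -ler_pdivlMr//.
have -> : e / (`|C| + 1) = ((e / (`|C| + 1)) `^ alpha^-1) `^ alpha.
  by rewrite -powRrM mulVf ?gt_eqF// powRr1// divr_ge0// ltW.
by apply: ge0_ler_powR; rewrite ?nnegrE ?powR_ge0 ?(ltW a0) ?(ltW d0)//; exact: HN.
Qed.

Lemma C_alpha01_coefs (R : realType) (f : R -> R) (alpha : R) :
    (forall x : R, x \in `[0, 1] -> 0 < f x < 1) -> 0 < alpha ->
    (forall m : nat, alpha <> m%:R) -> C_alpha01 alpha f ->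
  exists (A : nat -> nat -> R) (C e : R) (n1 : nat),
    [/\ 0 < C, 0 < e, (1 <= n1)%N,
        forall m x, (n1 <= m)%N -> x \in `[0, 1] ->
          `|(bernstein m (A m)).[x] - f x| <= C * Delta m x `^ alpha &
        (forall m n k, (n1 <= m)%N -> (m <= n)%N -> (k <= n)%N ->
          `|bcoef n k (bernstein m (A m)) - A n k| <=
            C * Delta m (k%:R / n%:R) `^ alpha) /\
        forall n k, (n1 <= n)%N -> (k <= n)%N -> e <= A n k <= 1 - e].
Proof.
move=> hf a0 an [D []]; have /andP[ra _] := truncn_lt_nonint a0 an.
move: (Num.truncn alpha) ra => r ra Df HD HC.
have d0 : 0 < alpha - r%:R by rewrite subr_gt0.
have [C C0 hold] := modulus_holder d0 HC.
have rem := taylor_remainder (ltW ra) HD hold C0.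
have cD : {within `[0 : R, 1], continuous (D 0%N)}.
  move: HD hold d0; case: (r) => [_ hold d0|r' HD _ _]; last exact: deriv_on01_continuous (HD 0%N isT).
  exact: holder_continuous d0 C0 hold.
have [e e0 fe] := continuous_range01 hf Df cD.
have [K1 K10 H1] := avg_taylor_coef (ltW ra) C0 rem.
have [K2 K20 H2] := taylor_coef_close (ltW ra) C0 rem.
have e2 : 0 < e / 2 / K2 by rewrite !divr_gt0.
have [N N0 HN] := Delta_small e2.
exists (taylor_coef D r), K1, (e / 2), (N + 2 * r)%N; split => //.
- by rewrite divr_gt0.
- by rewrite (leq_trans N0) ?leq_addr.
- move=> m x /leq_addP[Nm rm] x01.
  have := H1 m x (horner_eval x) (leq_trans N0 Nm) rm x01 (averages_horner m x01).
  rewrite /= /horner_eval; congr (`|_ - _| <= _).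
  by rewrite -(Df x x01) -(derivn_taylor D x (leq0n r)) derivn0.
split.
- move=> m n k /leq_addP[Nm rm] mn kn; have m1 := leq_trans N0 Nm.
  have n1 := leq_trans m1 mn.
  by have := H1 m _ (@bcoef R n k) m1 rm (frac_in01 R n1 kn) (averages_bcoef R n1 kn mn).
- move=> n k /leq_addP[Nn rn] kn; have n1 := leq_trans N0 Nn.
  have y01 := frac_in01 R n1 kn.
  have := H2 n k n1 rn kn; rewrite (Df _ y01).
  have := HN n _ Nn y01; rewrite ler_pdivlMr// mulrC => h.
  move=> /le_trans/(_ h); rewrite ler_norml => /andP[h1 h2].
  by have /andP[h3 h4] := fe _ y01; apply/andP; split; lra.
Qed.

Lemma bernstein_1B (R : realType) (n : nat) (c : nat -> R) :
  bernstein n (fun k => 1 - c k) = 1 - bernstein n c.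
Proof. by rewrite (bernsteinB n (fun=> 1)) bernstein_const. Qed.

Lemma avg_1B (R : realType) (m : nat) (x : R) (L : {scalar {poly R}}) (c : nat -> R) :
  averages m x L -> L (bernstein m (fun i => 1 - c i)) = 1 - L (bernstein m c).
Proof. by move=> [L1 _ _ _]; rewrite bernstein_1B linearB/= L1. Qed.

Lemma avgB (R : realType) (m : nat) (L : {scalar {poly R}}) (c d : nat -> R) :
  L (bernstein m (fun i => c i - d i)) = L (bernstein m c) - L (bernstein m d).
Proof. by rewrite bernsteinB linearB. Qed.

(** The parameters do not depend on A, since they have to serve A and 1 - A together.
The ratio M = l^2 is such that Delta (M m) y ^ alpha <= c / 4 Delta m y ^ alpha;
then K is such that K c >= C + (K + 1) c / 4; finally n0 is large enough for the
conditions on the range and on the rounding. *)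
Lemma lower_data_exist (R : realType) (alpha C e : R) (n1 : nat) :
    0 < alpha -> 0 < C -> 0 < e -> (1 <= n1)%N ->
  exists (K c : R) (n0 M : nat),
  [/\ 0 <= K, (n1 <= n0)%N, (1 < M)%N & C <= K * c] /\
    (forall m x (L : {scalar {poly R}}), (1 <= m)%N -> x \in `[0, 1] ->
       averages m x L ->
       c * Delta m x `^ alpha <= L (bernstein m (Delta_coef alpha m))) /\
    forall A : nat -> nat -> R,
      (forall m n k, (n1 <= m)%N -> (m <= n)%N -> (k <= n)%N ->
          bcoef n k (bernstein m (A m)) - A n k <=
            C * Delta m (k%:R / n%:R) `^ alpha) ->
      (forall n k, (n1 <= n)%N -> (k <= n)%N -> e <= A n k) ->
      lower_data A (Delta_coef alpha) K n0 M.
Proof.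
move=> a0 C0 e0 n10.
have [c c0 Hc] := @avg_Delta_coef_ge R alpha (ltW a0).
(* With l >= w, the factor l^-alpha is at most c / 4. *)
pose w := (4 / c) `^ alpha^-1; pose l := (Num.truncn w).+2.
pose K := 1 + 2 * (C / c).
have Cc : 0 < C / c by rewrite divr_gt0.
have K0 : 0 < K by rewrite /K; lra.
have K1 : 0 < K + 1 by lra.
have KcC : K * c = c + 2 * C by rewrite /K; field; rewrite gt_eqF.
have lR : 0 < l%:R :> R by rewrite ltr0n.
have lw : 4 / c <= l%:R `^ alpha.
  have -> : 4 / c = w `^ alpha.
    by rewrite -powRrM mulVf ?gt_eqF// powRr1// divr_ge0// ltW.
  apply: ge0_ler_powR; rewrite ?nnegrE ?powR_ge0 ?(ltW a0)//.
  by apply/ltW/(lt_trans (truncnS_gt w)); rewrite ltr_nat.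
have [N1 N10 HN1] := Delta_powR_small (K + 1) a0 e0.
have [N2 HN2] := @powR_le_exp2 R alpha (ltW a0).
exists K, c, (n1 + N1 + N2)%N, (l ^ 2)%N; split.
  split; [exact: ltW|by rewrite -addnA leq_addr| |by rewrite KcC; lra].
  by rewrite -[1%N](exp1n 2) ltn_exp2r.
split; first by move=> m x L; exact: Hc.
have parts n : (n1 + N1 + N2 <= n)%N -> [/\ (n1 <= n)%N, (N1 <= n)%N, (N2 <= n)%N & (1 <= n)%N].
  by move=> /leq_addP[/leq_addP[h1 h2] h3]; split => //; exact: leq_trans h1.
move=> A HA Ae; split.
- move=> n k /parts[n1n N1n N2n n1'] kn.
  have nR : 0 < n%:R :> R by rewrite ltr0n.
  apply: (@le_trans _ _ (n%:R^-1 `^ alpha)); last first.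
    by apply: ge0_ler_powR; rewrite ?nnegrE ?invr_ge0 ?(ltW a0) ?(ltW (Delta_gt0 _ _)) ?Delta_ge_inv.
  rewrite -(powR_inv1 (ltW nR)) -powRrM mulN1r powRN lef_pV2 ?posrE ?exprn_gt0 ?powR_gt0//.
  exact: HN2.
- move=> n k /parts[n1n N1n N2n n1'] kn.
  apply: le_trans (Ae n k n1n kn).
  by apply: HN1 => //; apply: frac_in01.
- move=> m k /parts[n1m N1m N2m m1] kn; set n := (l ^ 2 * m)%N in kn *.
  have l2 : (1 <= l ^ 2)%N by rewrite expn_gt0.
  have mn : (m <= n)%N by rewrite leq_pmull.
  have n1' := leq_trans m1 mn.
  have y01 := frac_in01 R n1' kn; set y := _ / _ in y01.
  have avL := averages_bcoef R n1' kn mn; rewrite -/y in avL.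
  rewrite avgB avgZ/=.
  have h1 := HA m n k n1m mn kn; rewrite -/y in h1.
  have h2 := Hc m y _ m1 y01 avL; rewrite /= in h2.
  set p := Delta m y `^ alpha in h1 h2.
  have p0 : 0 <= p by rewrite powR_ge0.
  have h3 : Delta_coef alpha n k <= c / 4 * p.
    apply: (@le_trans _ _ ((Delta m y / l%:R) `^ alpha)).
      apply: ge0_ler_powR; rewrite ?nnegrE ?(ltW a0) ?divr_ge0 ?(ltW (Delta_gt0 _ _))//.
      apply: (le_trans (Delta_mul l2 m1 y01)).
      by rewrite natrX sqrtr_sqr gtr0_norm.
    rewrite powRM ?invr_ge0 ?(ltW (Delta_gt0 _ _))// -/p mulrC ler_wpM2r//.
    rewrite -(powR_inv1 (ltW lR)) -powRrM mulN1r powRN.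
    by rewrite -[leRHS]invrK invf_div lef_pV2 ?posrE ?powR_gt0// divr_gt0.
  have h4 : K * (c * p) <= K * bcoef n k (bernstein m (Delta_coef alpha m)).
    by rewrite ler_wpM2l// ltW.
  have h5 : (K + 1) * Delta_coef alpha n k <= (K + 1) * (c / 4 * p).
    by rewrite ler_wpM2l// ltW.
  have h6 : (K + 1) * (c / 4 * p) = (c / 2 + C / 2) * p.
    have -> : (K + 1) * (c / 4 * p) = (K * c + c) / 4 * p by field.
    by rewrite KcC; field.
  have h7 : K * (c * p) = (c + 2 * C) * p by rewrite mulrA KcC.
  have h8 : 0 <= c * p by rewrite mulr_ge0// ltW.
  have h9 : 0 <= C * p by rewrite mulr_ge0// ltW.
  lra.
Qed.

Definition envelopes (R : realType) (f : R -> R) (alpha : R) (a b : nat -> nat -> R) :=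
  [/\ (forall n k, (1 <= n)%N -> (k <= n)%N ->
         [/\ 0 <= a n k, a n k <= b n k & b n k <= 1]),
      (forall n k, (1 <= n)%N -> (k <= n)%N ->
         (exists z : int, 'C(n, k)%:R * a n k = z%:~R * 2 ^- n) /\
         (exists z : int, 'C(n, k)%:R * b n k = z%:~R * 2 ^- n)),
      (forall n p, (1 <= n)%N -> p \in `[0, 1] ->
         (bernstein n (a n)).[p] <= f p <= (bernstein n (b n)).[p]),
      (forall m n, (1 <= m)%N -> (m < n)%N ->
         bernstein_le n (bernstein m (a m)) (bernstein n (a n)) /\
         bernstein_le n (bernstein n (b n)) (bernstein m (b m))) &
      exists C : R, forall n x, (1 <= n)%N -> x \in `[0, 1] ->
        `|(bernstein n (b n)).[x] - (bernstein n (a n)).[x]|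
          <= C * Delta n x `^ alpha].

Lemma lower_poly_bounds (R : realType) (A E : nat -> nat -> R) (K : R) (m : nat)
    (x : R) (L : {scalar {poly R}}) :
    (forall i, (i <= m)%N -> 2 ^- m <= E m i) -> averages m x L ->
  L (bernstein m (A m)) - (K + 1) * L (bernstein m (E m)) <=
    L (lower_poly A E K m) <=
    L (bernstein m (A m)) - K * L (bernstein m (E m)).
Proof.
move=> mE avL; rewrite -!avgZ -!avgB; apply/andP; split; apply: (avg_le avL) => i im.
  have [_ /andP[h _]] := dyadic_floorP (A m i - K * E m i) im.
  by apply: le_trans h; have := mE i im; lra.
by have [_ /andP[]] := dyadic_floorP (A m i - K * E m i) im.
Qed.

(** The upper envelope is the complement of the lower envelope of 1 - f. Both are
built on the same scales, so that they lie on either side of the Bernstein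
polynomial with coefficients A. *)
Lemma envelopes_exist (R : realType) (f : R -> R) (alpha : R) :
    (forall x : R, x \in `[0, 1] -> 0 < f x < 1) -> 0 < alpha ->
    (forall m : nat, alpha <> m%:R) -> C_alpha01 alpha f ->
  exists a b, envelopes f alpha a b.
Proof.
move=> hf a0 an /(C_alpha01_coefs hf a0 an)[A [C [e [N [C0 e0 n11 app [step rng]]]]]].
have [K [c [n0 [M [[K0 n10 M1 CKc] [Hc ldA]]]]]] := lower_data_exist a0 C0 e0 n11.
have [C2 C20 HC2] := @avg_Delta_coef_le R alpha (ltW a0).
pose A' n k := 1 - A n k; pose E : nat -> nat -> R := Delta_coef alpha.
have n00 : (1 <= n0)%N by exact: leq_trans n10.
have ld : lower_data A E K n0 M.
  apply: ldA => [m n k n1m mn kn|n k n1n kn]; last by have /andP[] := rng n k n1n kn.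
  by have := step m n k n1m mn kn; rewrite ler_norml => /andP[].
have ld' : lower_data A' E K n0 M.
  apply: ldA => [m n k n1m mn kn|n k n1n kn]; last first.
    by have /andP[h1 h2] := rng n k n1n kn; rewrite /A'; lra.
  have m1 := leq_trans n11 n1m; have n1' := leq_trans m1 mn.
  rewrite (avg_1B _ (averages_bcoef R n1' kn mn))/=.
  by have := step m n k n1m mn kn; rewrite ler_norml /A' => /andP[]; lra.
have E0 n k : (n0 <= n)%N -> (k <= n)%N -> 0 <= E n k by move=> _ _; apply: powR_ge0.
have [a_ge0 a_dy a_rep a_mono] := lower_coef_spec n00 M1 ld.
have [b_ge0 b_dy b_rep b_mono] := lower_coef_spec n00 M1 ld'.
set a := lower_coef A E K n0 M in a_ge0 a_dy a_rep a_mono *.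
set b := lower_coef A' E K n0 M in b_ge0 b_dy b_rep b_mono *.
have mE m i : (n0 <= m)%N -> (i <= m)%N -> 2 ^- m <= E m i by exact: (ld_dyadic ld).
have sc n : (n0 <= n)%N -> [/\ (n0 <= scale n0 M n)%N, (scale n0 M n <= n)%N,
    (n <= M * scale n0 M n)%N & (1 <= scale n0 M n)%N].
  by move=> /(scale_bounds n00 M1)[h1 h2 h3]; split => //; exact: leq_trans h1.
have small n : (n < n0)%N -> bernstein n (a n) = 0 /\ bernstein n (b n) = 0.
  move=> nn0; split; rewrite (@eq_bernstein _ _ _ (fun=> 0)) ?bernstein_const// => k _;
    by rewrite /a /b /lower_coef nn0.
(* The lower envelope lies below the Bernstein polynomial of A by at least
   K c Delta^alpha, which pays for its distance C Delta^alpha to f. *)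
have bnd n x : (n0 <= n)%N -> x \in `[0, 1] ->
    [/\ (bernstein n (a n)).[x] <= f x, (bernstein n (b n)).[x] <= 1 - f x &
      1 - (bernstein n (b n)).[x] - (bernstein n (a n)).[x] <=
        2 * (K + 1) * C2 * Delta (scale n0 M n) x `^ alpha].
  move=> n0n x01; have [h1 h2 h3 h4] := sc n n0n.
  rewrite a_rep// b_rep//; set s := scale n0 M n in h1 h2 h3 h4 *.
  have avL := averages_horner s x01.
  have := lower_poly_bounds A K (fun i => mE s i h1) avL.
  have := lower_poly_bounds A' K (fun i => mE s i h1) avL.
  rewrite (avg_1B _ avL) /= /horner_eval -/E => /andP[l1 u1] /andP[l2 u2].
  have := app s x (leq_trans n10 h1) x01; rewrite ler_norml => /andP[g1 g2].
  have := Hc s x (horner_eval x) h4 x01 avL.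
  have := HC2 s x (horner_eval x) h4 x01 avL.
  rewrite /= /horner_eval -/E => ub lb.
  set p := Delta s x `^ alpha in g1 g2 ub lb *.
  have p0 : 0 <= p by rewrite powR_ge0.
  have k1 : C * p <= K * (bernstein s (E s)).[x].
    apply: (@le_trans _ _ (K * (c * p))); first by rewrite mulrA ler_wpM2r.
    by rewrite ler_wpM2l.
  have k2 : (K + 1) * (bernstein s (E s)).[x] <= (K + 1) * (C2 * p).
    by rewrite ler_wpM2l// addr_ge0.
  split; [lra|lra|].
  have -> : 2 * (K + 1) * C2 * p = 2 * ((K + 1) * (C2 * p)) by ring.
  lra.
exists a, (fun n k => 1 - b n k); split.
- move=> n k n1 kn; have b0 := b_ge0 n k n1 kn; split; [exact: a_ge0| |lra].
  rewrite /a /b /lower_coef; case: ltnP => n0n; first by rewrite subr0.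
  have [h1 h2 h3 h4] := sc n n0n.
  have av := averages_bcoef R n1 kn h2; set s := scale n0 M n in h1 h2 h3 h4 av *.
  have := lower_poly_bounds A K (fun i => mE s i h1) av.
  have := lower_poly_bounds A' K (fun i => mE s i h1) av.
  rewrite (avg_1B _ av) -/E => /andP[_ u1] /andP[_ u2].
  have : 0 <= K * bcoef n k (bernstein s (E s)).
    rewrite mulr_ge0// -(avg_const 0 av); apply: (avg_le av) => i im.
    exact: E0.
  by move: u1 u2; rewrite /=; lra.
- move=> n k n1 kn; split; first exact: a_dy.
  by apply: dyadic1B; exact: b_dy.
- move=> n x n1 x01; rewrite bernstein_1B hornerD hornerN hornerC.
  have [nn0|n0n] := ltnP n n0.
    have [-> ->] := small n nn0; rewrite !horner0 subr0.
    by have /andP[/ltW -> /ltW ->] := hf x x01.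
  by have [h1 h2 _] := bnd n x n0n x01; rewrite h1/=; lra.
- move=> m n m1 mn; split; first exact: a_mono (ltnW mn).
  have [d [d0 Hd]] := b_mono m n m1 (ltnW mn); exists d; split => //.
  by rewrite !bernstein_1B -Hd; ring.
exists (Num.max (n0%:R `^ alpha) (2 * (K + 1) * C2 * M%:R `^ alpha)) => n x n1 x01.
rewrite bernstein_1B hornerD hornerN hornerC.
have d0 := Delta_gt0 x n1; have dp := powR_ge0 (Delta n x) alpha.
have [nn0|n0n] := ltnP n n0.
  have [-> ->] := small n nn0; rewrite !horner0 !subr0 normr1.
  apply: (@le_trans _ _ (n0%:R `^ alpha * Delta n x `^ alpha)).
    rewrite -powRM ?ler0n ?(ltW d0)//.
    have h : 1 <= n0%:R * Delta n x.
      have n0R : 0 < n0%:R :> R by rewrite ltr0n.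
      rewrite -ler_pdivrMl// mulr1 (le_trans _ (Delta_ge_inv n x))//.
      by rewrite lef_pV2 ?posrE ?ltr0n// ler_nat ltnW.
    rewrite -[leLHS](one_powR alpha).
    by apply: ge0_ler_powR; rewrite ?nnegrE ?(ltW a0)// (le_trans ler01).
  by rewrite ler_wpM2r// le_max lexx.
have [h1 h2 h3] := bnd n x n0n x01; have [k1 k2 k3 k4] := sc n n0n.
rewrite ger0_norm; last by lra.
apply: (le_trans h3).
apply: (@le_trans _ _ (2 * (K + 1) * C2 * M%:R `^ alpha * Delta n x `^ alpha)); last first.
  by rewrite ler_wpM2r// le_max lexx orbT.
rewrite -[leRHS]mulrA; apply: ler_wpM2l; first by rewrite !mulr_ge0 ?addr_ge0// ltW.
rewrite -powRM ?ler0n ?(ltW d0)//.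
apply: ge0_ler_powR; rewrite ?nnegrE ?(ltW a0) ?mulr_ge0 ?ler0n ?(ltW d0) ?(ltW (Delta_gt0 _ _))//.
by apply: Delta_le_mul => //; exact: ltnW.
Qed.

(** * Words of inputs and their probabilities *)

Definition heads (w : seq input) : nat := count (fun x => x.1) w.

(** Words grow at their end, as the initial segments of an input sequence do. *)
Fixpoint words (n : nat) : seq (seq (bool * bool)) :=
  if n is m.+1 then
    [seq rcons w x | w <- words m, x <- [:: (true, true); (true, false);
                                            (false, true); (false, false)]]
  else [:: [::]].

Lemma mem_words (n : nat) (w : seq (bool * bool)) : (w \in words n) = (size w == n).
Proof.
elim: n w => [|n IH] w; first by rewrite inE size_eq0.
apply/allpairsP/idP => [[[v x] /= [vn _ ->]]|].
  by rewrite size_rcons eqSS -IH.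
case/lastP: w => [//|v x]; rewrite size_rcons eqSS -IH => vn.
by exists (v, x); split => //; case: (x) => -[] [].
Qed.

Lemma uniq_words (n : nat) : uniq (words n).
Proof.
elim: n => // n IH; apply: allpairs_uniq => // -[v x] [u y] _ _ /= /rcons_inj.
by case=> -> ->.
Qed.

Definition word_poly (R : realType) (n : nat) (w : seq input) : {poly R} :=
  (2 ^- n) *: ('X^(heads w) * (1 - 'X) ^+ (n - heads w)).

Definition words_poly (R : realType) (n : nat) (Q : pred (seq input)) : {poly R} :=
  \sum_(w <- words n | Q w) word_poly R n w.

Lemma word_prob (R : realType) (p : R) (w : seq input) :
  \prod_(x <- w) (bernoulli_pmf p x.1 * bernoulli_pmf 2^-1 x.2) =
  (word_poly R (size w) w).[p].
Proof.
have hs v : (heads v <= size v)%N by apply: count_size.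
rewrite /word_poly hornerZ hornerM hornerXn horner_exp !hornerE.
elim: w => [|[b c] w IH]; first by rewrite big_nil /= !expr0 invr1 !mulr1.
rewrite big_cons IH /= /heads /= -/(heads w) exprS invfM.
have -> : bernoulli_pmf (2^-1 : R) c = 2^-1.
  by rewrite /bernoulli_pmf; case: c => //; lra.
rewrite /bernoulli_pmf; case: b => /=.
  by rewrite add1n exprS subSS; ring.
by rewrite add0n subSn// exprS; ring.
Qed.

Lemma law_words (R : realType) (p : R) (n : nat) (ws : seq (seq (bool * bool))) :
    p \in `[0, 1] -> uniq ws -> all (fun w => size w == n) ws ->
  measurable ([set s | mkseq s n \in ws] : set inputs) /\
  input_law p ([set s | mkseq s n \in ws] : set inputs) =
    (\sum_(w <- ws) (word_poly R n w).[p])%:E.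
Proof.
move=> p01; elim: ws => [_ _|w ws IH /= /andP[wws uws] /andP[/eqP wn an]].
  rewrite [X in measurable X](_ : _ = set0); last by apply/seteqP; split.
  split; first exact: measurable0.
  rewrite [X in input_law p X](_ : _ = set0); last by apply/seteqP; split.
  by rewrite measure0 big_nil.
have [mE PE] := IH uws an.
have -> : [set s : inputs | mkseq s n \in w :: ws] =
    cylinder w `|` [set s | mkseq s n \in ws].
  apply/seteqP; split => s /=; rewrite in_cons /cylinder /= wn.
    by move=> /orP[/eqP|]; [left|right].
  by move=> [->|->]; rewrite ?eqxx ?orbT.
have mw : measurable (cylinder w : set inputs) by exact: measurable_cylinder.
split; first exact: measurableU.
have disj : (cylinder w : set inputs) `&` [set s | mkseq s n \in ws] = set0.
  apply/seteqP; split => s //=; rewrite /cylinder/= wn => -[-> h].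
  by rewrite h in wws.
rewrite -[LHS]/(input_law p _) (measureU (input_law p) mw mE disj) big_cons EFinD -PE; congr (_ + _)%E.
have p01' : 0 <= p <= 1 by move: p01; rewrite in_itv.
by apply: (etrans (input_law_cylinder w p01')); rewrite word_prob wn.
Qed.

Lemma law_words_poly (R : realType) (p : R) (n : nat) (Q : pred (seq input)) :
    p \in `[0, 1] ->
  measurable ([set s | Q (mkseq s n)] : set inputs) /\
  input_law p ([set s | Q (mkseq s n)] : set inputs) = ((words_poly R n Q).[p])%:E.
Proof.
move=> p01; have := @law_words R p n [seq w <- words n | Q w] p01.
have -> : [set s : inputs | mkseq s n \in [seq w <- words n | Q w]] =
    [set s | Q (mkseq s n)].
  by apply/seteqP; split => s /=; rewrite mem_filter mem_words size_mkseq eqxx andbT.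
move=> /(_ (filter_uniq _ (uniq_words n)))[]; last first.
  by move=> mE ->; rewrite big_filter /words_poly horner_sum.
by apply/allP => w; rewrite mem_filter mem_words => /andP[].
Qed.

Definition word_class (n h : nat) : seq (seq (bool * bool)) :=
  [seq w <- words n | heads w == h].

Lemma heads_le (n : nat) (w : seq input) : w \in words n -> (heads w <= n)%N.
Proof. by rewrite mem_words => /eqP <-; exact: count_size. Qed.

(** Words with the same number of heads have the same probability. *)
Lemma words_polyE (R : realType) (n : nat) (Q : pred (seq input)) :
  words_poly R n Q =
    bernstein n (fun h => (count Q (word_class n h))%:R / (2 ^+ n * 'C(n, h)%:R)).
Proof.
rewrite /bernstein /words_poly.
transitivity (\sum_(w <- words n | Q w) \sum_(h < n.+1 | heads w == h) word_poly R n w).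
  rewrite big_seq_cond [RHS]big_seq_cond; apply: eq_bigr => w /andP[/heads_le wn _].
  rewrite (bigD1 (Ordinal (wn : (heads w < n.+1)%N)))//= big1 ?addr0// => i /andP[/eqP h].
  by move/eqP; case; apply/val_inj.
rewrite (exchange_big_dep xpredT)//=; apply: eq_bigr => h _.
have C0 : 'C(n, h)%:R != 0 :> R.
  by rewrite pnatr_eq0 -lt0n bin_gt0 -ltnS.
have e0 : 2 ^+ n != 0 :> R by rewrite expf_neq0.
have -> : 'C(n, h)%:R * ((count Q (word_class n h))%:R / (2 ^+ n * 'C(n, h)%:R)) =
    (count Q (word_class n h))%:R * 2 ^- n :> R by field; rewrite C0 e0.
rewrite -scalerA scaler_nat /word_class count_filter.
rewrite (eq_bigr (fun=> (2 ^- n) *: ('X^h * (1 - 'X) ^+ (n - h)) : {poly R})).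
  by rewrite big_const_seq iter_addr_0.
by move=> w /andP[_ /eqP wh]; rewrite /word_poly wh.
Qed.

Lemma count_word_class (R : realType) (n h : nat) (Q : pred (seq input)) : (h <= n)%N ->
  (count Q (word_class n h))%:R = 2 ^+ n * 'C(n, h)%:R * bcoef n h (words_poly R n Q).
Proof.
move=> hn; rewrite words_polyE bcoef_bernstein// mulrC divfK//.
by rewrite mulf_neq0 ?expf_neq0// pnatr_eq0 -lt0n bin_gt0.
Qed.

(** The probabilities of the four extensions of a word add up to that of the word. *)
Lemma words_poly_ext (R : realType) (n : nat) (Q : pred (seq input)) :
  words_poly R n.+1 (fun w => Q (take n w)) = words_poly R n Q.
Proof.
rewrite /words_poly [words n.+1]/(allpairs_dep _ _ _) big_mkcond [RHS]big_mkcond.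
rewrite big_allpairs_dep/= big_seq [RHS]big_seq.
apply: eq_bigr => w; rewrite mem_words => /eqP wn.
rewrite !big_cons big_nil -!cats1 !take_size_cat//; case: (Q w); last by rewrite !addr0.
have hw : (heads w <= n)%N by rewrite -wn; exact: count_size.
rewrite /word_poly /heads !count_cat/= !addn0 !addn1 -/(heads w) subSS subSn//.
rewrite -!mul_polyC !exprS invfM polyCM.
have h2 : (2^-1 : R)%:P + (2^-1)%:P = 1.
  by rewrite -polyCD -polyC1; congr (_%:P); lra.
rewrite -[RHS]mul1r; apply: etrans (congr1 (fun z => z * _) h2); ring.
Qed.

Lemma words_polyT (R : realType) (n : nat) : words_poly R n predT = 1.
Proof.
elim: n => [|n <-]; last exact: (words_poly_ext R n predT).
by rewrite /words_poly big_cons big_nil /word_poly /= !expr0 invr1 scale1r mulr1 addr0.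
Qed.

(** * Stopping times *)

Lemma take_mkseq (T : Type) (s : nat -> T) (k n : nat) : (k <= n)%N ->
  take k (mkseq s n) = mkseq s k.
Proof. by move=> kn; rewrite /mkseq -map_take take_iota (minn_idPl kn). Qed.

(** Whether a stopping time is at most the length of w, and its value then, can be
read off from any extension of w; this is one. *)
Definition pad (w : seq input) : inputs := nth (false, false) w.

Lemma mkseq_pad (w : seq input) (k : nat) : (k <= size w)%N ->
  mkseq (pad w) k = take k w.
Proof.
move=> kw; have e : mkseq (pad w) (size w) = w.
  apply: (@eq_from_nth _ (false, false)); first by rewrite size_mkseq.
  by move=> i; rewrite size_mkseq => iw; rewrite nth_mkseq.
by rewrite -[in RHS]e take_mkseq.
Qed.

Definition stopped (N : inputs -> option nat) (out : seq input -> bool)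
    (w : seq input) : bool :=
  if N (pad w) is Some k then (k <= size w)%N && out (take k w) else false.

Lemma stoppedP (N : inputs -> option nat) (out : seq input -> bool)
    (n : nat) (s : inputs) : stopping_time N ->
  stopped N out (mkseq s n) <->
    exists2 k, (k <= n)%N & N s = Some k /\ out (mkseq s k).
Proof.
move=> stN; rewrite /stopped.
have e k : (k <= n)%N -> mkseq (pad (mkseq s n)) k = mkseq s k.
  by move=> kn; rewrite mkseq_pad ?size_mkseq// take_mkseq.
split.
  case E : (N _) => [k|//]; rewrite size_mkseq => /andP[kn].
  rewrite take_mkseq// => ok; exists k => //; split => //.
  exact: stN (e k kn) E.
move=> [k kn [Nk ok]]; rewrite (stN k s _ _ Nk); last by rewrite e.
by rewrite size_mkseq kn take_mkseq.
Qed.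

Lemma runs_pastE (N : inputs -> option nat) (n : nat) : stopping_time N ->
  runs_past N n = [set s | predC (stopped N (fun=> true)) (mkseq s n)].
Proof.
move=> stN; apply/seteqP; split => s /=; rewrite /runs_past/=.
  move=> h; apply/negP => /(stoppedP _ _ _ stN)[k kn [Nk _]].
  by move: h; rewrite Nk ltnNge kn.
move=> /negP h; case E : (N s) => [k|//]; rewrite ltnNge; apply/negP => kn.
by apply: h; apply/(stoppedP _ _ _ stN); exists k.
Qed.

Lemma outputs_headsE (N : inputs -> option nat) (out : seq input -> bool) :
  stopping_time N ->
  outputs_heads N out = \bigcup_n [set s | stopped N out (mkseq s n)].
Proof.
move=> stN; apply/seteqP; split => s /=; rewrite /outputs_heads/=.
  by move=> [k Nk ok]; exists k => //=; apply/(stoppedP _ _ _ stN); exists k.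
by move=> [n _ /= /(stoppedP _ _ _ stN)[k kn [Nk ok]]]; exists k.
Qed.

Lemma stopsE (N : inputs -> option nat) : stops N = outputs_heads N (fun=> true).
Proof.
by apply/seteqP; split => s /=; [move=> [k Nk]; exists k | move=> [k Nk _]; exists k].
Qed.

Lemma measurable_words (R : realType) (n : nat) (Q : pred (seq input)) :
  measurable ([set s | Q (mkseq s n)] : set inputs).
Proof. by have [|] := @law_words_poly R 0 n Q; rewrite ?in_itv/= ?lexx ?ler01. Qed.

Lemma measurable_outputs_heads (R : realType) (N : inputs -> option nat)
    (out : seq input -> bool) : stopping_time N ->
  measurable (outputs_heads N out : set inputs).
Proof.
move=> stN; rewrite outputs_headsE//; apply: bigcupT_measurable => n.
exact: (measurable_words R).
Qed.

Lemma law_runs_past (R : realType) (N : inputs -> option nat) (n : nat) (p : R) :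
    stopping_time N -> p \in `[0, 1] ->
  input_law p (runs_past N n) =
    ((words_poly R n (predC (stopped N (fun=> true)))).[p])%:E.
Proof.
move=> stN p01; rewrite runs_pastE//.
by have [] := law_words_poly n (predC (stopped N (fun=> true))) p01.
Qed.

Lemma words_poly_predC (R : realType) (n : nat) (Q : pred (seq input)) :
  words_poly R n (predC Q) = 1 - words_poly R n Q.
Proof.
apply/eqP; rewrite eq_sym subr_eq addrC -(words_polyT R n).
by rewrite /words_poly (bigID Q)/=.
Qed.

(** The output is known by time n unless the algorithm is still running. *)
Lemma outputs_heads_bracket (R : realType) (N : inputs -> option nat)
    (out : seq input -> bool) (n : nat) (p : R) :
    stopping_time N -> p \in `[0, 1] ->
  ((((words_poly R n (stopped N out)).[p])%:E <= input_law p (outputs_heads N out)) /\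
  (input_law p (outputs_heads N out) <= ((words_poly R n (stopped N out)).[p])%:E +
    input_law p (runs_past N n)))%E.
Proof.
move=> stN p01; have [mQ PQ] := law_words_poly n (stopped N out) p01.
have mO := measurable_outputs_heads R out stN.
have mR : measurable (runs_past N n : set inputs).
  by rewrite runs_pastE//; exact: (measurable_words R).
rewrite -PQ; split.
  apply: le_measure; rewrite ?inE// => s /= /(stoppedP _ _ _ stN)[k kn [Nk ok]].
  by exists k.
apply: (@le_trans _ _ (input_law p ([set s | stopped N out (mkseq s n)] `|` runs_past N n))).
  apply: le_measure; rewrite ?inE//; first exact: measurableU.
  move=> s [k Nk ok]; have [kn|nk] := leqP k n.
    by left; apply/(stoppedP _ _ _ stN); exists k.
  by right; rewrite /runs_past/= Nk.
exact: measureU2.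
Qed.

(** * Accepted and rejected words *)

(** A set between X and Y that has m h words with h heads, whenever these numbers
allow it; see [count_fill]. *)
Definition fill (n : nat) (X Y : pred (seq input)) (m : nat -> nat) : pred (seq input) :=
  fun w => X w || (w \in take (m (heads w) - count X (word_class n (heads w)))
    [seq v <- word_class n (heads w) | Y v && ~~ X v]).

Lemma sub_fill (n : nat) (X Y : pred (seq input)) (m : nat -> nat) (w : seq input) :
  X w -> fill n X Y m w.
Proof. by rewrite /fill => ->. Qed.

Lemma fill_sub (n : nat) (X Y : pred (seq input)) (m : nat -> nat) (w : seq input) :
  (forall w, X w -> Y w) -> fill n X Y m w -> Y w.
Proof.
move=> XY /orP[/XY//|/mem_take]; rewrite mem_filter => /andP[/andP[]].
by [].
Qed.

Lemma count_fill (n h : nat) (X Y : pred (seq input)) (m : nat -> nat) :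
    (forall w, X w -> Y w) ->
    (count X (word_class n h) <= m h)%N -> (m h <= count Y (word_class n h))%N ->
  count (fill n X Y m) (word_class n h) = m h.
Proof.
move=> XY Xm mY; set c := word_class n h in Xm mY *.
have uc : uniq c by rewrite filter_uniq// uniq_words.
set t := take (m h - count X c) [seq v <- c | Y v && ~~ X v].
have ut : uniq t by rewrite take_uniq// filter_uniq.
have -> : count (fill n X Y m) c = count (predU X (mem t)) c.
  apply: eq_in_count => w; rewrite mem_filter => /andP[/eqP wh _].
  by rewrite /fill wh.
have e := count_predUI X (mem t) c.
have : count (predI X (mem t)) c = 0%N.
  apply/eqP; rewrite -leqn0 leqNgt -has_count; apply/hasPn => w _ /=.
  apply/negP => /andP[Xw /mem_take]; rewrite mem_filter Xw andbF.
  by [].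
move=> e0; rewrite e0 addn0 in e; rewrite e.
have -> : count (mem t) c = size t.
  rewrite -size_filter; apply: perm_size; apply: uniq_perm => //.
    by rewrite filter_uniq.
  move=> w; rewrite mem_filter andb_idr// => /mem_take.
  by rewrite mem_filter => /andP[].
rewrite size_take size_filter.
have : (count Y c = count X c + count (fun v => Y v && ~~ X v) c)%N.
  rewrite -(count_predUI X); rewrite -[LHS]addn0; congr (_ + _)%N.
    by apply: eq_count => v /=; have := XY v; case: (X v); case: (Y v) => // /(_ isT).
  by rewrite (@eq_count _ _ pred0) ?count_pred0// => v /=; case: (X v); rewrite ?andbF.
move=> eY; case: ltnP; lia.
Qed.

(** The accepted and the rejected words of length n: the extensions of those of length
n - 1, completed to al n h and be n h words with h heads. Acceptance chooses
first. *)
Fixpoint decided (al be : nat -> nat -> nat) (n : nat) :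
    pred (seq input) * pred (seq input) :=
  if n is m.+1 then
    let: (A, B) := decided al be m in
    let A' := fill n (fun w => A (take m w)) (fun w => ~~ B (take m w)) (al n) in
    (A', fill n (fun w => B (take m w)) (fun w => ~~ A' w) (be n))
  else (fun=> false, fun=> false).

Lemma decided_disjoint (al be : nat -> nat -> nat) (n : nat) (w : seq input) :
  (decided al be n).1 w -> (decided al be n).2 w = false.
Proof.
elim: n w => [//|n IH] w; rewrite /=.
case: (decided al be n) IH => A B /= IH Aw; apply/negP => Bw.
have : ~~ fill n.+1 (fun w => A (take n w)) (fun w => ~~ B (take n w)) (al n.+1) w.
  apply: (fill_sub _ Bw) => v Bv; apply/negP => Av.
  have : ~~ B (take n v) by apply: (fill_sub _ Av) => u /IH ->.
  by rewrite Bv.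
by rewrite Aw.
Qed.

Lemma decided_mono (al be : nat -> nat -> nat) (n : nat) (w : seq input) :
  ((decided al be n).1 (take n w) -> (decided al be n.+1).1 w) /\
  ((decided al be n).2 (take n w) -> (decided al be n.+1).2 w).
Proof. by rewrite /=; case: (decided al be n) => A B /=; split; exact: sub_fill. Qed.

(** The order on polynomials says precisely that the extensions of the words chosen at
time n are at most as many as the words prescribed at time n + 1. *)
Lemma count_ext_le (R : realType) (n h : nat) (Q : pred (seq input)) (c : nat -> R)
    (m : nat) : (h <= n.+1)%N ->
    bernstein_le n.+1 (words_poly R n Q) (bernstein n.+1 c) ->
    m%:R = 2 ^+ n.+1 * 'C(n.+1, h)%:R * c h ->
  (count (fun w => Q (take n w)) (word_class n.+1 h) <= m)%N.
Proof.
move=> hn le mE; rewrite -(ler_nat R) (count_word_class R)// words_poly_ext mE.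
have := bernstein_le_bcoef hn le; rewrite bcoef_bernstein// => h1.
by rewrite ler_wpM2l// mulr_ge0// exprn_ge0.
Qed.

Lemma card_word_class (R : realType) (n h : nat) : (h <= n)%N ->
  (size (word_class n h))%:R = 2 ^+ n * 'C(n, h)%:R :> R.
Proof.
move=> hn; rewrite -count_predT (count_word_class R _ hn) words_polyT.
by rewrite bcoef1 mulr1.
Qed.

Lemma words_poly_count (R : realType) (n : nat) (Q : pred (seq input)) (c : nat -> R) :
    (forall h, (h <= n)%N ->
       (count Q (word_class n h))%:R = 2 ^+ n * 'C(n, h)%:R * c h) ->
  words_poly R n Q = bernstein n c.
Proof.
move=> H; rewrite words_polyE; apply: eq_bernstein => h hn; rewrite H// mulrC mulKf//.
by rewrite mulf_neq0 ?expf_neq0// pnatr_eq0 -lt0n bin_gt0.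
Qed.

(** The condition a + b <= 1 leaves enough words for the rejections after the
acceptances are chosen. *)
Lemma decided_count (R : realType) (a b : nat -> nat -> R) (al be : nat -> nat -> nat) :
    (forall n h, (1 <= n)%N -> (h <= n)%N -> a n h + b n h <= 1) ->
    (forall n h, (1 <= n)%N -> (h <= n)%N ->
       (al n h)%:R = 2 ^+ n * 'C(n, h)%:R * a n h) ->
    (forall n h, (1 <= n)%N -> (h <= n)%N ->
       (be n h)%:R = 2 ^+ n * 'C(n, h)%:R * b n h) ->
    (forall n, (1 <= n)%N ->
       bernstein_le n.+1 (bernstein n (a n)) (bernstein n.+1 (a n.+1))) ->
    (forall n, (1 <= n)%N ->
       bernstein_le n.+1 (bernstein n (b n)) (bernstein n.+1 (b n.+1))) ->
  forall n, (1 <= n)%N ->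
    words_poly R n (decided al be n).1 = bernstein n (a n) /\
    words_poly R n (decided al be n).2 = bernstein n (b n).
Proof.
move=> ab alE beE aM bM; elim=> [//|n IH] _.
have cnt (c : nat -> nat -> R) (ga : nat -> nat -> nat) (Q : pred (seq input)) h :
    (h <= n.+1)%N ->
    (forall n h, (1 <= n)%N -> (h <= n)%N ->
       (ga n h)%:R = 2 ^+ n * 'C(n, h)%:R * c n h) ->
    (forall n, (1 <= n)%N ->
       bernstein_le n.+1 (bernstein n (c n)) (bernstein n.+1 (c n.+1))) ->
    ((n == 0)%N -> Q =1 pred0) ->
    ((1 <= n)%N -> words_poly R n Q = bernstein n (c n)) ->
    (count (fun w => Q (take n w)) (word_class n.+1 h) <= ga n.+1 h)%N.
  move=> hn gaE cM Q0 Qn; case: (posnP n) => n0.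
    rewrite (@eq_count _ _ pred0) ?count_pred0// => w.
    by rewrite Q0// n0.
  apply: (count_ext_le hn _ (gaE n.+1 h isT hn)).
  by rewrite Qn//; apply: cM.
have disj := @decided_disjoint al be n.
have h0 : (n == 0)%N -> (decided al be n).1 =1 pred0 /\ (decided al be n).2 =1 pred0.
  by move=> /eqP ->.
move: IH disj h0 => /=; case: (decided al be n) => A B /= IH disj h0.
set A' := fill _ _ _ _.
have tot h : (h <= n.+1)%N -> (al n.+1 h + be n.+1 h <= size (word_class n.+1 h))%N.
  move=> hn; rewrite -(ler_nat R) natrD (card_word_class R hn) alE// beE// -mulrDr.
  by rewrite -[leRHS]mulr1 ler_wpM2l ?ab// mulr_ge0// exprn_ge0.
have compl (Q : pred (seq input)) h :
    (count Q (word_class n.+1 h) + count (fun w => ~~ Q w) (word_class n.+1 h) =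
     size (word_class n.+1 h))%N by exact: count_predC.
have cA h : (h <= n.+1)%N ->
    (count (fun w => A (take n w)) (word_class n.+1 h) <= al n.+1 h)%N.
  move=> hn; apply: (cnt a) => //; first by move=> /h0[].
  by move=> /IH[].
have cB h : (h <= n.+1)%N ->
    (count (fun w => B (take n w)) (word_class n.+1 h) <= be n.+1 h)%N.
  move=> hn; apply: (cnt b) => //; first by move=> /h0[].
  by move=> /IH[].
have cA' h : (h <= n.+1)%N -> count A' (word_class n.+1 h) = al n.+1 h.
  move=> hn; apply: count_fill; [by move=> w /disj ->|exact: cA|].
  have := tot h hn; have := cB h hn; have := compl (fun w => B (take n w)) h.
  by lia.
have cB' h : (h <= n.+1)%N ->
    count (fill n.+1 (fun w => B (take n w)) (fun w => ~~ A' w) (be n.+1)) (word_class n.+1 h)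
      = be n.+1 h.
  move=> hn; apply: count_fill; [|exact: cB|].
    move=> w Bw; apply/negP => A'w.
    have : ~~ B (take n w) by apply: (fill_sub _ A'w) => v /disj ->.
    by rewrite Bw.
  have := tot h hn; have := cA' h hn; have := compl A' h; lia.
split; apply: words_poly_count => h hn; first by rewrite cA'// alE.
by rewrite cB'// beE.
Qed.

(** * Simulation from envelopes *)

Lemma words_poly_stopped (R : realType) (N : inputs -> option nat)
    (out : seq input -> bool) (n : nat) (Q : pred (seq input)) :
    (forall s : inputs, stopped N out (mkseq s n) = Q (mkseq s n)) ->
  words_poly R n (stopped N out) = words_poly R n Q.
Proof.
move=> H; rewrite /words_poly big_mkcond [RHS]big_mkcond big_seq [RHS]big_seq.
apply: eq_bigr => w; rewrite mem_words => /eqP wn.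
have <- : mkseq (pad w) n = w by rewrite mkseq_pad ?wn// -wn take_size.
by rewrite H.
Qed.

Lemma words_poly_disjoint (R : realType) (n : nat) (Q S : pred (seq input)) :
    (forall w, Q w -> S w = false) ->
  words_poly R n (fun w => Q w || S w) = words_poly R n Q + words_poly R n S.
Proof.
move=> QS; rewrite /words_poly big_mkcond [X in _ = X + _]big_mkcond.
rewrite [X in _ = _ + X]big_mkcond -big_split/=; apply: eq_bigr => w _.
by have := QS w; case: (Q w) => /= [/(_ isT) ->|_]; rewrite ?addr0 ?add0r.
Qed.

Definition first_time (P : nat -> pred (seq input)) (s : inputs) : option nat :=
  match pselect (exists n, P n (mkseq s n)) with
  | left ex => Some (ex_minn ex)
  | right _ => None
  end.

Lemma first_timeP (P : nat -> pred (seq input)) (s : inputs) (k : nat) :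
  first_time P s = Some k <->
    P k (mkseq s k) /\ forall j, (j < k)%N -> ~~ P j (mkseq s j).
Proof.
rewrite /first_time; case: pselect => [ex|nex]; last first.
  by split => // -[Pk _]; case: nex; exists k.
case: ex_minnP => m Pm mmin; split => [[<-]|[Pk kmin]].
  by split => // j jm; apply/negP => /mmin; rewrite leqNgt jm.
congr Some; apply/eqP; rewrite eqn_leq mmin// leqNgt; apply/negP => /kmin.
by rewrite Pm.
Qed.

Lemma first_time_stopping (P : nat -> pred (seq input)) : stopping_time (first_time P).
Proof.
move=> k s t st /first_timeP[Pk kmin].
have e j : (j <= k)%N -> mkseq t j = mkseq s j.
  by move=> jk; rewrite -(take_mkseq t jk) -st take_mkseq.
by apply/first_timeP; split => [|j jk]; rewrite e//; [exact: kmin | exact: ltnW].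
Qed.

Lemma first_time_before (P : nat -> pred (seq input)) (n : nat) (s : inputs) :
  P n (mkseq s n) -> exists2 k, (k <= n)%N & first_time P s = Some k.
Proof.
move=> Pn; have ex : exists n, P n (mkseq s n) by exists n.
have [m Pm mmin] := ex_minnP ex; exists m; first exact: mmin.
apply/first_timeP; split => // j jm; apply/negP => /mmin.
by rewrite leqNgt jm.
Qed.

Lemma eq_of_close (R : realType) (x y : R) :
  (forall e, 0 < e -> `|x - y| <= e) -> x = y.
Proof.
move=> H; apply/eqP; rewrite -subr_eq0 -normr_le0; apply/ler_addgt0Pr => e e0.
by rewrite add0r H.
Qed.

Lemma dyadic_nat (R : realType) (n k : nat) (v : R) : 0 <= v -> dyadic n k v ->
  exists m : nat, m%:R = 2 ^+ n * 'C(n, k)%:R * v.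
Proof.
move=> v0 [z Hz]; have e : 2 ^+ n * 'C(n, k)%:R * v = z%:~R.
  by rewrite -mulrA Hz mulrCA divff ?mulr1// expf_neq0.
have : 0 <= z%:~R :> R by rewrite -e !mulr_ge0// exprn_ge0.
rewrite ler0z e; case: z {e Hz} => // m _; exists m.
by [].
Qed.

(** The algorithm stops when its word is accepted or rejected. It runs past n with
probability equal to the gap between the envelopes at n, and both f p and the
probability of the output heads lie in this gap. *)
Lemma simulate_envelopes (R : realType) (f : R -> R) (alpha : R) (a b : nat -> nat -> R) :
    0 < alpha -> envelopes f alpha a b ->
  can_simulate f (fun n x => Delta n x `^ alpha).
Proof.
move=> a0 [rng dy bnd mono [C HC]]; pose b' n k := 1 - b n k.
have counts (c : nat -> nat -> R) : (forall n k, (1 <= n)%N -> (k <= n)%N -> 0 <= c n k) ->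
    (forall n k, (1 <= n)%N -> (k <= n)%N -> dyadic n k (c n k)) ->
    exists ga : nat -> nat -> nat, forall n h, (1 <= n)%N -> (h <= n)%N ->
       (ga n h)%:R = 2 ^+ n * 'C(n, h)%:R * c n h.
  move=> c0 cd.
  have : forall nh : nat * nat, exists m : nat, (1 <= nh.1)%N -> (nh.2 <= nh.1)%N ->
      m%:R = 2 ^+ nh.1 * 'C(nh.1, nh.2)%:R * c nh.1 nh.2.
    move=> [n h] /=; have [n1|] := boolP (1 <= n)%N; last by exists 0%N.
    have [hn|] := boolP (h <= n)%N; last by exists 0%N.
    by have [m Hm] := dyadic_nat (c0 n h n1 hn) (cd n h n1 hn); exists m.
  by move=> /choice[g Hg]; exists (fun n h => g (n, h)) => n h; exact: (Hg (n, h)).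
have [al alE] : exists ga : nat -> nat -> nat, forall n h, (1 <= n)%N -> (h <= n)%N ->
       (ga n h)%:R = 2 ^+ n * 'C(n, h)%:R * a n h.
  apply: counts => n k n1 kn; first by have [] := rng n k n1 kn.
  by have [] := dy n k n1 kn.
have [be beE] : exists ga : nat -> nat -> nat, forall n h, (1 <= n)%N -> (h <= n)%N ->
       (ga n h)%:R = 2 ^+ n * 'C(n, h)%:R * b' n h.
  apply: counts => n k n1 kn; first by have [_ _] := rng n k n1 kn; rewrite subr_ge0.
  by apply: dyadic1B; have [] := dy n k n1 kn.
have cnt : forall n, (1 <= n)%N ->
    words_poly R n (decided al be n).1 = bernstein n (a n) /\
    words_poly R n (decided al be n).2 = bernstein n (b' n).
  apply: decided_count => // [n h n1 hn|n n1|n n1].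
  - by have [_ h1 _] := rng n h n1 hn; rewrite /b'; lra.
  - by have [] := mono n n.+1 n1 (ltnSn n).
  - have [_ [d [d0 Hd]]] := mono n n.+1 n1 (ltnSn n); exists d; split => //.
    by rewrite !bernstein_1B -Hd; ring.
pose A n := (decided al be n).1; pose B n := (decided al be n).2.
pose P n w := A n w || B n w.
pose N := first_time P; pose out w := A (size w) w.
have stN : stopping_time N by exact: first_time_stopping.
have Amono m n (s : inputs) : (m <= n)%N ->
    (A m (mkseq s m) -> A n (mkseq s n)) /\ (B m (mkseq s m) -> B n (mkseq s n)).
  move=> mn; rewrite -(subnK mn); elim: (n - m)%N => [//|i [IHA IHB]].
  have [hA hB] := decided_mono al be (i + m) (mkseq s (i + m).+1).
  rewrite take_mkseq// in hA hB; rewrite addSn.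
  by split => [/IHA|/IHB]; [exact: hA | exact: hB].
have AB n w : A n w -> B n w = false by exact: decided_disjoint.
have outE n (s : inputs) : stopped N out (mkseq s n) = A n (mkseq s n).
  apply/idP/idP => [/(stoppedP _ _ _ stN)[k kn [_]]|An].
    by rewrite /out size_mkseq; have [hA _] := Amono k n s kn; exact: hA.
  apply/(stoppedP _ _ _ stN); have [|k kn Nk] := @first_time_before P n s.
    by rewrite /P An.
  exists k => //; split => //; rewrite /out size_mkseq.
  have /first_timeP[/orP[//|Bk] _] := Nk.
  have [_ hB] := Amono k n s kn.
  by have := AB n _ An; rewrite hB.
have stopE n (s : inputs) : stopped N (fun=> true) (mkseq s n) = P n (mkseq s n).
  apply/idP/idP => [/(stoppedP _ _ _ stN)[k kn [/first_timeP[Pk _] _]]|Pn].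
    have [hA hB] := Amono k n s kn.
    by case/orP: Pk => [/hA An|/hB Bn]; rewrite /P ?An ?Bn ?orbT.
  apply/(stoppedP _ _ _ stN).
  by have [k kn Nk] := first_time_before Pn; exists k.
have polyA n : (1 <= n)%N -> words_poly R n (stopped N out) = bernstein n (a n).
  by move=> n1; rewrite (words_poly_stopped R (outE n)); have [] := cnt n n1.
have polyP n : (1 <= n)%N -> words_poly R n (predC (stopped N (fun=> true))) =
    bernstein n (b n) - bernstein n (a n).
  move=> n1; rewrite words_poly_predC (words_poly_stopped R (stopE n)).
  rewrite words_poly_disjoint; last exact: AB.
  have [-> ->] := cnt n n1; rewrite bernstein_1B; ring.
have past n p : (1 <= n)%N -> p \in `[0, 1] -> input_law p (runs_past N n) =
    ((bernstein n (b n)).[p] - (bernstein n (a n)).[p])%:E.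
  by move=> n1 p01; rewrite law_runs_past// polyP// hornerD hornerN.
have gap n p : (1 <= n)%N -> p \in `[0, 1] ->
    (bernstein n (b n)).[p] - (bernstein n (a n)).[p] <= C * Delta n p `^ alpha.
  by move=> n1 p01; apply: (le_trans (ler_norm _)); exact: HC.
exists N, out; split; last first.
  by exists C => n p n1 p01; rewrite past// lee_fin; exact: gap.
split => // p p01.
have fin o : input_law p (outputs_heads N o) = (fine (input_law p (outputs_heads N o)))%:E.
  rewrite fineK//; apply: fin_num_measure; exact: (measurable_outputs_heads R).
split.
  rewrite stopsE fin; congr (_%:E); apply: eq_of_close => e e0.
  have [n n1 Hn] := Delta_powR_small C a0 e0.
  have [lo _] := outputs_heads_bracket (fun=> true) n stN p01.
  rewrite fin lee_fin in lo.
  have hi : (input_law p (outputs_heads N (fun=> true)) <= 1)%E.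
    by apply: probability_le1; exact: (measurable_outputs_heads R).
  rewrite fin lee_fin in hi.
  have := polyP n n1; rewrite words_poly_predC => /(congr1 (fun q => q.[p])).
  rewrite !hornerD !hornerN hornerC => e1.
  have := gap n p n1 p01; have := Hn n p (leqnn n) p01; rewrite ler_norml; lra.
rewrite fin; congr (_%:E); apply: eq_of_close => e e0.
have [n n1 Hn] := Delta_powR_small C a0 e0.
have [] := outputs_heads_bracket out n stN p01.
rewrite fin past// polyA// -EFinD !lee_fin => lo hi.
have /andP[f1 f2] := bnd n p n1 p01.
have := gap n p n1 p01; have := Hn n p (leqnn n) p01; rewrite ler_norml; lra.
Qed.

(** * Derivatives of polynomials with nonnegative Bernstein coefficients *)

Local Open Scope complex_scope.

Lemma normc_add_le (R : realType) (x y : R[i]) :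
  Normc.normc (x + y) <= Normc.normc x + Normc.normc y.
Proof. exact: le_normcD. Qed.

Lemma normc_sum_le (R : realType) (I : Type) (r : seq I) (F : I -> R[i]) :
  Normc.normc (\sum_(i <- r) F i) <= \sum_(i <- r) Normc.normc (F i).
Proof.
elim: r => [|i r IH]; first by rewrite !big_nil Normc.normc0.
by rewrite !big_cons (le_trans (normc_add_le _ _))// lerD2l.
Qed.

Lemma normcX (R : realType) (x : R[i]) (n : nat) :
  Normc.normc (x ^+ n) = Normc.normc x ^+ n.
Proof.
elim: n => [|n IH]; first by rewrite !expr0 Normc.normc1.
by rewrite !exprS Normc.normcM IH.
Qed.

Lemma normc_real (R : realType) (x : R) : Normc.normc x%:C = `|x|.
Proof. by rewrite /= expr0n/= addr0 sqrtr_sqr. Qed.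

Lemma normc_ge0 (R : realType) (x : R[i]) : 0 <= Normc.normc x.
Proof. by case: x => a b /=; exact: sqrtr_ge0. Qed.

Lemma normc_opp (R : realType) (x : R[i]) : Normc.normc (- x) = Normc.normc x.
Proof. by case: x => a b /=; rewrite !sqrrN. Qed.

(** Cauchy's estimate. With u = w^2, the even and odd parts of P take at u the values
(P w + P (- w)) / 2 and (P w - P (- w)) / (2 w), so they satisfy the same bound
on the circle and have smaller size. *)
Lemma coef_le_circle (R : realType) (B : R) (P : {poly R[i]}) :
    (forall w, Normc.normc w = 1 -> Normc.normc P.[w] <= B) ->
  forall k, Normc.normc P`_k <= B.
Proof.
have [n] := ubnP (size P); elim: n P => // n IH P Pn PB k.
have B0 : 0 <= B by apply: le_trans (PB 1 (Normc.normc1 R)); exact: normc_ge0.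
have [s1|s1] := leqP (size P) 1.
  have [-> | k0] := posnP k.
    by have := PB 1 (Normc.normc1 R); rewrite (size1_polyC s1) hornerC coefC.
  by rewrite (size1_polyC s1) coefC (gtn_eqF k0) Normc.normc0.
(* Both parts are values at u = w^2 of polynomials, for a square root w of u. *)
have half (u : R[i]) : Normc.normc u = 1 ->
    Normc.normc (even_poly P).[u] <= B /\ Normc.normc (odd_poly P).[u] <= B.
  move=> u1; pose w := sqrtc u; have w2 : w ^+ 2 = u by exact: sqr_sqrtc.
  have w1 : Normc.normc w = 1.
    have : Normc.normc w ^+ 2 = 1 by rewrite -normcX w2.
    move/eqP; rewrite sqrf_eq1 => /orP[/eqP//|/eqP h].
    by have := normc_ge0 w; rewrite h; lra.
  have ev (v : R[i]) : P.[v] = (even_poly P).[v ^+ 2] + (odd_poly P).[v ^+ 2] * v.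
    rewrite -[in LHS](poly_even_odd P) hornerD hornerM !horner_comp !hornerXn hornerX.
    by [].
  have h1 := PB w w1; have h2 := PB (- w); rewrite normc_opp in h2.
  move: h1 (h2 w1); rewrite !ev sqrrN w2.
  set a := (even_poly P).[u]; set b := _ * w; have -> : (odd_poly P).[u] * - w = - b.
    by rewrite mulrN.
  move=> {}h1 {}h2.
  have nb : Normc.normc b = Normc.normc (odd_poly P).[u] by rewrite Normc.normcM w1 mulr1.
  rewrite -nb.
  have n2 (z : R[i]) : Normc.normc (z + z) = 2 * Normc.normc z.
    have -> : z + z = (2%:R)%:C * z by rewrite rmorph_nat mulr_natl mulr2n.
    by rewrite Normc.normcM normc_real normr_nat.
  have ha : Normc.normc (a + a) <= 2 * B.
    have -> : a + a = (a + b) + (a + - b) by ring.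
    by apply: (le_trans (normc_add_le _ _)); lra.
  have hb : Normc.normc (b + b) <= 2 * B.
    have -> : b + b = (a + b) + - (a + - b) by ring.
    by apply: (le_trans (normc_add_le _ _)); rewrite normc_opp; lra.
  by rewrite !n2 in ha hb; lra.
have se : (size (even_poly P) < n)%N.
  by apply: (leq_ltn_trans (size_even_poly _)); rewrite uphalfE; move: Pn s1; lia.
have so : (size (odd_poly P) < n)%N.
  by apply: (leq_ltn_trans (size_odd_poly _)); move: Pn s1; lia.
rewrite -(odd_double_half k); case: (odd k) => /=.
  by rewrite add1n -coef_odd_poly; apply: (IH _ so) => u /half[].
by rewrite add0n -coef_even_poly; apply: (IH _ se) => u /half[].
Qed.

(** If Delta = 1 / n the triangle inequality suffices. Otherwise write w = a + i b:
the first norm is at most x + a + b^2 / (2 (x + a)), where x + a >= x / 2 and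
b^2 <= x (1 - x) / (4 n), hence at most x + a + 1 / (2 n); the second one is
treated in the same way, and the contributions of a cancel. *)
Lemma disc_sum_le (R : realType) (n : nat) (x : R) (w : R[i]) : (1 <= n)%N ->
    x \in `[0, 1] -> Normc.normc w = Delta n x / 2 ->
  Normc.normc (x%:C + w) + Normc.normc (1 - (x%:C + w)) <= 1 + n%:R^-1.
Proof.
move=> n0 x01 wE; have d0 := Delta_gt0 x n0; have d2 := Delta_sqr n x01.
have n1 : 0 < n%:R^-1 :> R by rewrite invr_gt0 ltr0n.
move: (x01); rewrite in_itv/= => /andP[x0 x1].
case: (leP (x * (1 - x) / n%:R) (n%:R^-1 ^+ 2)) d2 => hx d2.
  have dE : Delta n x = n%:R^-1.
    by apply/eqP; rewrite -(eqrXn2 (n := 2)) ?(ltW d0) ?(ltW n1)//; apply/eqP.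
  have h1 := normc_add_le x%:C w.
  have h2 := normc_add_le (1 - x)%:C (- w).
  rewrite normc_opp in h2.
  have -> : 1 - (x%:C + w) = (1 - x)%:C + - w by rewrite rmorphB rmorph1; ring.
  by rewrite !normc_real ger0_norm// wE dE in h1 h2; rewrite ger0_norm in h2; lra.
case: w wE => a b /= wE.
have ab : a ^+ 2 + b ^+ 2 = (Delta n x / 2) ^+ 2.
  by rewrite -wE sqr_sqrtr// addr_ge0 ?sqr_ge0.
move: d2 d0 ab hx n1; move: (Delta n x) (n%:R^-1) {wE} => d v d2 d0 ab hx v0.
have vx : v < x * (1 - x) by rewrite expr2 ltr_pM2r in hx.
have dx : d <= x * (1 - x).
  rewrite -(ler_pXn2r (n := 2)) ?nnegrE ?(ltW d0)//; last by lra.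
  by rewrite d2 expr2 ler_pM2l//; lra.
have ad : `|a| <= d / 2.
  rewrite -(ler_pXn2r (n := 2)) ?nnegrE ?divr_ge0 ?(ltW d0)//.
  by rewrite real_normK ?num_real// -ab lerDl sqr_ge0.
have b2 : b ^+ 2 <= d ^+ 2 / 4.
  have -> : d ^+ 2 / 4 = (d / 2) ^+ 2 by field.
  by rewrite -ab lerDr sqr_ge0.
move: ad; rewrite ler_norml => /andP[a1 a2].
have aux (y c : R) : 0 <= y -> d <= y -> d ^+ 2 <= y * v -> - (d / 2) <= c ->
    Num.sqrt ((y + c) ^+ 2 + b ^+ 2) <= y + c + v / 2.
  move=> y0 dy dv dc; have yc : y / 2 <= y + c by lra.
  rewrite -[leRHS]ger0_norm -?sqrtr_sqr; last by lra.
  rewrite ler_wsqrtr//; nra.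
have h1 : Num.sqrt ((x + a) ^+ 2 + b ^+ 2) <= x + a + v / 2.
  by apply: aux => //; [nra | rewrite d2; nra].
have h2 : Num.sqrt (((1 - x) + - a) ^+ 2 + b ^+ 2) <= (1 - x) + - a + v / 2.
  by apply: aux; [nra | nra | rewrite d2; nra | lra].
have -> : Num.sqrt ((1 - (x + a)) ^+ 2 + (0 - (0 + b)) ^+ 2) =
    Num.sqrt (((1 - x) + - a) ^+ 2 + b ^+ 2) :> R by congr Num.sqrt; ring.
by rewrite add0r; lra.
Qed.

Lemma disc_point (R : realType) (n : nat) (x : R) (w : R[i]) : (1 <= n)%N ->
    x \in `[0, 1] -> Normc.normc w = Delta n x / 2 ->
  let S := Normc.normc (x%:C + w) + Normc.normc (1 - (x%:C + w)) in
  [/\ 1 <= S, Normc.normc (x%:C + w) / S \in `[0, 1] &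
      `|Normc.normc (x%:C + w) / S - x| <= 2 * Delta n x].
Proof.
move=> n0 x01 wE S; have Sn := disc_sum_le n0 x01 wE; rewrite -/S in Sn.
have dn := Delta_ge_inv n x.
set z := x%:C + w in S Sn *.
have S1 : 1 <= S.
  by have := normc_add_le z (1 - z); rewrite addrC subrK Normc.normc1.
have S0 : 0 < S by lra.
have z0 := normc_ge0 z; have y0 := normc_ge0 (1 - z).
have zS : Normc.normc z <= S by rewrite lerDl.
move: (x01); rewrite in_itv/= => /andP[x0 x1].
have h1 : Normc.normc z <= x + Delta n x / 2.
  by rewrite (le_trans (normc_add_le _ _))// normc_real ger0_norm// wE.
have h2 : x <= Normc.normc z + Delta n x / 2.
  have := normc_add_le z (- w); rewrite addrK normc_real ger0_norm// normc_opp wE.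
  by [].
split => //; first by rewrite in_itv/= divr_ge0 ?(ltW S0)//= ler_pdivrMr// mul1r.
have -> : Normc.normc z / S = Normc.normc z - Normc.normc z / S * (S - 1).
  by field; rewrite gt_eqF.
have u0 : 0 <= Normc.normc z / S by rewrite divr_ge0// ltW.
have u1 : Normc.normc z / S <= 1 by rewrite ler_pdivrMr// mul1r.
have h3 : 0 <= Normc.normc z / S * (S - 1) by rewrite mulr_ge0// subr_ge0.
have h4 : Normc.normc z / S * (S - 1) <= S - 1 by rewrite ler_piMl// subr_ge0.
have d0 := Delta_gt0 x n0.
by rewrite ler_norml; apply/andP; split; lra.
Qed.

(** Triangle inequality and homogeneity of degree n in (X, 1 - X); this is where the
signs of the coefficients matter. *)
Lemma normc_bernstein_le (R : realType) (n : nat) (c : nat -> R) (z : R[i]) :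
    (forall k, (k <= n)%N -> 0 <= c k) ->
    let S := Normc.normc z + Normc.normc (1 - z) in 0 < S ->
  Normc.normc (map_poly (real_complex R) (bernstein n c)).[z] <=
    S ^+ n * (bernstein n c).[Normc.normc z / S].
Proof.
move=> c0 S S0.
have -> : (map_poly (real_complex R) (bernstein n c)).[z] =
    \sum_(k < n.+1) ('C(n, k)%:R * c k)%:C * (z ^+ k * (1 - z) ^+ (n - k)).
  rewrite /bernstein rmorph_sum horner_sum; apply: eq_bigr => k _.
  rewrite /= map_polyZ [map_poly _ (_ * _)]rmorphM/= !rmorphXn/= rmorphB/= rmorph1.
  by rewrite map_polyX !hornerE.
apply: (le_trans (normc_sum_le _ _)).
rewrite horner_bernstein mulr_sumr; apply: ler_sum => k _.
have kn : (k <= n)%N by rewrite -ltnS.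
rewrite !Normc.normcM !normcX normc_real ger0_norm ?mulr_ge0 ?c0//.
have -> : 1 - Normc.normc z / S = Normc.normc (1 - z) / S.
  by rewrite /S; field; rewrite gt_eqF.
rewrite !expr_div_n.
have -> : S ^+ n = S ^+ k * S ^+ (n - k) by rewrite -exprD subnKC.
rewrite le_eqVlt; apply/orP; left; apply/eqP.
by field; rewrite !expf_neq0 ?gt_eqF.
Qed.

Lemma expr_1Dinv_le (R : realType) (n : nat) : (1 <= n)%N ->
  (1 + n%:R^-1) ^+ n <= expR 1 :> R.
Proof.
move=> n0; have nR : n%:R != 0 :> R by rewrite pnatr_eq0 -lt0n.
have -> : expR 1 = expR (n%:R^-1) ^+ n :> R by rewrite -expRM_natr mulVf.
by apply: lerXn2r; rewrite ?nnegrE ?addr_ge0 ?invr_ge0 ?expR_ge0 ?expR_ge1Dx.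
Qed.

(** Cauchy's estimate in the disc of radius Delta n x / 2 about x. *)
Lemma bernstein_derivn_le (R : realType) (alpha : R) (k : nat) : 0 <= alpha ->
  exists2 K : R, 0 < K & forall (n : nat) (c : nat -> R) (A : R), (1 <= n)%N ->
    (forall k, (k <= n)%N -> 0 <= c k) -> 0 <= A ->
    (forall y, y \in `[0, 1] -> (bernstein n c).[y] <= A * Delta n y `^ alpha) ->
    forall x, x \in `[0, 1] ->
      `|(bernstein n c)^`(k).[x]| * Delta n x ^+ k <= K * A * Delta n x `^ alpha.
Proof.
move=> a0; have e0 := expR_gt0 (1 : R).
exists (k`!%:R * 2 ^+ k * (expR 1 * 3 `^ alpha)).
  by rewrite !mulr_gt0 ?exprn_gt0 ?powR_gt0 ?ltr0n ?fact_gt0.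
move=> n c A n0 c0 A0 HA x x01; set G := bernstein n c.
have d0 := Delta_gt0 x n0; set rho := Delta n x / 2.
have rho0 : 0 < rho by rewrite divr_gt0.
pose P : {poly R[i]} := \sum_(j < n.+1) (G^`N(j).[x] * rho ^+ j)%:C *: 'X^j.
have PE (w : R[i]) : P.[w] = (map_poly (real_complex R) G).[x%:C + rho%:C * w].
  have GE : G = _ := poly_taylor x (size_bernstein n c).
  rewrite [X in map_poly _ X]GE rmorph_sum/= !horner_sum.
  apply: eq_bigr => j _; rewrite map_polyZ [map_poly _ (_ ^+ _)]rmorphXn/=.
  rewrite rmorphB/= map_polyX map_polyC/= !hornerE addrAC subrr add0r.
  rewrite [(_%:C * w) ^+ j]exprMn mulrA -rmorphXn -rmorphM/=.
  by [].
pose B := expR 1 * A * (3 * Delta n x) `^ alpha.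
have PB (w : R[i]) : Normc.normc w = 1 -> Normc.normc P.[w] <= B.
  move=> w1; have wE : Normc.normc (rho%:C * w) = Delta n x / 2.
    by rewrite Normc.normcM w1 mulr1 normc_real gtr0_norm.
  have [S1 u01 ux] := disc_point n0 x01 wE; have Sn := disc_sum_le n0 x01 wE.
  rewrite PE; set z := x%:C + _ in S1 u01 ux Sn *.
  set S := Normc.normc z + _ in S1 u01 ux Sn *.
  have S0 : 0 < S by lra.
  apply: (le_trans (normc_bernstein_le c0 S0)); rewrite -/S /B -mulrA.
  apply: ler_pM.
  - by rewrite exprn_ge0// ltW.
  - rewrite horner_bernstein sumr_ge0// => i _.
    have im : (i <= n)%N by rewrite -ltnS.
    move: u01; rewrite in_itv/= => /andP[u0 u1].
    by rewrite !mulr_ge0 ?c0 ?exprn_ge0 ?subr_ge0.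
  - apply: le_trans (expr_1Dinv_le R n0); apply: lerXn2r; rewrite ?nnegrE ?(ltW S0)//.
  - apply: (le_trans (HA _ u01)); rewrite ler_wpM2l//.
    have d3 : Delta n (Normc.normc z / S) <= 3 * Delta n x.
      apply: (le_trans (Delta_shift n0 u01 x01)).
      by apply: (le_trans (lerD (lexx _) ux)); lra.
    by apply: ge0_ler_powR; rewrite ?nnegrE ?mulr_ge0 ?(ltW d0) ?(ltW (Delta_gt0 _ _)).
have B0 : 0 <= B by rewrite !mulr_ge0 ?powR_ge0 ?(ltW e0).
have [kn|kn] := leqP k n; last first.
  have -> : G^`(k) = 0.
    rewrite nderivn_def (_ : G^`N(k) = 0) ?mul0rn//.
    apply/polyP => i; rewrite coef_nderivn coef0 nth_default ?mul0rn//.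
    by apply: (leq_trans (size_bernstein _ _)); rewrite (leq_trans kn)// leq_addr.
  rewrite hornerC normr0 mul0r !mulr_ge0 ?powR_ge0 ?exprn_ge0 ?(ltW e0)//.
have := coef_le_circle PB k.
have -> : P`_k = (G^`N(k).[x] * rho ^+ k)%:C.
  rewrite /P coef_sum (bigD1 (Ordinal (kn : (k < n.+1)%N)))//= big1 ?addr0.
    by rewrite coefZ coefXn eqxx mulr1.
  move=> i ik; rewrite coefZ coefXn (_ : (k == i) = false) ?mulr0//.
  by apply/negbTE; apply: contra ik => /eqP ik; apply/eqP/val_inj.
rewrite normc_real normrM (ger0_norm (exprn_ge0 k (ltW rho0))) => h.
have -> : `|G^`(k).[x]| * Delta n x ^+ k =
    k`!%:R * 2 ^+ k * (`|G^`N(k).[x]| * rho ^+ k).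
  rewrite nderivn_def hornerMn -mulr_natr normrM normr_nat /rho expr_div_n.
  by field; rewrite expf_neq0.
rewrite -!mulrA; apply: ler_wpM2l => //; apply: ler_wpM2l; first by rewrite exprn_ge0.
apply: (le_trans h); rewrite /B powRM ?(ltW d0)//.
by rewrite le_eqVlt; apply/orP; left; apply/eqP; ring.
Qed.

Local Close Scope complex_scope.

(** * Series of functions on the scale Delta *)

(** With e J the tail of the geometric series, u J - e J increases, u J + e J
decreases, and any number between the two sequences will do. *)
Lemma geometric_limit (R : realType) (u : nat -> R) (K q : R) :
    0 <= K -> 0 <= q < 1 -> (forall J, `|u J.+1 - u J| <= K * q ^+ J) ->
  exists l, forall J, `|l - u J| <= K / (1 - q) * q ^+ J.
Proof.
move=> K0 /andP[q0 q1] Hu; have q1' : 0 < 1 - q by rewrite subr_gt0.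
pose e J := K / (1 - q) * q ^+ J.
have eS J : e J = K * q ^+ J + e J.+1 by rewrite /e exprS; field; rewrite gt_eqF.
have e0 J : 0 <= e J by rewrite mulr_ge0 ?exprn_ge0// divr_ge0// ltW.
have step J : u J - e J <= u J.+1 - e J.+1 /\ u J.+1 + e J.+1 <= u J + e J.
  by have := Hu J; rewrite ler_norml (eS J) => /andP[h1 h2]; split; lra.
have incr J M : u J - e J <= u (J + M)%N - e (J + M)%N.
  elim: M => [|M IH]; first by rewrite addn0.
  by rewrite addnS (le_trans IH)//; case: (step (J + M)%N).
have decr J M : u (J + M)%N + e (J + M)%N <= u J + e J.
  elim: M => [|M IH]; first by rewrite addn0.
  by rewrite addnS (le_trans _ IH)//; case: (step (J + M)%N).
have cross J M : u J - e J <= u M + e M.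
  have h1 := incr J M; have h2 := decr M J; rewrite addnC in h2.
  by have := e0 (J + M)%N; lra.
pose A := [set u J - e J | J in [set: nat]].
have A0 : A !=set0 by exists (u 0%N - e 0%N), 0%N.
have ubA M : ubound A (u M + e M) by move=> _ [J _ <-]; exact: cross.
exists (sup A) => J; rewrite ler_norml; apply/andP; split.
  have : u J - e J <= sup A.
    by apply: ub_le_sup; [exists (u 0%N + e 0%N); exact: ubA | exists J].
  by rewrite /e; lra.
by have := ge_sup A0 (ubA J); rewrite /e; lra.
Qed.

Lemma powR_geometric_small (R : realType) (K q e : R) : 0 <= q < 1 -> 0 < e ->
  exists J, K * q ^+ J <= e.
Proof.
move=> /andP[q0 q1] e0; have q1' : `|q| < 1 by rewrite ger0_norm.
have /cvgrPdist_le/(_ (e / (`|K| + 1))) := cvg_expr q1'.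
have K1 : 0 < `|K| + 1 by rewrite ltr_wpDl.
move=> /(_ (divr_gt0 e0 K1))[J _ HJ]; exists J.
have := HJ J (leqnn J); rewrite sub0r normrN ler_pdivlMr// => h.
apply: le_trans h; rewrite (ger0_norm (exprn_ge0 _ q0)) mulrC ler_wpM2l ?exprn_ge0//.
by rewrite (le_trans (ler_norm K))// lerDl.
Qed.

Lemma inv_sqrt2 (R : realType) : 0 < ((Num.sqrt 2)^-1 : R) < 1.
Proof.
rewrite invr_gt0 sqrtr_gt0 ltr0n/= invf_lt1 ?sqrtr_gt0 ?ltr0n//.
by rewrite -[ltLHS]sqrtr1 ltr_sqrt ?ltr0n// ltr1n.
Qed.

Lemma powR_lt1 (R : realType) (x a : R) : 0 < x < 1 -> 0 < a -> 0 < x `^ a < 1.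
Proof.
move=> /andP[x0 x1] a0; rewrite powR_gt0//=.
rewrite -[ltRHS](one_powR a).
by apply: gt0_ltr_powR; rewrite ?nnegrE ?(ltW x0).
Qed.

(** The terms decrease geometrically away from the index where d j is close to h. The
sum telescopes against a function V of d with m (d) + V (d') <= V (d) for
d' <= d / sqrt 2, where m (d) is the summand. *)
Lemma two_regime_sum (R : realType) (delta : R) : 0 < delta < 1 ->
  exists2 M : R, 0 < M & forall (h : R) (d : nat -> R) J, 0 < h ->
    (forall j, 0 < d j) -> (forall j, d j.+1 <= d j / Num.sqrt 2) ->
    \sum_(j < J) (if d j < h then d j `^ delta else h / d j `^ (1 - delta)) <=
      M * h `^ delta.
Proof.
move=> /andP[de0 de1]; set w := 1 - delta; have w0 : 0 < w by rewrite subr_gt0.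
have /andP[r0 r1] := inv_sqrt2 R; set rt := (Num.sqrt 2)^-1 in r0 r1.
have /andP[s0 s1] := powR_lt1 (inv_sqrt2 R) de0.
have /andP[g0 g1] := powR_lt1 (inv_sqrt2 R) w0.
set s := rt `^ delta in s0 s1; set g := rt `^ w in g0 g1.
have s1' : 0 < 1 - s by rewrite subr_gt0.
have g1' : 0 < 1 - g by rewrite subr_gt0.
pose M := 1 + (1 - s)^-1 + g / (1 - g).
have sV : 0 < (1 - s)^-1 by rewrite invr_gt0.
have gV : 0 < g / (1 - g) by rewrite divr_gt0.
have M0 : 0 < M by rewrite /M; lra.
exists M => // h d J h0 d0 dS.
pose m x := if x < h then x `^ delta else h / x `^ w.
pose V x := if x < h then x `^ delta / (1 - s)
  else M * h `^ delta - h / x `^ w * (g / (1 - g)).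
have hw : h / h `^ w = h `^ delta.
  have hn0 : h != 0 by rewrite gt_eqF.
  rewrite -[X in X / _](powRr1 (ltW h0)) -powRB; last by rewrite hn0 implybT.
  by rewrite /w opprB addrC subrK.
have hd0 : 0 < h `^ delta by rewrite powR_gt0.
have big x : h <= x -> h / x `^ w <= h `^ delta.
  move=> hx; rewrite -hw ler_wpM2l ?(ltW h0)// lef_pV2 ?posrE ?powR_gt0//.
    by apply: ge0_ler_powR; rewrite ?nnegrE ?(ltW w0) ?(ltW h0)// (le_trans (ltW h0)).
  exact: lt_le_trans hx.
have small x : 0 < x -> x < h -> x `^ delta <= h `^ delta.
  by move=> x0 xh; apply: ge0_ler_powR; rewrite ?nnegrE ?(ltW de0) ?(ltW x0) ?(ltW h0) ?(ltW xh).
have V0 x : 0 < x -> 0 <= V x.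
  move=> x0; rewrite /V; case: ltP => xh; first by rewrite divr_ge0 ?powR_ge0 ?ltW.
  rewrite subr_ge0 (le_trans (ler_wpM2r (ltW gV) (big x xh)))// mulrC ler_wpM2r ?(ltW hd0)//.
  by rewrite /M; lra.
have VM x : 0 < x -> V x <= M * h `^ delta.
  move=> x0; rewrite /V; case: ltP => xh.
    rewrite mulrC; apply: ler_pM; rewrite ?powR_ge0 ?(ltW sV) ?small//.
    by rewrite /M; lra.
  by rewrite gerBl mulr_ge0 ?(ltW gV)// divr_ge0 ?powR_ge0 ?ltW.
have VS x y : 0 < x -> 0 < y -> y <= x * rt -> m x + V y <= V x.
  move=> x0 y0 yx.
  have yd : y `^ delta <= s * x `^ delta.
    rewrite mulrC -powRM ?(ltW x0) ?(ltW r0)//.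
    by apply: ge0_ler_powR; rewrite ?nnegrE ?mulr_ge0 ?(ltW de0) ?(ltW x0) ?(ltW y0) ?(ltW r0).
  have yw : y `^ w <= g * x `^ w.
    rewrite mulrC -powRM ?(ltW x0) ?(ltW r0)//.
    by apply: ge0_ler_powR; rewrite ?nnegrE ?mulr_ge0 ?(ltW w0) ?(ltW x0) ?(ltW y0) ?(ltW r0).
  rewrite /m /V; case: (ltP x h) => xh.
    have -> : y < h by apply: le_lt_trans xh; rewrite (le_trans yx)// ler_piMr ?ltW.
    rewrite -lerBrDl; have -> : x `^ delta / (1 - s) - x `^ delta = s * x `^ delta / (1 - s).
      by field; rewrite gt_eqF.
    by rewrite ler_wpM2r ?(ltW sV).
  have hx := big x xh; have xw0 : 0 < x `^ w by rewrite powR_gt0.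
  case: (ltP y h) => yh.
    have yb := ler_wpM2r (ltW sV) (small y y0 yh).
    have xb := ler_wpM2r (ltW gV) hx.
    have -> : M * h `^ delta = h `^ delta + h `^ delta * (1 - s)^-1 + h `^ delta * (g / (1 - g)).
      by rewrite /M; ring.
    by lra.
  have yw0 : 0 < y `^ w by rewrite powR_gt0.
  have hy : h / x `^ w <= g * (h / y `^ w).
    rewrite mulrCA ler_wpM2l ?(ltW h0)// ler_pdivlMr// mulrC ler_pdivrMr//.
  have := ler_wpM2r (ltW (_ : 0 < (1 - g)^-1)) hy; rewrite invr_gt0 => /(_ g1').
  have -> : g * (h / y `^ w) / (1 - g) = h / y `^ w * (g / (1 - g)) by ring.
  have -> : h / x `^ w / (1 - g) = h / x `^ w + h / x `^ w * (g / (1 - g)).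
    by field; rewrite !gt_eqF.
  by lra.
suff : \sum_(j < J) m (d j) + V (d J) <= V (d 0%N).
  have := V0 (d J) (d0 J); have := VM (d 0%N) (d0 0%N); rewrite /m; lra.
elim: J => [|J IH]; first by rewrite big_ord0 add0r.
rewrite big_ord_recr/=; apply: le_trans IH.
by rewrite -addrA lerD2l; apply: VS.
Qed.

(** D - S J is a limit of polynomials with derivatives of size O(q^J), hence Lipschitz
with a constant O(q^J). *)
Lemma deriv_on01_limit (R : realType) (D D' : R -> R) (S : nat -> {poly R}) (K q : R) :
    0 <= K -> 0 <= q < 1 ->
    (forall x J, x \in `[0, 1] -> `|D x - (S J).[x]| <= K * q ^+ J) ->
    (forall x J, x \in `[0, 1] -> `|D' x - (S J)^`().[x]| <= K * q ^+ J) ->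
  deriv_on01 D D'.
Proof.
move=> K0 q01 HD HD'; have [q0 _] := andP q01.
have key x y J : x \in `[0, 1] -> y \in `[0, 1] ->
    `|(D y - (S J).[y]) - (D x - (S J).[x])| <= K * q ^+ J * `|y - x|.
  move=> x01 y01; apply/ler_addgt0Pr => e e0.
  (* Replace D by the polynomial S M, with an error of at most e. *)
  have [M HM] := powR_geometric_small (3 * K) q01 e0.
  have qM : 0 <= K * q ^+ M by rewrite mulr_ge0// exprn_ge0.
  have yx1 : `|y - x| <= 1.
    by move: x01 y01; rewrite !in_itv/= ler_norml => /andP[? ?] /andP[? ?]; lra.
  have mv := @deriv_on01_mvt R _ _ (K * q ^+ J + K * q ^+ M) x y
    (@deriv_on01_horner R (S M - S J)) x01 y01.
  have /mv{}mv : forall z : R, z \in `[0, 1] -> `|z - x| <= `|y - x| ->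
      `|(S M - S J)^`().[z]| <= K * q ^+ J + K * q ^+ M.
    move=> z z01 _; rewrite derivB hornerD hornerN.
    have -> : (S M)^`().[z] - (S J)^`().[z] =
      (D' z - (S J)^`().[z]) - (D' z - (S M)^`().[z]) by ring.
    by rewrite (le_trans (ler_normB _ _))// lerD// HD'.
  rewrite !hornerD !hornerN in mv.
  have -> : D y - (S J).[y] - (D x - (S J).[x]) =
      ((S M).[y] - (S J).[y] - ((S M).[x] - (S J).[x])) +
      ((D y - (S M).[y]) - (D x - (S M).[x])) by ring.
  have h1 := HD y M y01; have h2 := HD x M x01.
  apply: (le_trans (ler_normD _ _)).
  have h3 := le_trans (ler_normB _ _) (lerD h1 h2).
  have : K * q ^+ M * `|y - x| <= K * q ^+ M by rewrite ler_piMr.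
  by rewrite mulrDl in mv; lra.
apply/deriv_on01P => x x01 e e0; have e4 : 0 < e / 2 by rewrite divr_gt0.
have [J HJ] := powR_geometric_small (2 * K) q01 e4.
have /deriv_on01P/(_ x x01 _ e4)[d d0 Hd] := @deriv_on01_horner R (S J).
exists d => // y y01 yx; have h1 := Hd y y01 yx; have h2 := key x y J x01 y01.
have -> : D y - D x - D' x * (y - x) =
    ((S J).[y] - (S J).[x] - (S J)^`().[x] * (y - x)) +
    ((D y - (S J).[y]) - (D x - (S J).[x])) - (D' x - (S J)^`().[x]) * (y - x) by ring.
have h3 : `|(D' x - (S J)^`().[x]) * (y - x)| <= K * q ^+ J * `|y - x|.
  by rewrite normrM ler_wpM2r// HD'.
apply: (le_trans (ler_normB _ _)); have := ler_normD
  ((S J).[y] - (S J).[x] - (S J)^`().[x] * (y - x)) ((D y - (S J).[y]) - (D x - (S J).[x])).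
have : 2 * K * q ^+ J * `|y - x| <= e / 2 * `|y - x| by rewrite ler_wpM2r.
by lra.
Qed.

Lemma holder_modulus (R : realType) (g : R -> R) (C d : R) : 0 <= C -> 0 <= d ->
    (forall x y : R, x \in `[0, 1] -> y \in `[0, 1] ->
      `|g x - g y| <= C * `|x - y| `^ d) ->
  forall h, 0 < h -> (modulus01 g h <= (C * h `^ d)%:E)%E.
Proof.
move=> C0 d0 H h h0; apply: ge_ereal_sup => _ [x [y [x01 y01 xy ->]]].
rewrite lee_fin (le_trans (H x y x01 y01))// ler_wpM2l//.
by apply: ge0_ler_powR; rewrite ?nnegrE ?(ltW h0)// ltW.
Qed.

Lemma Delta_exp2_le (R : realType) (J : nat) (x : R) : x \in `[0, 1] ->
  Delta (2 ^ J) x <= (Num.sqrt 2)^-1 ^+ J.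
Proof.
move=> x01; have J0 : (1 <= 2 ^ J)%N by rewrite expn_gt0.
rewrite -(ler_pXn2r (n := 2)) ?nnegrE ?exprn_ge0 ?invr_ge0 ?sqrtr_ge0 ?(ltW (Delta_gt0 _ _))//.
apply: (le_trans (Delta_sqr_le J0 x01)).
by rewrite -exprM mulnC exprM exprVn sqr_sqrtr// natrX exprVn.
Qed.

(** The derivatives of order at most r are sums of geometrically decreasing terms. In
the increment of the r-th derivative, a term is estimated by the mean value
theorem if d j is at least |x - y| at x or at y, and by its size otherwise. *)
Lemma C_alpha01_of_series (R : realType) (f : R -> R) (alpha C : R)
    (H : {poly R}) (U : nat -> {poly R}) (d : nat -> R -> R) :
    0 < alpha -> (forall m : nat, alpha <> m%:R) ->
    (forall j x, 0 < d j x) ->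
    (forall j x, x \in `[0, 1] -> d j x <= (Num.sqrt 2)^-1 ^+ j) ->
    (forall j x, x \in `[0, 1] -> d j.+1 x <= d j x / Num.sqrt 2) ->
    (forall j x z, x \in `[0, 1] -> z \in `[0, 1] ->
      `|z - x| <= d j x -> d j x <= 2 * d j z) ->
    (forall x J, x \in `[0, 1] ->
      `|f x - (H + \sum_(j < J) U j).[x]| <= C * d J x `^ alpha) ->
    (forall k, exists K : R, forall j x, x \in `[0, 1] ->
      `|(U j)^`(k).[x]| * d j x ^+ k <= K * d j x `^ alpha) ->
  C_alpha01 alpha f.
Proof.
move=> a0 an d0 dexp dhalf dshift conv bnd; rewrite /C_alpha01.
have /andP[ra ra1] := truncn_lt_nonint a0 an.
move: (Num.truncn alpha) ra ra1 => r ra ra1.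
pose de := alpha - r%:R; have de0 : 0 < de by rewrite subr_gt0.
have de1 : de < 1 by rewrite /de ltrBlDl natr1.
have /andP[rt0 rt1] := inv_sqrt2 R.
have d1 j (x : R) : x \in `[0, 1] -> d j x <= 1.
  by move=> x01; rewrite (le_trans (dexp j x x01))// exprn_ile1 ?ltW.
have [K K0 HK] : exists2 K : R, 0 <= K & forall k, (k <= r.+1)%N ->
    forall j x, x \in `[0, 1] ->
      `|(U j)^`(k).[x]| * d j x ^+ k <= K * d j x `^ alpha.
  apply: bounded_upto => [k B B' HB BB' j x x01|k _]; last exact: bnd.
  by rewrite (le_trans (HB j x x01))// ler_wpM2r ?powR_ge0.
have bk k j x : (k <= r)%N -> x \in `[0, 1] -> `|(U j)^`(k).[x]| <= K * d j x `^ de.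
  move=> kr x01; have ka : k%:R <= alpha by rewrite (le_trans _ (ltW ra))// ler_nat.
  have := HK k (leqW kr) j x x01.
  rewrite (powR_mulXn (ltW (d0 j x)) (ltW a0) ka) mulrA ler_pM2r ?exprn_gt0// => /le_trans.
  apply; rewrite ler_wpM2l//; apply: ger_powR; first by rewrite d0 d1.
  by rewrite /de lerD2l lerN2 ler_nat.
have btop j x : x \in `[0, 1] -> `|(U j)^`(r.+1).[x]| <= K / d j x `^ (1 - de).
  move=> x01; have := HK r.+1 (leqnn _) j x x01.
  rewrite (powR_mulXn (ltW (d0 j x)) (ltW a0) (ltW ra)) -/de exprSr.
  rewrite mulrA [_ * (_ * d j x)]mulrCA mulrC ler_pM2r ?exprn_gt0// => h.
  rewrite ler_pdivlMr ?powR_gt0// -(ler_pM2r (powR_gt0 de (d0 j x))) -mulrA.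
  rewrite -powRD; last by rewrite (gt_eqF (d0 j x)) implybT.
  by rewrite subrK powRr1// ltW.
pose q : R := (Num.sqrt 2)^-1 `^ de.
have /andP[q0 q1] := powR_lt1 (inv_sqrt2 R) de0; rewrite -/q in q0 q1.
have q01 : 0 <= q < 1 by rewrite ltW.
have dq J (x : R) : x \in `[0, 1] -> d J x `^ de <= q ^+ J.
  move=> x01; apply: (@le_trans _ _ (((Num.sqrt 2)^-1 ^+ J) `^ de)).
    apply: ge0_ler_powR; rewrite ?nnegrE ?exprn_ge0 ?(ltW de0) ?(ltW rt0) ?(ltW (d0 _ _))//.
    exact: dexp.
  rewrite -[X in X `^ de](powR_mulrn J (ltW rt0)) -powRrM mulrC powRrM -/q.
  by rewrite powR_mulrn// ltW.
pose S J := H + \sum_(j < J) U j.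
have SS J k : (S J.+1)^`(k) = (S J)^`(k) + (U J)^`(k).
  rewrite /S big_ord_recr/= addrA; exact: derivnD.
have lim k x : exists l, (k <= r)%N -> x \in `[0, 1] ->
    forall J, `|l - (S J)^`(k).[x]| <= K / (1 - q) * q ^+ J.
  have [kr|/negP nk] := boolP (k <= r)%N; last by exists 0.
  have [x01|/negP nx] := boolP (x \in `[0, 1]); last by exists 0.
  have [J|l Hl] := @geometric_limit R (fun J => (S J)^`(k).[x]) K q K0 q01.
    rewrite SS hornerD addrC addKr (le_trans (bk k J x kr x01))// ler_wpM2l//.
    exact: dq.
  by exists l.
have [D HD] : exists D : nat -> R -> R, forall k x, (k <= r)%N -> x \in `[0, 1] ->
    forall J, `|D k x - (S J)^`(k).[x]| <= K / (1 - q) * q ^+ J.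
  have : forall kx : nat * R, exists l, (kx.1 <= r)%N -> kx.2 \in `[0, 1] ->
      forall J, `|l - (S J)^`(kx.1).[kx.2]| <= K / (1 - q) * q ^+ J.
    by move=> [k x]; exact: lim.
  by move=> /choice[D HD]; exists (fun k x => D (k, x)) => k x; exact: (HD (k, x)).
have K'0 : 0 <= K / (1 - q) by rewrite divr_ge0// subr_ge0 ltW.
set K' := K / (1 - q) in HD K'0.
exists D; split.
- move=> x x01; apply: eq_of_close => e e0.
  have [J HJ] := powR_geometric_small (K' + `|C|) q01 e0; apply: le_trans HJ.
  have h1 := HD 0%N x (leq0n _) x01 J; rewrite derivn0 in h1.
  have h2 : `|f x - (S J).[x]| <= `|C| * q ^+ J.
    apply: (le_trans (conv x J x01)).
    apply: (@le_trans _ _ (`|C| * d J x `^ alpha)).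
      by rewrite ler_wpM2r ?powR_ge0// ler_norm.
    rewrite ler_wpM2l// (le_trans _ (dq J x x01))//; apply: ger_powR.
      by rewrite d0 d1.
    by rewrite /de gerBl.
  have -> : D 0%N x - f x = (D 0%N x - (S J).[x]) - (f x - (S J).[x]) by ring.
  by rewrite mulrDl (le_trans (ler_normB _ _))// lerD.
- move=> k kr; apply: (@deriv_on01_limit _ _ _ (fun J => (S J)^`(k)) K' q) => // x J x01.
    by apply: HD => //; exact: ltnW.
  by rewrite -derivnS; exact: HD.
have [M M0 HM] := @two_regime_sum R de ltac:(by rewrite de0).
have [B B0 HB] := horner_bounded01 H^`(r.+1).
have w0 : 0 < 1 - de by rewrite subr_gt0.
pose m h e : R := if e < h then e `^ de else h / e `^ (1 - de).
have m0 h e : 0 <= h -> 0 <= m h e.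
  by move=> h0; rewrite /m; case: ifP => _; rewrite ?divr_ge0 ?powR_ge0.
have mvtU x y j : x \in `[0, 1] -> y \in `[0, 1] -> `|y - x| <= d j x ->
    `|(U j)^`(r).[y] - (U j)^`(r).[x]| <= 2 * K * (`|y - x| / d j x `^ (1 - de)).
  move=> x01 y01 yx; rewrite [leRHS](_ : _ = 2 * K / d j x `^ (1 - de) * `|y - x|).
    apply: (deriv_on01_mvt (@deriv_on01_horner R (U j)^`(r)) x01 y01) => z z01 zx.
    rewrite -derivnS (le_trans (btop j z z01))// [2 * K]mulrC -mulrA ler_wpM2l//.
    rewrite -[leLHS]div1r ler_pdivrMr ?powR_gt0// mulrAC ler_pdivlMr ?powR_gt0// mul1r.
    have dxz : d j x <= 2 * d j z by apply: dshift => //; exact: le_trans zx yx.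
    apply: (@le_trans _ _ ((2 * d j z) `^ (1 - de))).
      by apply: ge0_ler_powR; rewrite ?nnegrE ?mulr_ge0 ?(ltW w0) ?(ltW (d0 _ _)).
    rewrite powRM ?(ltW (d0 _ _))// ler_wpM2r ?powR_ge0//.
    rewrite -[leRHS](powRr1 (ler0n R 2)); apply: ler_powR; first by rewrite ler1n.
    by rewrite gerBl ltW.
  by ring.
have term x y j : x \in `[0, 1] -> y \in `[0, 1] ->
    `|(U j)^`(r).[x] - (U j)^`(r).[y]| <=
      2 * K * m `|x - y| (d j x) + 2 * K * m `|x - y| (d j y).
  move=> x01 y01; have mx := m0 _ (d j x) (normr_ge0 (x - y)).
  have my := m0 _ (d j y) (normr_ge0 (x - y)).
  have K2 : 0 <= 2 * K by rewrite mulr_ge0.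
  have [xd|xd] := leP `|x - y| (d j x).
    have xd' : `|y - x| <= d j x by rewrite distrC.
    rewrite distrC; apply: (le_trans (mvtU x y j x01 y01 xd')).
    by rewrite {1}/m ltNge xd/= (distrC y x) lerDl mulr_ge0.
  have [yd|yd] := leP `|x - y| (d j y).
    apply: (le_trans (mvtU y x j y01 x01 yd)); rewrite {2}/m ltNge yd/=.
    by rewrite lerDr mulr_ge0.
  rewrite /m xd yd; apply: (le_trans (ler_normB _ _)); apply: lerD.
    apply: (le_trans (bk r j x (leqnn r) x01)); rewrite ler_wpM2r ?powR_ge0//; lra.
  by apply: (le_trans (bk r j y (leqnn r) y01)); rewrite ler_wpM2r ?powR_ge0//; lra.
exists (B + 4 * K * M); near=> h; apply: holder_modulus.
- by rewrite addr_ge0// !mulr_ge0// ltW.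
- exact: ltW.
- move=> x y x01 y01; have [->|nxy] := eqVneq x y.
    by rewrite subrr normr0 !mulr_ge0 ?powR_ge0// addr_ge0// !mulr_ge0// ltW.
  have h0 : 0 < `|x - y| by rewrite normr_gt0 subr_eq0.
  have h1 : `|x - y| <= 1.
    by move: x01 y01; rewrite !in_itv/= ler_norml => /andP[? ?] /andP[? ?]; lra.
  have hh : `|x - y| <= `|x - y| `^ de.
    rewrite -[leLHS](powRr1 (ltW h0)); apply: ger_powR; last exact: ltW.
    by rewrite h0.
  apply/ler_addgt0Pr => e e0; have [J HJ] := powR_geometric_small (2 * K') q01 e0.
  have sumU : `|\sum_(j < J) ((U j)^`(r).[x] - (U j)^`(r).[y])| <=
      4 * K * M * `|x - y| `^ de.
    apply: (le_trans (ler_norm_sum _ _ _)).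
    have hx := HM _ (d^~ x) J h0 (d0^~ x) (fun j => dhalf j x x01).
    have hy := HM _ (d^~ y) J h0 (d0^~ y) (fun j => dhalf j y y01).
    apply: (@le_trans _ _ (2 * K * (\sum_(j < J) m `|x - y| (d j x)) +
       2 * K * (\sum_(j < J) m `|x - y| (d j y)))).
      by rewrite !mulr_sumr -big_split/=; apply: ler_sum => j _; exact: term.
    have K2 : 0 <= 2 * K by rewrite mulr_ge0.
    have -> : 4 * K * M * `|x - y| `^ de = 2 * K * (M * `|x - y| `^ de) +
      2 * K * (M * `|x - y| `^ de) by ring.
    by apply: lerD; apply: ler_wpM2l.
  have mvtH : `|H^`(r).[x] - H^`(r).[y]| <= B * `|x - y|.
    apply: (deriv_on01_mvt (@deriv_on01_horner R H^`(r)) y01 x01) => z z01 _.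
    by rewrite -derivnS HB.
  have SE z : (S J)^`(r).[z] = H^`(r).[z] + \sum_(j < J) (U j)^`(r).[z].
    by rewrite /S derivnD hornerD (raddf_sum (derivn r)) horner_sum.
  have dS : (S J)^`(r).[x] - (S J)^`(r).[y] = (H^`(r).[x] - H^`(r).[y]) +
      \sum_(j < J) ((U j)^`(r).[x] - (U j)^`(r).[y]).
    by rewrite !SE sumrB; ring.
  have -> : D r x - D r y = ((S J)^`(r).[x] - (S J)^`(r).[y]) +
      ((D r x - (S J)^`(r).[x]) - (D r y - (S J)^`(r).[y])) by ring.
  have e1 := HD r x (leqnn r) x01 J; have e2 := HD r y (leqnn r) y01 J.
  have e3 := le_trans (ler_normB _ _) (lerD e1 e2).
  have e4 : `|(S J)^`(r).[x] - (S J)^`(r).[y]| <= (B + 4 * K * M) * `|x - y| `^ de.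
    rewrite dS mulrDl; apply: (le_trans (ler_normD _ _)); apply: lerD => //.
    by rewrite (le_trans mvtH)// ler_wpM2l.
  by apply: (le_trans (ler_normD _ _)); lra.
by near: h; exact: nbhs_right_gt.
Unshelve. all: by end_near. Qed.

(** * Smoothness from simulation *)

Lemma words_poly_ext_add (R : realType) (m n : nat) (Q : pred (seq input)) :
  words_poly R (m + n) (fun w => Q (take n w)) = words_poly R n Q.
Proof.
elim: m => [|m IH].
  rewrite /words_poly add0n big_mkcond [RHS]big_mkcond big_seq [RHS]big_seq.
  by apply: eq_bigr => w; rewrite mem_words => /eqP <-; rewrite take_size.
rewrite -IH -(words_poly_ext R (m + n)); congr words_poly; apply/funext => w /=.
by rewrite take_takel ?leq_addl.
Qed.

Lemma stopped_take (N : inputs -> option nat) (out : seq input -> bool) (m n : nat)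
    (w : seq input) : stopping_time N -> (m <= n)%N -> size w = n ->
  stopped N out (take m w) -> stopped N out w.
Proof.
move=> stN mn wn; have e k : (k <= n)%N -> take k w = mkseq (pad w) k.
  by move=> kn; rewrite mkseq_pad// wn.
rewrite e// -[in X in _ -> X](take_size w) wn e//.
move=> /(stoppedP _ _ _ stN)[k km Hk]; apply/(stoppedP _ _ _ stN).
by exists k => //; exact: leq_trans mn.
Qed.

(** The difference is the probability of the words that stop between the times m and
n. *)
Lemma stopped_increment (R : realType) (N : inputs -> option nat)
    (out : seq input -> bool) (m n : nat) : stopping_time N -> (m <= n)%N ->
  exists2 c : nat -> R, (forall k, 0 <= c k) &
    words_poly R n (stopped N out) - words_poly R m (stopped N out) = bernstein n c.
Proof.
move=> stN mn; pose Q w := stopped N out w && ~~ stopped N out (take m w).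
exists (fun h => (count Q (word_class n h))%:R / (2 ^+ n * 'C(n, h)%:R)).
  by move=> k; rewrite divr_ge0// mulr_ge0// exprn_ge0.
rewrite -words_polyE -(words_poly_ext_add R (n - m) m) subnK//.
apply/eqP; rewrite subr_eq; apply/eqP; rewrite /words_poly.
rewrite big_mkcond [X in _ = X + _]big_mkcond [X in _ = _ + X]big_mkcond -big_split/=.
rewrite big_seq [RHS]big_seq; apply: eq_bigr => w; rewrite mem_words => /eqP wn.
rewrite /Q; have := stopped_take stN mn wn (out := out).
case: (stopped N out (take m w)) => [/(_ isT) ->|_]; first by rewrite andbF add0r.
by rewrite andbT addr0.
Qed.

Lemma C_alpha01_of_simulation (R : realType) (f : R -> R) (alpha : R) :
    0 < alpha -> (forall m : nat, alpha <> m%:R) ->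
    can_simulate f (fun n x => Delta n x `^ alpha) -> C_alpha01 alpha f.
Proof.
move=> a0 an [N [out [[stN sim] [C HC]]]].
pose A n := words_poly R n (stopped N out).
have e2 j : (1 <= 2 ^ j)%N by rewrite expn_gt0.
have close x n : (1 <= n)%N -> x \in `[0, 1] ->
    (A n).[x] <= f x <= (A n).[x] + C * Delta n x `^ alpha.
  move=> n1 x01; have [_ fE] := sim x x01.
  have [h1 h2] := outputs_heads_bracket out n stN x01.
  rewrite fE in h1 h2; rewrite -!lee_fin h1/=; apply: (le_trans h2).
  by rewrite EFinD leeD2l//; apply: HC.
pose d j x : R := Delta (2 ^ j.+1) x.
have dd j x : x \in `[0, 1] ->
    C * Delta (2 ^ j) x `^ alpha <= `|C| * 2 `^ alpha * d j x `^ alpha.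
  move=> x01; have p0 := Delta_gt0 x (e2 j); have q0 := Delta_gt0 x (e2 j.+1).
  apply: (@le_trans _ _ (`|C| * Delta (2 ^ j) x `^ alpha)).
    by rewrite ler_wpM2r ?powR_ge0// ler_norm.
  rewrite -mulrA -powRM ?(ltW q0)// ler_wpM2l//.
  apply: ge0_ler_powR; rewrite ?nnegrE ?mulr_ge0 ?(ltW a0) ?(ltW p0) ?(ltW q0)//.
  by apply: Delta_le_mul => //; rewrite expnS; lia.
(* The j-th term of the series: stopping with output heads between the times
2^j and 2^(j+1). *)
pose U j := A (2 ^ j.+1)%N - A (2 ^ j)%N.
have tele J : A 1%N + \sum_(j < J) U j = A (2 ^ J)%N.
  elim: J => [|J IH]; first by rewrite big_ord0 addr0.
  by rewrite big_ord_recr/= addrA IH /U addrC subrK.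
apply: (@C_alpha01_of_series R f alpha (`|C| * 2 `^ alpha) (A 1%N) U d) => //.
- by move=> j x; apply: Delta_gt0.
- move=> j x x01; apply: (le_trans (Delta_exp2_le _ x01)).
  have /andP[r0 r1] := inv_sqrt2 R.
  by rewrite exprSr ler_piMr ?exprn_ge0 ?ltW.
- by move=> j x x01; rewrite /d [in leLHS]expnS; apply: Delta_mul.
- move=> j x z x01 z01 zx; have q0 := Delta_gt0 x (e2 j.+1).
  apply: (le_trans (Delta_shift_rel (e2 j.+1) x01 z01)); rewrite mulrC ler_wpM2r ?(ltW (Delta_gt0 _ _))//.
  have h : `|z - x| / d j x <= 1 by rewrite ler_pdivrMr// mul1r.
  by apply: (le_trans (lerD (lexx 1) h)); lra.
- move=> x J x01; rewrite tele; have /andP[h1 h2] := close x _ (e2 J) x01.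
  by apply: le_trans (dd J x x01); rewrite ger0_norm ?subr_ge0// lerBlDl.
move=> k; have [K K0 HK] := @bernstein_derivn_le R alpha k (ltW a0).
exists (K * (`|C| * 2 `^ alpha)) => j x x01.
have mn : (2 ^ j <= 2 ^ j.+1)%N by rewrite leq_exp2l.
have [c c0 Uc] := stopped_increment R out stN mn.
rewrite /U /A Uc; apply: HK x01 => [|//||y y01]; first exact: e2.
  by rewrite mulr_ge0// powR_ge0.
rewrite -Uc hornerD hornerN.
have /andP[h1 h2] := close y _ (e2 j) y01; have /andP[h3 h4] := close y _ (e2 j.+1) y01.
by apply: le_trans (dd j y y01); rewrite /A in h1 h2 h3 h4; lra.
Qed.

(** * Simulation at the rate Delta^alpha and smoothness *)

Theorem theorem8 (R : realType) (f : R -> R) (alpha : R)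
    (hf : forall x, x \in `[0, 1] -> 0 < f x < 1)
    (alpha_gt0 : 0 < alpha)
    (alpha_nonint : forall m : nat, alpha <> m%:R) :
  (C_alpha01 alpha f ->
    can_simulate f (fun n x => Delta n x `^ alpha) /\
    exists a b : nat -> nat -> R,
      [/\ (forall n k, (1 <= n)%N -> (k <= n)%N ->
             [/\ 0 <= a n k, a n k <= b n k & b n k <= 1]),
          (forall n k, (1 <= n)%N -> (k <= n)%N ->
             (exists z : int, 'C(n, k)%:R * a n k = z%:~R * 2 ^- n) /\
             (exists z : int, 'C(n, k)%:R * b n k = z%:~R * 2 ^- n)),
          (forall n p, (1 <= n)%N -> p \in `[0, 1] ->
             (bernstein n (a n)).[p] <= f p <= (bernstein n (b n)).[p]),
          (forall m n, (1 <= m)%N -> (m < n)%N ->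
             bernstein_le n (bernstein m (a m)) (bernstein n (a n)) /\
             bernstein_le n (bernstein n (b n)) (bernstein m (b m))) &
          exists C : R, forall n x, (1 <= n)%N -> x \in `[0, 1] ->
            `|(bernstein n (b n)).[x] - (bernstein n (a n)).[x]|
              <= C * Delta n x `^ alpha]) /\
  (can_simulate f (fun n x => Delta n x `^ alpha) -> C_alpha01 alpha f).
Proof.
split=> [fC|]; last exact: C_alpha01_of_simulation.
have [a [b env]] := envelopes_exist hf alpha_gt0 alpha_nonint fC.
by split; [exact: simulate_envelopes env | exists a, b].
Qed.
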